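(* Let $F=\{F_i\}_{i=1,\dots,l}$ be an abelian (pairwise commuting) family of germs of holomorphic diffeomorphisms of $(\mathbb C^n,0)$, $F_i(x)=D_ix+f_i(x)$ with $f_i(0)=0$, $Df_i(0)=0$ and $D_i=\mathrm{diag}(\mu_{i,1},\dots,\mu_{i,n})$ invertible, and let $D=\{D_ix\}_{i=1,\dots,l}$. Let $x^{R_1},\dots,x^{R_p}$ be monomials generating the ring $\widehat{\mathcal O}_n^D$ of formal invariants of $D$, and let $\mathrm{ResIdeal}$ be the ideal of $\mathcal O_n$ they generate. Assume that $D$ is diophantine on $\mathrm{ResIdeal}$. If the non-linear centralizer of $D$ is generated by the $x^{R_i}$'s, then $F$ is holomorphically linearizable on $\mathrm{ResIdeal}$.
   Context: $\mathcal O_n$ is the ring of germs of holomorphic functions at $0\in\mathbb C^n$ and $\widehat{\mathcal O}_n$ the ring of formal power series. For $Q\in\mathbb N^n$: $|Q|=q_1+\dots+q_n$, $x^Q=x_1^{q_1}\cdots x_n^{q_n}$, $\mu_i^Q=\mu_{i,1}^{q_1}\cdots\mu_{i,n}^{q_n}$. The ring of formal invariants is $\widehat{\mathcal O}_n^D=\{f\in\widehat{\mathcal O}_n\mid f(D_ix)=f(x),\ i=1,\dots,l\}$; it is (formally) generated by finitely many monomials $x^{R_1},\dots,x^{R_p}$ ($R_i\neq 0$). For a monomial ideal $\mathcal I$ and $k\ge1$, $\omega_k(D,\mathcal I)=\inf\{\max_{1\le i\le l}|\mu_i^Q-\mu_{i,j}|\ne0\mid 2\le|Q|\le2^k,\ 1\le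 j\le n,\ Q\in\mathbb N^n,\ x^Q\notin\mathcal I\}$; $D$ is diophantine on $\mathcal I$ if $-\sum_{k\ge1}\frac{\ln\omega_k(D,\mathcal I)}{2^k}<+\infty$. ''The non-linear centralizer of $D$ is generated by the $x^{R_i}$'s'' means: if $\mu_i^Q=\mu_{i,j}$ for all $1\le i\le l$, for some $Q\in\mathbb N^n$ with $|Q|\ge2$ and some $1\le j\le n$, then $x^Q$ belongs to the ideal generated by $x^{R_1},\dots,x^{R_p}$. $F$ is holomorphically linearizable on $\mathcal I$ if there is a germ of holomorphic diffeomorphism $\Phi$ of $(\mathbb C^n,0)$, tangent to the identity at $0$, such that $\Phi\circ F_i\circ\Phi^{-1}-D_ix\in\mathcal I^n$ for all $1\le i\le l$. *)

(* Defs.v *)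
From HB Require Import structures.
From mathcomp Require Import all_boot all_order all_algebra.
From mathcomp Require Import complex.
From mathcomp Require Import all_classical all_reals all_analysis.

Set Implicit Arguments.
Unset Strict Implicit.
Unset Printing Implicit Defensive.

Import Order.TTheory GRing.Theory Num.Theory numFieldNormedType.Exports.

Local Open Scope classical_set_scope.
Local Open Scope ring_scope.
Local Open Scope complex_scope.

(* The topology of R[i] given by its modulus, as for any numFieldType. *)
HB.instance Definition _ (R : realType) :=
  NormedModule.copy R[i] (R[i] : numFieldType)^o.

Definition multiindex (n : nat) := {ffun 'I_n -> nat}.

Definition mdeg (n : nat) (Q : multiindex n) : nat := (\sum_(j < n) Q j)%N.

(* x^Q; also used for mu_i^Q, the vector mu_i being the diagonal of D_i. *)
Definition mpow (R : realType) (n : nat) (x : 'rV[R[i]]_n) (Q : multiindex n)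
  : R[i] := \prod_(j < n) x 0 j ^+ Q j.

(* Formal power series in n variables, as families of coefficients. *)
Definition fps (R : realType) (n : nat) := multiindex n -> R[i].

Definition box_multiindex (n N : nat) (Q : {ffun 'I_n -> 'I_N})
  : multiindex n := [ffun j => Q j : nat].

(* The power series c converges absolutely at x, with sum s. The partial sums
   are over the boxes {0, ..., N-1}^n, an exhaustion of N^n; by absolute
   convergence the choice of the exhaustion is immaterial. *)
Definition fps_sum_at (R : realType) (n : nat) (c : fps R n) (x : 'rV[R[i]]_n)
    (s : R[i]) : Prop :=
  (exists M : R[i], forall N : nat,
     \sum_(Q : {ffun 'I_n -> 'I_N})
        `|c (box_multiindex Q) * mpow x (box_multiindex Q)| <= M) /\
  (fun N : nat => \sum_(Q : {ffun 'I_n -> 'I_N})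
        c (box_multiindex Q) * mpow x (box_multiindex Q)) @ \oo --> s.

(* Germs at 0 are represented by total functions of which only the values
   near 0 matter. Holomorphic in several variables is taken in the sense of
   Weierstrass: near 0, the function is the sum of an absolutely convergent
   power series (O_n is the ring C{x_1, ..., x_n}). *)
Definition holomorphic_germ (R : realType) (n : nat) (f : 'rV[R[i]]_n -> R[i])
  : Prop :=
  exists c : fps R n, \forall x \near (0 : 'rV[R[i]]_n), fps_sum_at c x (f x).

Definition holomorphic_map_germ (R : realType) (n : nat)
    (F : 'rV[R[i]]_n -> 'rV[R[i]]_n) : Prop :=
  forall j : 'I_n, holomorphic_germ (fun x => F x 0 j).

(* F is a germ of biholomorphism of (C^n, 0), and G is its inverse germ. *)
Definition inverse_diffeo_germs (R : realType) (n : nat)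
    (F G : 'rV[R[i]]_n -> 'rV[R[i]]_n) : Prop :=
  [/\ F 0 = 0 /\ G 0 = 0,
      holomorphic_map_germ F,
      holomorphic_map_germ G,
      (\forall x \near (0 : 'rV[R[i]]_n), G (F x) = x) &
      (\forall x \near (0 : 'rV[R[i]]_n), F (G x) = x)].

Definition diffeo_germ (R : realType) (n : nat)
    (F : 'rV[R[i]]_n -> 'rV[R[i]]_n) : Prop :=
  exists G, inverse_diffeo_germs F G.

(* The ideal of O_n generated by the monomials x^(Rs 0), ..., x^(Rs (p-1)),
   as a set of (representatives of) germs. *)
Definition monomial_ideal (R : realType) (n p : nat) (Rs : 'I_p -> multiindex n)
  : set ('rV[R[i]]_n -> R[i]) :=
  [set h | exists g : 'I_p -> 'rV[R[i]]_n -> R[i],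
     (forall k, holomorphic_germ (g k)) /\
     \forall x \near (0 : 'rV[R[i]]_n), h x = \sum_(k < p) mpow x (Rs k) * g k x].

(* The formal series c(D x), for D the diagonal matrix with diagonal d. *)
Definition fps_diag (R : realType) (n : nat) (c : fps R n) (d : 'rV[R[i]]_n)
  : fps R n := fun Q => c Q * mpow d Q.

Definition formal_invariant (R : realType) (n l : nat)
    (mu : 'I_l -> 'rV[R[i]]_n) (c : fps R n) : Prop :=
  forall i : 'I_l, fps_diag c (mu i) = c.

Definition mcomb (n p : nat) (Rs : 'I_p -> multiindex n) (A : multiindex p)
  : multiindex n := [ffun j => (\sum_(k < p) A k * Rs k j)%N].

(* The formal series g(x^(Rs 0), ..., x^(Rs (p-1))), whose coefficient of x^Q
   is the sum of the g A over the A with sum_k A_k Rs_k = Q. When every Rs k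
   is nonzero, such an A has all its entries at most |Q|, so that the sum is
   over all of them. *)
Definition fps_mono_subst (R : realType) (n p : nat) (Rs : 'I_p -> multiindex n)
    (g : fps R p) : fps R n :=
  fun Q => \sum_(A : {ffun 'I_p -> 'I_(mdeg Q).+1} |
                  mcomb Rs (box_multiindex A) == Q) g (box_multiindex A).

(* The ring of formal invariants is C[[x^(Rs 0), ..., x^(Rs (p-1))]]. *)
Definition generate_invariants (R : realType) (n l p : nat)
    (mu : 'I_l -> 'rV[R[i]]_n) (Rs : 'I_p -> multiindex n) : Prop :=
  (forall k : 'I_p, Rs k != [ffun=> 0%N]) /\
  (forall c : fps R n,
     formal_invariant mu c <-> exists g : fps R p, c = fps_mono_subst Rs g).

(* max_i |mu_i^Q - mu_(i,j)|, a real number. *)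
Definition small_divisor (R : realType) (n l : nat) (mu : 'I_l -> 'rV[R[i]]_n)
    (Q : multiindex n) (j : 'I_n) : R :=
  \big[Num.max/0]_(i < l) Normc.normc (mpow (mu i) Q - mu i 0 j).

Definition omega (R : realType) (n l : nat) (mu : 'I_l -> 'rV[R[i]]_n)
    (I : set ('rV[R[i]]_n -> R[i])) (k : nat) : \bar R :=
  ereal_inf [set e | exists (Q : multiindex n) (j : 'I_n),
    [/\ (2 <= mdeg Q <= 2 ^ k)%N,
        ~ I (fun x => mpow x Q),
        small_divisor mu Q j != 0 &
        e = (small_divisor mu Q j)%:E]].

(* If there is no small divisor of degree at most 2^k then omega_k = +oo and
   the k-th term is 0, since fine +oo = 0 and ln 0 = 0. Otherwise omega_k is a
   positive real, a minimum over a finite set, and is nonincreasing in k; hence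
   the terms ln omega_k / 2^k are bounded above by a summable sequence and the
   series always has a sum in [-oo, +oo[. *)
Definition diophantine (R : realType) (n l : nat) (mu : 'I_l -> 'rV[R[i]]_n)
    (I : set ('rV[R[i]]_n -> R[i])) : Prop :=
  (- (\sum_(1 <= k <oo) (ln (fine (omega mu I k)) / 2 ^+ k)%:E) < +oo)%E.

Definition centralizer_generated (R : realType) (n l p : nat)
    (mu : 'I_l -> 'rV[R[i]]_n) (Rs : 'I_p -> multiindex n) : Prop :=
  forall (Q : multiindex n) (j : 'I_n),
    (2 <= mdeg Q)%N -> (forall i : 'I_l, mpow (mu i) Q = mu i 0 j) ->
    monomial_ideal Rs (fun x : 'rV[R[i]]_n => mpow x Q).

(* Vectors of C^n are rows, so that D_i x is x *m diag_mx (mu i). *)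
Definition holomorphically_linearizable (R : realType) (n l : nat)
    (mu : 'I_l -> 'rV[R[i]]_n) (F : 'I_l -> 'rV[R[i]]_n -> 'rV[R[i]]_n)
    (I : set ('rV[R[i]]_n -> R[i])) : Prop :=
  exists Phi Psi : 'rV[R[i]]_n -> 'rV[R[i]]_n,
    [/\ inverse_diffeo_germs Phi Psi,
        is_diff 0 Phi id &
        forall (i : 'I_l) (j : 'I_n),
          I (fun x => (Phi (F i (Psi x)) - x *m diag_mx (mu i)) 0 j)].

(* Main.v *)
(* The conjugacy [F_i o Psi = Psi o D_i], read modulo the monomial ideal [I], is
   a semilinear equation for [Psi = x + psi]: for [x^Q] outside [I],
     (mu_i^Q - mu_ij) psi_jQ = [f_ij (x + psi)]_Q.
   The hypothesis on the centralizer makes some divisor nonzero, commutation of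
   the [F_i] makes the equations for the various [i] compatible (by induction
   on [|Q|]), so dividing by the largest divisor defines [psi]. It converges by
   Siegel's majorant method: if [exp lam] is a superadditive weight absorbing
   the divisors, the l^1 norm of [psi] with weights [rho^|Q| exp (- lam Q)] is
   bounded by induction on the degree of truncation. Such a [lam] of linear
   growth is given by Bruno's counting of the small divisors; divisors in
   direction [j] at [Q] and [Q + P] cannot both be small unless [|P|] is large,
   as [P + e_s <= Q + P] for some [s], so that [x^(P + e_s)] is outside [I].
   Finally [Phi] is the inverse of [Psi], and every coefficient of
   [Phi o F_i o Psi - D_i] outside [I] vanishes. *)
From HB Require Import structures.
From mathcomp Require Import all_boot all_order all_algebra.
From mathcomp Require Import complex ring lra zify.
From mathcomp Require Import all_classical all_reals all_analysis.
From mathcomp Require mpoly ssrcomplements.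
Import -(notations) mpoly.
Require Import Defs.
Set Implicit Arguments.
Unset Strict Implicit.
Unset Printing Implicit Defensive.
Import Order.TTheory GRing.Theory Num.Theory numFieldNormedType.Exports.
Local Open Scope classical_set_scope.
Local Open Scope ring_scope.
Local Open Scope complex_scope.

(** Two structural facts carry the argument. The complement of a monomial ideal is closed under
    divisors, so agreement of coefficients there is stable under products and compositions, and the
    equation makes sense modulo the ideal. And the nonlinear part has order two: each coefficient of
    f (x + psi) is built from products of at least two nonconstant factors. Hence the recursion is
    triangular in the degree, and a weight with exp (lam P + lam Q) <= div exp (lam (P + Q)) absorbs
    the divisor at the outermost multiplication. No infinite sum is formed. A series is its family
    of coefficients, convergence is a bound uniform in the polynomial truncations, and a germ is
    tied to its series by geometric remainders. For the same reason [lam] need only work up to a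
    degree [L], provided that its growth rate [K] does not depend on [L]: the radius obtained is rho
    exp (- K). *)

Local Notation mdg := mpoly.mdeg.
Local Notation normc := Normc.normc.

(** * The real-valued modulus of complex numbers *)

Section ComplexModulus.
Variable R : realType.
Implicit Types z w : R[i].

Lemma complex_normE z : `|z| = (normc z)%:C. Proof. by []. Qed.

Lemma normc_ge0 z : 0 <= normc z.
Proof. by rewrite -ler0c -complex_normE. Qed.

Lemma normcD z w : normc (z + w) <= normc z + normc w.
Proof. exact: (@le_normcD R z w). Qed.

Lemma normcB z w : normc (z - w) <= normc z + normc w.
Proof. by rewrite -[normc w](@normcN R w); exact: normcD. Qed.

Lemma normc_eq0 z : (normc z == 0) = (z == 0).
Proof.
by apply/eqP/eqP => [/Normc.eq0_normc|->]; last exact: Normc.normc0.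
Qed.

Lemma normc_gt0 z : (0 < normc z) = (z != 0).
Proof. by rewrite lt_def normc_ge0 andbT normc_eq0. Qed.

Lemma normcXn z k : normc (z ^+ k) = normc z ^+ k.
Proof.
by elim: k => [|k IH]; rewrite ?expr0 ?Normc.normc1 // !exprS Normc.normcM IH.
Qed.

Lemma normc_sum (I : Type) (r : seq I) (P : pred I) (F : I -> R[i]) :
  normc (\sum_(i <- r | P i) F i) <= \sum_(i <- r | P i) normc (F i).
Proof.
elim/big_rec2 : _ => [|i x y _ xy]; first by rewrite Normc.normc0.
by apply: le_trans (normcD _ _) _; rewrite lerD2l.
Qed.

Lemma normc_prod (I : Type) (r : seq I) (P : pred I) (F : I -> R[i]) :
  normc (\prod_(i <- r | P i) F i) = \prod_(i <- r | P i) normc (F i).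
Proof.
elim/big_rec2 : _ => [|i x y _ xy]; first by rewrite Normc.normc1.
by rewrite Normc.normcM xy.
Qed.

End ComplexModulus.

(** * Weighted norms and truncations of polynomials *)

(* Sealed: conversion tests between two such products would otherwise unfold
   the polynomial arithmetic. *)
HB.lock Definition mprod (n : nat) (S : nzRingType) (g : 'I_n -> S)
  (m : multinom n) : S := mmap1 g m.

Section PolyNorm.
Variables (R : realType) (n : nat).
Local Notation mon := (multinom n).
Local Notation mp := (mpoly n R[i]).
Implicit Types (p q : mp) (w : mon -> R) (m : mon).

Definition wnorm w p : R := \sum_(m <- msupp p) w m * normc (mcoeff m p).

(** A bound on the size replaces the support by an index set independent of [p], so that norms of
    several polynomials can be compared term by term. *)
Lemma wnormE k w p : (mmeasure mdg p <= k)%N ->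
  wnorm w p = \sum_(m : bmultinom n k) w m * normc (mcoeff m p).
Proof.
move=> lpk; rewrite /wnorm (ssrcomplements.big_mksub (bmultinom n k)) ?msupp_uniq //=.
  rewrite big_rmcond //= => j /memN_msupp_eq0 ->.
  by rewrite Normc.normc0 mulr0.
by move=> x /mmeasure_mnm_lt /leq_trans; apply.
Qed.

Lemma ler_wnorm w w' p p' :
  (forall m, w m * normc (mcoeff m p) <= w' m * normc (mcoeff m p')) ->
  wnorm w p <= wnorm w' p'.
Proof.
move=> le_w; pose k := maxn (mmeasure mdg p) (mmeasure mdg p').
by rewrite !(@wnormE k) ?leq_maxl ?leq_maxr// ler_sum.
Qed.

Lemma wnorm_ge0 w p : (forall m, 0 <= w m) -> 0 <= wnorm w p.
Proof. by move=> w0; apply: sumr_ge0 => m _; rewrite mulr_ge0 ?normc_ge0. Qed.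

Lemma wnorm0 w : wnorm w 0 = 0.
Proof. by rewrite /wnorm msupp0 big_nil. Qed.

Lemma wnormD w p q : (forall m, 0 <= w m) ->
  wnorm w (p + q) <= wnorm w p + wnorm w q.
Proof.
move=> w0.
pose k := maxn (mmeasure mdg (p + q)) (maxn (mmeasure mdg p) (mmeasure mdg q)).
rewrite !(@wnormE k) ?leq_max ?leqnn ?orbT //.
rewrite -big_split /=; apply: ler_sum => m _.
by rewrite -mulrDr mcoeffD ler_wpM2l // normcD.
Qed.

Lemma wnorm_sum w (I : Type) (r : seq I) (P : pred I) (F : I -> mp) :
  (forall m, 0 <= w m) ->
  wnorm w (\sum_(i <- r | P i) F i) <= \sum_(i <- r | P i) wnorm w (F i).
Proof.
move=> w0; elim/big_rec2 : _ => [|i x y _ xy]; first by rewrite wnorm0.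
by apply: le_trans (wnormD _ _ w0) _; rewrite lerD2l.
Qed.

Lemma wnormZ w c p : wnorm w (c *: p) = normc c * wnorm w p.
Proof.
pose k := maxn (mmeasure mdg (c *: p)) (mmeasure mdg p).
rewrite !(@wnormE k) ?leq_maxl ?leq_maxr// mulr_sumr.
by apply: eq_bigr => m _; rewrite mcoeffZ Normc.normcM mulrCA.
Qed.

Lemma wnormX w m : wnorm w (mpolyX R[i] m) = w m.
Proof. by rewrite /wnorm msuppX big_seq1 mcoeffX eqxx Normc.normc1 mulr1. Qed.

Lemma wnorm1 w : wnorm w 1 = w (@mnm0 n).
Proof. by rewrite -(mpolyX0 n R[i]) wnormX. Qed.

(** Three weights, and a condition only on the monomials that occur: a weight which is controlled
    only on sums of nonconstant monomials can then be used on factors without constant term. *)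
Lemma wnormM w1 w2 w3 p q :
  (forall m, 0 <= w3 m) ->
  (forall m m', m \in msupp p -> m' \in msupp q ->
     w3 (mnm_add m m') <= w1 m * w2 m') ->
  wnorm w3 (p * q) <= wnorm w1 p * wnorm w2 q.
Proof.
move=> w0 w3le; rewrite mpolyME.
apply: le_trans (wnorm_sum _ _ _ w0) _.
rewrite big_allpairs /(wnorm w1 p) /(wnorm w2 q) mulr_suml.
rewrite big_seq [leRHS]big_seq; apply: ler_sum => m mp_.
rewrite mulr_sumr big_seq [leRHS]big_seq; apply: ler_sum => m' mq /=.
rewrite wnormZ wnormX Normc.normcM mulrC mulrACA ler_wpM2r ?w3le//.
by rewrite mulr_ge0 // normc_ge0.
Qed.

Definition submul w := forall m m', w (mnm_add m m') <= w m * w m'.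

Lemma mprodE (S : nzRingType) (g : 'I_n -> S) m : mprod g m = mmap1 g m.
Proof. by rewrite unlock. Qed.

Lemma mprod0 (S : comNzRingType) (g : 'I_n -> S) : mprod g (@mnm0 n) = 1.
Proof. by rewrite unlock mmap11. Qed.

Lemma mprod_addU (S : comNzRingType) (g : 'I_n -> S) i m :
  mprod g (mnm_add (mnm1 i) m) = g i * mprod g m.
Proof.
by rewrite unlock commr_mmap1_M ?mmap1U // => j x; exact: mulrC.
Qed.

Lemma mon_ind (P : mon -> Prop) :
  P (@mnm0 n) -> (forall i m, P m -> P (mnm_add (mnm1 i) m)) -> forall m, P m.
Proof.
move=> P0 PS m; have [k] := ubnP (mdg m); elim: k m => // k IH m.
have [->//|m0 mk] := eqVneq m (@mnm0 n).
have [i mi] : exists i, m i != 0%N.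
  apply/existsP; apply: contraNT m0 => /existsPn m0.
  by apply/eqP/mnmP => i; rewrite mnm0E; apply/eqP; rewrite -[_ == _]negbK.
have := mi; rewrite -lep1mP => /submK <-; rewrite addmC; apply/PS/IH.
have := mk; rewrite -{1}[m](@submK _ (mnm1 i)) ?lep1mP //.
by rewrite mdegD mdeg1 addn1.
Qed.

Lemma wnorm_mprod w (g : 'I_n -> mp) r m :
  (forall m, 0 <= w m) -> submul w -> w (@mnm0 n) <= 1 -> 0 <= r ->
  (forall i, wnorm w (g i) <= r) -> wnorm w (mprod g m) <= r ^+ mdg m.
Proof.
move=> w0 wM w1 r0 gr; elim/mon_ind: m => [|i m IH].
  by rewrite mprod0 mdeg0 expr0 wnorm1.
rewrite mprod_addU mdegD mdeg1 exprS.
apply: le_trans (wnormM (w1 := w) (w2 := w) _ _) _ => //.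
by rewrite ler_pM ?wnorm_ge0.
Qed.

Lemma mcoeff0M p q : mcoeff (@mnm0 n) (p * q) = mcoeff (@mnm0 n) p * mcoeff (@mnm0 n) q.
Proof. exact: (rmorphM (mcoeff (@mnm0 n))). Qed.

Lemma mnm_neq0 m : m != @mnm0 n -> exists i m', m = mnm_add (mnm1 i) m'.
Proof. by elim/mon_ind: m => [|i m _ _]; [rewrite eqxx|exists i, m]. Qed.

Lemma mcoeff0_mprod (g : 'I_n -> mp) m :
  (forall i, mcoeff (@mnm0 n) (g i) = 0) -> m != @mnm0 n ->
  mcoeff (@mnm0 n) (mprod g m) = 0.
Proof.
by move=> g0 /mnm_neq0[i [m' ->]]; rewrite mprod_addU mcoeff0M g0 mul0r.
Qed.

Lemma msupp_neq0 p m : mcoeff (@mnm0 n) p = 0 -> m \in msupp p -> m != @mnm0 n.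
Proof.
move=> p0; rewrite mcoeff_msupp; apply: contraNneq => ->.
by rewrite p0.
Qed.

(** One factor is split off; since [m] has degree at least two, the remaining product has no
    constant term either. The stronger weight [w'] is paid once, at this outermost multiplication,
    and [w] serves for the rest. *)
Lemma wnorm_mprod_gain w w' (g : 'I_n -> mp) r m :
  (forall m, 0 <= w m) -> submul w -> w (@mnm0 n) <= 1 -> 0 <= r ->
  (forall m, 0 <= w' m) ->
  (forall m m', m != @mnm0 n -> m' != @mnm0 n ->
     w' (mnm_add m m') <= w m * w m') ->
  (forall i, wnorm w (g i) <= r) -> (forall i, mcoeff (@mnm0 n) (g i) = 0) ->
  (1 < mdg m)%N -> wnorm w' (mprod g m) <= r ^+ mdg m.
Proof.
move=> w0 wM w1 r0 w'0 w'le gr g0 m2.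
have m0 : m != @mnm0 n by rewrite -mdeg_eq0 -lt0n ltnW.
move/mnm_neq0: (m0) => [i [m' em]]; move: m2; rewrite em mdegD mdeg1 ltnS.
rewrite lt0n mdeg_eq0 => m'0; rewrite mprod_addU exprS.
apply: le_trans (wnormM (w1 := w) (w2 := w) _ _) _ => //.
  move=> a b ain bin; apply: w'le; first exact: msupp_neq0 ain.
  by apply: msupp_neq0 bin; exact: mcoeff0_mprod.
by rewrite ler_pM ?wnorm_ge0 // wnorm_mprod.
Qed.

End PolyNorm.

(** * Composition of polynomials and congruences on sets of monomials *)

HB.lock Definition pcomp (R : realType) (n : nat) (g : 'I_n -> mpoly n R[i])
  (p : mpoly n R[i]) : mpoly n R[i] := mmap (@mpolyC n R[i]) g p.

Section PolyComp.
Variables (R : realType) (n : nat).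
Local Notation mon := (multinom n).
Local Notation mp := (mpoly n R[i]).
Implicit Types (p q : mp) (w : mon -> R) (m : mon) (g : 'I_n -> mp).

Lemma pcomp_mmap g p : pcomp g p = mmap (@mpolyC n R[i]) g p.
Proof. by rewrite unlock. Qed.

Lemma pcompD g p q : pcomp g (p + q) = pcomp g p + pcomp g q.
Proof. by rewrite unlock raddfD. Qed.

Lemma pcompZ g c p : pcomp g (c *: p) = c *: pcomp g p.
Proof. by rewrite unlock mmapZ mul_mpolyC. Qed.

Lemma pcompE k g p : (mmeasure mdg p <= k)%N ->
  pcomp g p = \sum_(m : bmultinom n k) mcoeff m p *: mprod g m.
Proof.
move=> pk; rewrite unlock (mmapE k) //; apply: eq_bigr => m _.
by rewrite mul_mpolyC unlock.
Qed.

Lemma wnorm_pcomp w w' g p :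
  (forall m, 0 <= w m) ->
  (forall m, m \in msupp p -> wnorm w (mprod g m) <= w' m) ->
  wnorm w (pcomp g p) <= wnorm w' p.
Proof.
move=> w0 gw; rewrite unlock /mmap.
apply: le_trans (wnorm_sum _ _ _ w0) _.
rewrite /(wnorm w' p) big_seq [leRHS]big_seq; apply: ler_sum => m mp_.
rewrite mul_mpolyC wnormZ mulrC ler_wpM2r ?normc_ge0 //.
by have := gw m mp_; rewrite unlock.
Qed.

(** The target ring is arbitrary: polynomials as target give the associativity of composition,
    scalars its evaluation at a point. *)
Lemma mmap_pcomp (S : comNzRingType) (f : {rmorphism R[i] -> S}) (h : 'I_n -> S) g p :
  mmap f h (pcomp g p) = mmap f (fun i => mmap f h (g i)) p.
Proof.
rewrite unlock [X in mmap f h X]/mmap rmorph_sum /=; apply: eq_bigr => m _.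
rewrite rmorphM /= mmapC -!mprodE; congr (_ * _).
elim/mon_ind: m => [|i m IH]; first by rewrite !mprod0 rmorph1.
by rewrite !mprod_addU rmorphM /= IH.
Qed.

Lemma pcompA h g p : pcomp h (pcomp g p) = pcomp (fun i => pcomp h (g i)) p.
Proof. rewrite [LHS]pcomp_mmap mmap_pcomp pcomp_mmap; congr (mmap _ _ p).
by apply/funext => i; rewrite pcomp_mmap. Qed.

Lemma meval_pcomp (x : 'I_n -> R[i]) g p :
  meval x (pcomp g p) = meval (fun i => meval x (g i)) p.
Proof. exact: mmap_pcomp. Qed.

Lemma pcompX g i : pcomp g (mpolyX _ (mnm1 i)) = g i.
Proof. by rewrite unlock mmapX mmap1U. Qed.

(** Congruence modulo the span of the monomials not in [P]; this span is an ideal when [P] is closed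
    under divisors. *)
Definition eqon (P : pred mon) p q := forall m, P m -> mcoeff m p = mcoeff m q.

Lemma eqon_trans P p q r : eqon P p q -> eqon P q r -> eqon P p r.
Proof. by move=> pq qr m Pm; rewrite pq ?qr. Qed.

Lemma eqon_sym P p q : eqon P p q -> eqon P q p.
Proof. by move=> pq m Pm; rewrite pq. Qed.

Lemma eqonM_gen (P : pred mon) p p' q q' :
  (forall m m', P (mnm_add m m') ->
     mcoeff m p * mcoeff m' q = mcoeff m p' * mcoeff m' q') ->
  eqon P (p * q) (p' * q').
Proof.
move=> e m Pm; rewrite !mcoeffM; apply: eq_bigr => k /eqP km.
by apply: e; rewrite -km.
Qed.

Definition down_closed (P : pred mon) :=
  forall m m', P (mnm_add m m') -> P m /\ P m'.

Lemma eqonM P p p' q q' : down_closed P ->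
  eqon P p p' -> eqon P q q' -> eqon P (p * q) (p' * q').
Proof.
move=> dP pp' qq'; apply: eqonM_gen => m m' /dP[Pm Pm'].
by rewrite pp' ?qq'.
Qed.

Lemma eqon_sum P (I : Type) (r : seq I) (Q : pred I) (F G : I -> mp) :
  (forall i, Q i -> eqon P (F i) (G i)) ->
  eqon P (\sum_(i <- r | Q i) F i) (\sum_(i <- r | Q i) G i).
Proof.
move=> FG m Pm; rewrite !raddf_sum /=; apply: eq_bigr => i Qi.
exact: FG.
Qed.

Lemma eqonZ P c p q : eqon P p q -> eqon P (c *: p) (c *: q).
Proof. by move=> pq m Pm; rewrite !mcoeffZ pq. Qed.

Lemma eqon_mprod P g g' m : down_closed P -> (forall i, eqon P (g i) (g' i)) ->
  eqon P (mprod g m) (mprod g' m).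
Proof.
move=> dP gg'; elim/mon_ind: m => [|i m IH]; first by rewrite !mprod0.
by rewrite !mprod_addU; apply: eqonM.
Qed.

Lemma eqon_pcomp P g g' p : down_closed P -> (forall i, eqon P (g i) (g' i)) ->
  eqon P (pcomp g p) (pcomp g' p).
Proof.
move=> dP gg'; rewrite !(pcompE _ (leqnn _)).
by apply: eqon_sum => m _; apply/eqonZ/eqon_mprod.
Qed.

(** A coefficient on [P] of a product of two factors without constant term only involves their
    coefficients at nonconstant parts, hence on [Q]. With [P] the degrees at most d and [Q] the
    degrees below d, this is the triangularity of the conjugacy equation. *)
Lemma eqon_mprod_gain (P Q : pred mon) g g' m :
  down_closed Q ->
  (forall m m', m != @mnm0 n -> m' != @mnm0 n -> P (mnm_add m m') -> Q m /\ Q m') ->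
  (forall i, eqon Q (g i) (g' i)) ->
  (forall i, mcoeff (@mnm0 n) (g i) = 0) -> (forall i, mcoeff (@mnm0 n) (g' i) = 0) ->
  (1 < mdg m)%N -> eqon P (mprod g m) (mprod g' m).
Proof.
move=> dQ PQ gg' g0 g'0 m2.
have m0 : m != @mnm0 n by rewrite -mdeg_eq0 -lt0n ltnW.
move/mnm_neq0: (m0) => [i [m' em]]; move: m2; rewrite em mdegD mdeg1 ltnS.
rewrite lt0n mdeg_eq0 => m'0; rewrite !mprod_addU; apply: eqonM_gen => a b Pab.
have [->|a0] := eqVneq a (@mnm0 n).
  by rewrite (g0 i) (g'0 i); apply: etrans (mul0r _) (esym (mul0r _)).
have [->|b0] := eqVneq b (@mnm0 n).
  rewrite (mcoeff0_mprod g0 m'0) (mcoeff0_mprod g'0 m'0).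
  by apply: etrans (mulr0 _) (esym (mulr0 _)).
have [Qa Qb] := PQ _ _ a0 b0 Pab; 
exact: (f_equal2 *%R (gg' i a Qa) (eqon_mprod m' dQ gg' Qb)).
Qed.

Lemma eqon_pcomp_gain (P Q : pred mon) g g' p :
  down_closed Q ->
  (forall m m', m != @mnm0 n -> m' != @mnm0 n -> P (mnm_add m m') -> Q m /\ Q m') ->
  (forall i, eqon Q (g i) (g' i)) ->
  (forall i, mcoeff (@mnm0 n) (g i) = 0) -> (forall i, mcoeff (@mnm0 n) (g' i) = 0) ->
  (forall m, (mdg m < 2)%N -> mcoeff m p = 0) ->
  eqon P (pcomp g p) (pcomp g' p).
Proof.
move=> dQ PQ gg' g0 g'0 p2; rewrite !(pcompE _ (leqnn _)).
apply: eqon_sum => m _; have [m2|m2] := ltnP (mdg m) 2.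
  rewrite p2 //; apply: (@eqon_trans _ _ 0) => a _;
  by rewrite mcoeffZ mul0r mcoeff0.
exact/eqonZ/(eqon_mprod_gain dQ PQ).
Qed.

Lemma mprod_low g m k : (forall i, mcoeff (@mnm0 n) (g i) = 0) ->
  (mdg k < mdg m)%N -> mcoeff k (mprod g m) = 0.
Proof.
move=> g0; elim/mon_ind: m k => [|i m IH] k; first by rewrite mdeg0.
rewrite mdegD mdeg1 add1n ltnS => km; rewrite mprod_addU mcoeffM.
apply: big1 => -[a b] /= /eqP kab.
have [->|a0] := eqVneq (a : mon) (@mnm0 n); first by rewrite (g0 i) mul0r.
rewrite [X in _ * X]IH ?mulr0 //; 
have dk := congr1 mdg kab; rewrite mdegD in dk.
by move: a0 km dk; rewrite -mdeg_eq0; lia.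
Qed.

(** When [g] vanishes at 0, the power of [g] with exponent [m] has order at least |m|, so
    coefficients of [p] of degree [N] or more do not reach the degrees below [N]. *)
Lemma eqon_pcompl N g p p' : (forall i, mcoeff (@mnm0 n) (g i) = 0) ->
  eqon (fun m => mdg m < N)%N p p' ->
  eqon (fun m => mdg m < N)%N (pcomp g p) (pcomp g p').
Proof.
move=> g0 pp' m mN; pose k := maxn (mmeasure mdg p) (mmeasure mdg p').
rewrite !(@pcompE k) ?leq_maxl ?leq_maxr // !raddf_sum /=; apply: eq_bigr => a _.
rewrite !mcoeffZ; have [aN|aN] := ltnP (mdg a) N; first by rewrite pp'.
by rewrite mprod_low ?mulr0 // (leq_trans mN).
Qed.

Lemma down_closed_deg N : down_closed (fun m => mdg m < N)%N.
Proof. by move=> m m'; rewrite mdegD => h; split; lia. Qed.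

Definition trunc N (c : mon -> R[i]) : mp :=
  \sum_(m : bmultinom n N) c m *: mpolyX R[i] m.

Lemma mcoeff_trunc N c m : mcoeff m (trunc N c) = if (mdg m < N)%N then c m else 0.
Proof.
case: ltnP => h; first exact: mcoeff_mpoly.
rewrite raddf_sum /= big1 // => a _; rewrite mcoeffZ mcoeffX.
case: eqP => [am|]; rewrite ?mulr0 //.
by have := bmdeg a; rewrite am ltnNge h.
Qed.

Lemma msize_trunc N c : (mmeasure mdg (trunc N c) <= N)%N.
Proof.
rewrite mmeasureE big_seq; apply/bigmax_leqP_seq => m mt _.
move: mt; rewrite mcoeff_msupp mcoeff_trunc; case: ltnP => //.
by rewrite eqxx.
Qed.

Lemma wnorm_trunc N w c :
  wnorm w (trunc N c) = \sum_(m : bmultinom n N) w m * normc (c m).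
Proof.
rewrite (wnormE _ (msize_trunc _ _)); apply: eq_bigr => m _.
by rewrite mcoeff_trunc bmdeg.
Qed.

Lemma eqon_trunc N M c : (N <= M)%N ->
  eqon (fun m => mdg m < N)%N (trunc N c) (trunc M c).
Proof. by move=> NM m mN; rewrite !mcoeff_trunc mN (leq_trans mN). Qed.

End PolyComp.

(** * Bruno's count of the small divisors *)

Section Counting.
Variables (n : nat).
Local Notation mon := (multinom n).
Implicit Types (P Q : mon) (bad : pred mon).

(* [cnt bad Q c]: some binary decomposition tree of [Q] into nonzero parts has
   exactly [c] inner nodes satisfying [bad]. *)
Inductive cnt bad : mon -> nat -> Prop :=
| cnt_leaf Q : cnt bad Q 0
| cnt_node P Q a b : P != @mnm0 n -> Q != @mnm0 n -> cnt bad P a -> cnt bad Q b ->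
    cnt bad (mnm_add P Q) (a + b + bad (mnm_add P Q)).

Lemma cnt_le_deg bad Q c : cnt bad Q c -> (c <= (mdg Q).-1)%N.
Proof.
elim=> [//|P {}Q a b]; rewrite -!mdeg_eq0 mdegD => P0 Q0 _ Pa _ Qb.
by case: (bad _); lia.
Qed.

(* Bruno's counting argument. The second conjunct is the induction
   strengthening: it bounds the count of [Q] when [Q] hangs below a bad [P]. *)
Lemma cnt_bound bad M Q c :
  (forall Q, bad Q -> (2 * M < mdg Q)%N) ->
  (forall P Q, P != @mnm0 n -> bad Q -> bad (mnm_add Q P) -> (2 * M <= mdg P)%N) ->
  cnt bad Q c ->
  (c = 0%N \/ (c.+1 * M <= mdg Q)%N) /\
  (forall P, P != @mnm0 n -> bad (mnm_add Q P) ->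
     (c.+2 * M <= mdg (mnm_add Q P))%N).
Proof.
move=> big_bad gap; elim=> [{}Q|P {}Q a b P0 Q0 _ [IP1 IP2] _ [IQ1 IQ2]].
  by split=> [|P P0 /big_bad]; [left|lia].
split.
  (* If one branch has no bad node, the bound of the other, which hangs below the bad root, already
     contains the two extra [M]; if both have some, each brings one [M] by its first conjunct. *)
  case: (boolP (bad _)) => bPQ.
    right; have := IP2 _ Q0 bPQ; have := IQ2 P P0; rewrite addmC bPQ => /(_ isT).
    move: (big_bad _ bPQ); rewrite !mdegD.
    by case: IP1 => [->|?]; case: IQ1 => [->|?]; lia.
  by rewrite !mdegD; case: IP1 => [->|?]; case: IQ1 => [->|?]; (try by left); right; lia.
move=> P' P'0 bPQP'; have := big_bad _ bPQP'; rewrite !mdegD.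
(* Two nested bad sums: [gap] makes the degree of [P'] pay for the node at [P + Q]. *)
case: (boolP (bad (mnm_add P Q))) => bPQ.
  have := gap _ _ P'0 bPQ bPQP'; have := IP2 _ Q0 bPQ.
  have := IQ2 P P0; rewrite addmC bPQ => /(_ isT); rewrite !mdegD.
  by case: IP1 => [->|?]; case: IQ1 => [->|?]; lia.
have nz A B : B != @mnm0 n -> mnm_add A B != @mnm0 n.
  by rewrite -!mdeg_eq0 mdegD; lia.
have := IP2 _ (nz Q P' P'0); rewrite addmA bPQP' => /(_ isT).
have := IQ2 _ (nz P P' P'0); rewrite addmA (addmC Q) bPQP' => /(_ isT).
rewrite !mdegD; by case: IP1 => [->|?]; case: IQ1 => [->|?]; lia.
Qed.

Lemma cntb_ex bad Q : exists c, `[< cnt bad Q c >].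
Proof. by exists 0%N; apply/asboolP; exact: cnt_leaf. Qed.

Lemma cntb_ub bad Q c : `[< cnt bad Q c >] -> (c <= (mdg Q).-1)%N.
Proof. by move/asboolP/cnt_le_deg. Qed.

(** Two trees can be joined at a new root, so the maximum over all trees is superadditive by
    construction, with an extra unit when the sum is bad. *)
Definition maxcnt bad Q : nat := ex_maxn (cntb_ex bad Q) (@cntb_ub bad Q).

Lemma maxcntP bad Q : cnt bad Q (maxcnt bad Q).
Proof. by rewrite /maxcnt; case: ex_maxnP => c /asboolP. Qed.

Lemma maxcnt_max bad Q c : cnt bad Q c -> (c <= maxcnt bad Q)%N.
Proof.
by move=> cQ; rewrite /maxcnt; case: ex_maxnP => d _; apply; exact/asboolP.
Qed.

Lemma maxcnt_super bad P Q : P != @mnm0 n -> Q != @mnm0 n ->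
  (maxcnt bad P + maxcnt bad Q + bad (mnm_add P Q) <= maxcnt bad (mnm_add P Q))%N.
Proof. by move=> P0 Q0; apply/maxcnt_max/cnt_node => //; exact: maxcntP. Qed.

Lemma maxcnt0 bad : maxcnt bad (@mnm0 n) = 0%N.
Proof. by have := cnt_le_deg (maxcntP bad (@mnm0 n)); rewrite mdeg0; lia. Qed.

Lemma maxcnt_superW bad P Q :
  (maxcnt bad P + maxcnt bad Q <= maxcnt bad (mnm_add P Q))%N.
Proof.
have [->|P0] := eqVneq P (@mnm0 n); first by rewrite maxcnt0 add0m.
have [->|Q0] := eqVneq Q (@mnm0 n); first by rewrite maxcnt0 addm0 addn0.
by apply: leq_trans (maxcnt_super bad P0 Q0); rewrite leq_addr.
Qed.

Lemma maxcnt_bound bad M Q :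
  (forall Q, bad Q -> (2 * M < mdg Q)%N) ->
  (forall P Q, P != @mnm0 n -> bad Q -> bad (mnm_add Q P) -> (2 * M <= mdg P)%N) ->
  (maxcnt bad Q * M <= mdg Q)%N.
Proof.
by move=> b1 b2; case: (cnt_bound b1 b2 (maxcntP bad Q)) => -[->|]; lia.
Qed.

End Counting.

(** * From the counts to a superadditive weight of linear growth *)

Section BrjunoWeight.
Variables (R : realType) (n : nat).
Local Notation mon := (multinom n).
Implicit Types (P Q : mon).

(* [gained S div K]: for every degree [L] there are logarithmic weights
   absorbing the divisors [div] on [S] up to degree [L], of growth rate at most
   [K] independently of [L]. *)
Definition gained (S : pred mon) (div : 'I_n -> mon -> R) (K : R) : Prop :=
  forall L : nat, exists lam : mon -> R,
  [/\ (forall Q, 0 <= lam Q), (forall Q, lam Q <= K * (mdg Q)%:R),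
      (forall P Q, lam P + lam Q <= lam (mnm_add P Q)) &
      (forall j P Q, P != @mnm0 n -> Q != @mnm0 n -> S (mnm_add P Q) ->
         (mdg (mnm_add P Q) <= L)%N ->
         expR (lam P + lam Q) <= div j (mnm_add P Q) * expR (lam (mnm_add P Q)))].

Variables (S : pred mon) (div : 'I_n -> mon -> R) (u : nat -> R) (theta U : R).
Hypothesis theta_gt0 : 0 < theta.
Hypothesis theta_le1 : theta <= 1.
Hypothesis u_ge0 : forall k, 0 <= u k.
Hypothesis div_ge : forall k j Q, S Q -> (2 <= mdg Q <= 2 ^ k.+1)%N ->
  expR (- u k.+1) <= div j Q.
Hypothesis div_gap : forall k j P Q, S (mnm_add Q P) -> P != @mnm0 n ->
  (2 <= mdg Q)%N ->
  div j Q < theta * expR (- u k.+1) ->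
  div j (mnm_add Q P) < theta * expR (- u k.+1) -> (2 ^ k.+1 <= mdg P)%N.
Hypothesis u_sum : forall N, \sum_(k < N) u k.+1 / 2 ^+ k.+1 <= U.

Let bad k j : pred mon :=
  fun Q => [&& S Q, (2 <= mdg Q)%N & div j Q < theta * expR (- u k.+1)].

Let c k := u k.+1 - ln theta.

Let c_ge0 k : 0 <= c k.
Proof. by rewrite subr_ge0 (le_trans _ (u_ge0 _)) // ln_le0. Qed.

Let expRc k : expR (- c k) = theta * expR (- u k.+1).
Proof. by rewrite opprB expRD lnK // posrE. Qed.

Let bad_bound k j Q : (maxcnt (bad k j) Q * 2 ^ k <= mdg Q)%N.
Proof.
apply: maxcnt_bound => [{}Q /and3P[SQ Q2]|P {}Q P0 /and3P[SQ Q2 d1] /and3P[SQP _ d2]].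
  rewrite -expnS ltnNge; apply: contraTN => Qk; rewrite -leNgt.
  apply: (le_trans _ (div_ge (k := k) j SQ _)); last by rewrite Q2.
  by rewrite ger_pMl ?expR_gt0.
by rewrite -expnS; exact: (div_gap SQP P0 Q2 d1 d2).
Qed.

(** If the divisor at a sum lies in the interval from [expR (- c k.+1)] to [expR (- c k)], the sum
    is bad at level [k] and that count pays [c k.+1]. A divisor above [expR (- c 0)] is paid by the
    degree term, which gains [c 0] whenever two nonzero parts are joined. The sum over [j] is there
    because the gap holds for a fixed direction only. *)
Let lam L Q : R := c 0 * (mdg Q).-1%:R +
  \sum_(k < L) c k.+1 * \sum_(j < n) (maxcnt (bad k j) Q)%:R.

Let lam_sum_superW k P Q : \sum_(j < n) (maxcnt (bad k j) P)%:R
  + \sum_(j < n) (maxcnt (bad k j) Q)%:R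
  <= \sum_(j < n) (maxcnt (bad k j) (mnm_add P Q))%:R :> R.
Proof.
rewrite -big_split /=; apply: ler_sum => j _.
by rewrite -natrD ler_nat maxcnt_superW.
Qed.

Let head_superW P Q :
  c 0 * (mdg P).-1%:R + c 0 * (mdg Q).-1%:R <= c 0 * (mdg (mnm_add P Q)).-1%:R.
Proof. by rewrite -mulrDr ler_wpM2l ?c_ge0 // -natrD ler_nat mdegD; lia. Qed.

Let tail_superW (I : Type) (r : seq I) (A : pred I) (t : I -> nat) P Q :
  \sum_(k <- r | A k) c (t k).+1 * \sum_(j < n) (maxcnt (bad (t k) j) P)%:R +
  \sum_(k <- r | A k) c (t k).+1 * \sum_(j < n) (maxcnt (bad (t k) j) Q)%:R <=
  \sum_(k <- r | A k)
    c (t k).+1 * \sum_(j < n) (maxcnt (bad (t k) j) (mnm_add P Q))%:R.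
Proof.
rewrite -big_split /=; apply: ler_sum => k _.
by rewrite -mulrDr ler_wpM2l ?c_ge0 ?lam_sum_superW.
Qed.

Let lam_superW L P Q : lam L P + lam L Q <= lam L (mnm_add P Q).
Proof. by rewrite /lam addrACA lerD // tail_superW. Qed.

Let lam_gain0 L P Q : P != @mnm0 n -> Q != @mnm0 n ->
  lam L P + lam L Q + c 0 <= lam L (mnm_add P Q).
Proof.
rewrite -!mdeg_eq0 => P0 Q0.
have h1 : c 0 * (mdg P).-1%:R + c 0 * (mdg Q).-1%:R + c 0 * 1
    <= c 0 * (mdg (mnm_add P Q)).-1%:R.
  rewrite -!mulrDr ler_wpM2l ?c_ge0 // -[1]/(1%:R) -!natrD ler_nat mdegD; lia.
have := tail_superW (index_enum 'I_L) xpredT val P Q.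
by move: h1; rewrite mulr1 /lam; move: (c 0) => c0 h1 h2; lra.
Qed.

Let lam_gainS L P Q (k : 'I_L) j : P != @mnm0 n -> Q != @mnm0 n ->
  bad k j (mnm_add P Q) ->
  lam L P + lam L Q + c k.+1 <= lam L (mnm_add P Q).
Proof.
move=> P0 Q0 b; have h1 := head_superW P Q.
have h2 := tail_superW (index_enum 'I_L) (fun i => i != k) val P Q.
have h3 : \sum_(j < n) (maxcnt (bad k j) P)%:R
  + \sum_(j < n) (maxcnt (bad k j) Q)%:R + 1
  <= \sum_(j < n) (maxcnt (bad k j) (mnm_add P Q))%:R :> R.
  rewrite -big_split /= (bigD1 j) //= [leRHS](bigD1 j) //= addrAC lerD //.
    rewrite -[1]/(1%:R) -!natrD ler_nat.
    by apply: leq_trans (maxcnt_super _ P0 Q0); rewrite b.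
  by apply: ler_sum => i _; rewrite -natrD ler_nat maxcnt_superW.
have := ler_wpM2l (c_ge0 k.+1) h3; rewrite !mulrDr mulr1.
have D1 (G : 'I_L -> R) : \sum_i G i = G k + \sum_(i | i != k) G i.
  exact: bigD1.
move: h1 h2; rewrite /lam !D1.
by move: (c 0) (c k.+1) => c0 ck h1 h2 h4; lra.
Qed.

Let lam_bound L Q :
  lam L Q <= (c 0 + n%:R * (4 * U + 4 * - ln theta)) * (mdg Q)%:R.
Proof.
rewrite /lam [leRHS]mulrDl lerD //.
  by rewrite ler_wpM2l ?c_ge0 // ler_nat leq_pred.
have lt0 : 0 <= - ln theta by rewrite oppr_ge0 ln_le0.
(* A count at level [k] is at most |Q| / 2^k; the factor 4 turns 1 / 2^k into the 1 / 2^(k+2) that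
   goes with [u k.+2] in the summable series. *)
apply: (@le_trans _ _ (\sum_(k < L) (n%:R * (mdg Q)%:R * 4) *
     (u k.+2 / 2 ^+ k.+2 + - ln theta * (1 / 2) ^+ k.+2))).
  apply: ler_sum => k _.
  have -> : n%:R * (mdg Q)%:R * 4 * (u k.+2 / 2 ^+ k.+2 + - ln theta * (1 / 2) ^+ k.+2)
     = c k.+1 * \sum_(j < n) ((mdg Q)%:R / 2 ^+ k) :> R.
    rewrite sumr_const card_ord -mulr_natl /c !exprS expr_div_n expr1n.
    by field; rewrite expf_neq0.
  rewrite ler_wpM2l ?c_ge0 //; apply: ler_sum => j _.
  by rewrite ler_pdivlMr ?exprn_gt0 // -natrX -natrM ler_nat bad_bound.
rewrite -mulr_sumr big_split /= -mulr_sumr.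
have -> : n%:R * (4 * U + 4 * - ln theta) * (mdg Q)%:R =
  (n%:R * (mdg Q)%:R * 4) * (U + - ln theta * 1) :> R by ring.
rewrite ler_wpM2l ?mulr_ge0 // lerD // ?ler_wpM2l //.
  apply: le_trans (u_sum L.+1); rewrite big_ord_recl /= lerDr.
  exact/divr_ge0/exprn_ge0.
have -> : \sum_(k < L) (1 / 2) ^+ k.+2 = 1 / 2 - (1 / 2) ^+ L.+1 :> R.
  elim: (L) => [|m IH]; first by rewrite big_ord0 expr1 subrr.
  by rewrite big_ord_recr /= IH !exprS; field.
have : 0 <= (1 / 2 : R) ^+ L.+1 by rewrite exprn_ge0 // divr_ge0.
by lra.
Qed.

Lemma gained_divisors : exists2 K, 0 <= K & gained S div K.
Proof.
exists (c 0 + n%:R * (4 * U + 4 * - ln theta)).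
  have U0 : 0 <= U by have := u_sum 0; rewrite big_ord0.
  have lt0 : 0 <= - ln theta by rewrite oppr_ge0 ln_le0.
  by rewrite addr_ge0 ?c_ge0 // mulr_ge0 // addr_ge0 // mulr_ge0.
move=> L; exists (lam L); split=> [Q|Q|P Q|j P Q P0 Q0 SPQ PQL].
- rewrite addr_ge0 ?mulr_ge0 ?c_ge0 //; apply: sumr_ge0 => k _.
  by rewrite mulr_ge0 ?c_ge0 //; apply: sumr_ge0.
- exact: lam_bound.
- exact: lam_superW.
have PQ2 : (2 <= mdg (mnm_add P Q))%N.
  by move: P0 Q0; rewrite -!mdeg_eq0 mdegD; lia.
(* Level [L] always qualifies, as degrees up to [L] are below 2^(L+1). *)
have exk : exists k, theta * expR (- u k.+1) <= div j (mnm_add P Q).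
  exists L; apply: (le_trans _ (div_ge (k := L) j SPQ _)).
    by rewrite ger_pMl ?expR_gt0.
  rewrite PQ2 (leq_trans PQL) // (leq_trans (ltnW (ltn_expl L (ltnSn 1)))) //.
  by rewrite leq_exp2l.
have gain k : theta * expR (- u k.+1) <= div j (mnm_add P Q) ->
    lam L P + lam L Q + c k <= lam L (mnm_add P Q) ->
    expR (lam L P + lam L Q) <= div j (mnm_add P Q) * expR (lam L (mnm_add P Q)).
  rewrite -expRc => dk lk.
  apply: (@le_trans _ _ (expR (- c k) * expR (lam L (mnm_add P Q)))).
    by rewrite -expRD ler_expR; lra.
  by rewrite ler_wpM2r ?expR_ge0.
(* At the least level [k.+1] whose threshold is met, minimality says that the sum is bad at level
   [k]. *)
case: (ex_minnP exk) => -[|k] dk kmin; first exact/(gain _ dk)/lam_gain0.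
have kL : (k < L)%N.
  rewrite ltnNge; apply/negP => Lk; have := kmin L; rewrite leqNgt ltnS Lk.
  move=> /(_ _)/negP; apply => //.
  apply: (le_trans _ (div_ge (k := L) j SPQ _)).
    by rewrite ger_pMl ?expR_gt0.
  rewrite PQ2 (leq_trans PQL) // (leq_trans (ltnW (ltn_expl L (ltnSn 1)))) //.
  by rewrite leq_exp2l.
apply: (gain _ dk); apply: (lam_gainS (k := Ordinal kL) (j := j)) => //.
rewrite /bad SPQ PQ2 /= ltNge; apply/negP => /kmin; by rewrite ltnn.
Qed.

End BrjunoWeight.

(** * Power series and the fixed point of the conjugacy equation *)

(** The least [r] and the largest [M] serve for all [t]. Monotonicity is the only demand on [P], so
    the lemma covers radii of convergence as well as bounds on finitely many numbers. *)
Lemma finite_uniform (R : realType) (T : finType) (P : T -> R -> R -> Prop) :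
  (forall t r r' M M', 0 < r' -> r' <= r -> M <= M' -> P t r M -> P t r' M') ->
  (forall t, exists r M, 0 < r /\ P t r M) ->
  exists r M, [/\ 0 < r, 0 <= M & forall t, P t r M].
Proof.
move=> Pmono Pex.
suff [r [M [r0 M0 PrM]]] : exists r M,
    [/\ 0 < r, 0 <= M & forall t, t \in enum T -> P t r M].
  by exists r, M; split => // t; apply: PrM; rewrite mem_enum.
elim: (enum T) => [|t s [r [M [r0 M0 IH]]]]; first by exists 1, 0.
have [r' [M' [r'0 PrM']]] := Pex t.
exists (Num.min r r'), (Num.max M M'); split; rewrite ?lt_min ?r0 ?le_max ?M0 //.
move=> t'; rewrite inE => /orP[/eqP ->|/IH].
  by apply: Pmono PrM'; rewrite ?lt_min ?r0 ?ge_min ?lexx ?orbT ?le_max ?lexx ?orbT.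
by apply: Pmono; rewrite ?lt_min ?r0 ?ge_min ?lexx ?orbT ?le_max ?lexx ?orbT.
Qed.

Section Series.
Variables (R : realType) (n : nat).
Local Notation mon := (multinom n).
Local Notation ser := (mon -> R[i]).
Implicit Types (c : ser) (g : 'I_n -> ser) (m : mon) (r M : R).

Definition rpow r m : R := r ^+ mdg m.

Lemma rpow_ge0 r m : 0 <= r -> 0 <= rpow r m.
Proof. by move=> r0; exact: exprn_ge0. Qed.

Lemma rpowM r : submul (rpow r).
Proof. by move=> m m'; rewrite /rpow mdegD exprD. Qed.

Lemma rpow0 r : rpow r (@mnm0 n) = 1.
Proof. by rewrite /rpow mdeg0. Qed.

(** The sum of |c_Q| r^|Q| is at most [M], stated through its partial sums. *)
Definition smaj r M c := forall N, wnorm (rpow r) (trunc N c) <= M.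

Definition sconv c := exists r M, 0 < r /\ smaj r M c.

Lemma smaj_ge0 r M c : smaj r M c -> 0 <= M.
Proof. by move=> /(_ 0%N); rewrite wnorm_trunc big1 // => -[m]. Qed.

Lemma smaj_mono r r' M M' c : 0 < r' -> r' <= r -> M <= M' -> smaj r M c -> smaj r' M' c.
Proof.
move=> r'0 r'r MM' cr N; apply: le_trans MM'; apply: le_trans (cr N).
apply: ler_wnorm => m; rewrite ler_wpM2r ?normc_ge0 //.
by rewrite lerXn2r // nnegrE ltW // (lt_le_trans r'0).
Qed.

(** A Schwarz lemma for majorants: every monomial present has degree at least [d], so shrinking the
    radius gains the factor (r' / r)^d. *)
Lemma smaj_low d r r' M c : 0 < r' -> r' <= r ->
  (forall m, (mdg m < d)%N -> c m = 0) ->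
  smaj r M c -> smaj r' ((r' / r) ^+ d * M) c.
Proof.
move=> r'0 r'r c0 cr N; have r0 : 0 < r by exact: lt_le_trans r'r.
have q0 : 0 <= r' / r by rewrite divr_ge0 // ltW.
have q1 : r' / r <= 1 by rewrite ler_pdivrMr // mul1r.
apply: le_trans (ler_wpM2l (exprn_ge0 d q0) (cr N)).
rewrite !wnorm_trunc mulr_sumr; apply: ler_sum => m _.
have [md|dm] := ltnP (mdg m) d; first by rewrite c0 // Normc.normc0 !mulr0.
rewrite mulrA ler_wpM2r ?normc_ge0 // /rpow.
have -> : r' ^+ mdg m = (r' / r) ^+ mdg m * r ^+ mdg m.
  by rewrite -exprMn divfK // gt_eqF.
apply: ler_wpM2r; first by rewrite exprn_ge0 // ltW.
exact: ler_wiXn2l.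
Qed.

(** The coefficient is read from the shortest truncations that contain degree |m|; when the [g i]
    have no constant term, longer ones give the same value, by [scompE]. *)
Definition scomp g c : ser := fun m =>
  mcoeff m (pcomp (fun i => trunc (mdg m).+1 (g i)) (trunc (mdg m).+1 c)).

Lemma mcoeff0_trunc N c : c (@mnm0 n) = 0 -> mcoeff (@mnm0 n) (trunc N c) = 0.
Proof. by move=> c0; rewrite mcoeff_trunc c0 if_same. Qed.

Lemma scompE N N' g c m : (forall i, g i (@mnm0 n) = 0) ->
  (mdg m < N)%N -> (mdg m < N')%N ->
  mcoeff m (pcomp (fun i => trunc N' (g i)) (trunc N c)) = scomp g c m.
Proof.
move=> g0 mN mN'; have d : (mdg m < (mdg m).+1)%N by [].
transitivity (mcoeff m (pcomp (fun i => trunc N' (g i)) (trunc (mdg m).+1 c))).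
  symmetry; apply: (eqon_pcompl (N := (mdg m).+1)) => // [i|]; first exact: mcoeff0_trunc.
  exact: eqon_trunc.
symmetry; apply: (eqon_pcomp (P := fun k => (mdg k < (mdg m).+1)%N) _ _ _) => //.
  exact: down_closed_deg.
by move=> i; exact: eqon_trunc.
Qed.

Lemma wnorm_pcomp_trunc N N' r rho M g c : 0 <= r -> 0 <= rho ->
  (forall i, smaj r rho (g i)) -> smaj rho M c ->
  wnorm (rpow r) (pcomp (fun i => trunc N' (g i)) (trunc N c)) <= M.
Proof.
move=> r0 rho0 gr cM; apply: le_trans (cM N).
apply: wnorm_pcomp => [m|m _]; first exact: rpow_ge0.
apply: wnorm_mprod => // [m'|||i]; rewrite ?rpow0 //.
- exact: rpow_ge0.
- exact: rpowM.
exact: gr.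
Qed.

Lemma smaj_scomp r rho M g c : 0 <= r -> 0 <= rho ->
  (forall i, g i (@mnm0 n) = 0) ->
  (forall i, smaj r rho (g i)) -> smaj rho M c -> smaj r M (scomp g c).
Proof.
move=> r0 rho0 g0 gr cM N.
apply: le_trans (wnorm_pcomp_trunc N N r0 rho0 gr cM).
apply: ler_wnorm => m; rewrite mcoeff_trunc; case: ltnP => mN.
  by rewrite (scompE _ g0 mN mN).
by rewrite Normc.normc0 mulr0 mulr_ge0 ?normc_ge0 ?rpow_ge0.
Qed.

(** By [smaj_low] at order one, the norms of the [g i] tend to 0 with the radius. The [M + 1] keeps
    the quotient defined when [M] is 0. *)
Lemma smaj_small rho g : 0 < rho -> (forall i, g i (@mnm0 n) = 0) ->
  (forall i, sconv (g i)) -> exists2 r, 0 < r & forall i, smaj r rho (g i).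
Proof.
move=> rho0 g0 gconv.
have [r [M [r0 M0 gM]]] : exists r M, [/\ 0 < r, 0 <= M & forall i, smaj r M (g i)].
  by apply: finite_uniform gconv => t r r' M M'; exact: smaj_mono.
have q0 : 0 < rho / (M + 1) by rewrite divr_gt0 // ltr_pwDr.
pose r' := Num.min r (r * (rho / (M + 1))).
have r'0 : 0 < r' by rewrite lt_min r0 mulr_gt0.
have r'r : r' <= r by rewrite ge_min lexx.
exists r' => // i; have : smaj r' ((r' / r) ^+ 1 * M) (g i).
  apply: smaj_low => // m; rewrite ltnS leqn0 mdeg_eq0 => /eqP ->; exact: g0.
apply: smaj_mono => //; rewrite expr1.
apply: (@le_trans _ _ (rho / (M + 1) * M)).
  rewrite ler_wpM2r // ler_pdivrMr // mulrC ge_min lexx orbT //.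
rewrite mulrAC ler_pdivrMr ?ltr_pwDr //.
by rewrite ler_wpM2l ?lerDl // ltW.
Qed.

Definition sX (i : 'I_n) : ser := fun m => (m == mnm1 i)%:R.

Lemma eqon_truncX N i : eqon (fun m => mdg m < N)%N (trunc N (sX i)) (mpolyX _ (mnm1 i)).
Proof. by move=> m mN; rewrite mcoeff_trunc mN mcoeffX eq_sym. Qed.

End Series.

(** * Recursive solution of the conjugacy equation and Siegel's majorant method *)

Section FixedPoint.
Variables (R : realType) (n l : nat).
Local Notation mon := (multinom n).
Local Notation ser := (mon -> R[i]).
Implicit Types (u v : 'I_n -> ser).
Variables (f : 'I_l -> 'I_n -> ser) (sel : 'I_n -> mon -> 'I_l).
Variables (S : pred mon) (div : 'I_n -> mon -> R[i]).
Hypothesis f_low : forall i j m, (mdg m < 2)%N -> f i j m = 0.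
Hypothesis f_conv : forall i j, sconv (f i j).

Let Xp u i : ser := fun m => sX R i m + u i m.

(** The solution of the equation with index [sel j m], given [u] on the right-hand side.
    Coefficients off [S] are free and set to 0. *)
Let op u j : ser := fun m =>
  if S m && (2 <= mdg m)%N then scomp (Xp u) (f (sel j m) j) m / div j m else 0.

Let flat u := forall j m, (mdg m < 2)%N -> u j m = 0.

Let op_flat u : flat (op u).
Proof. by move=> j m m2; rewrite /op leqNgt m2 andbF. Qed.

Let Xp0 u i : flat u -> Xp u i (@mnm0 n) = 0.
Proof. by move=> fu; rewrite /Xp fu ?mdeg0 // addr0 /sX eq_sym mnm1_eq0. Qed.

Let gain_deg d (m m' : mon) : m != @mnm0 n -> m' != @mnm0 n ->
  (mdg (mnm_add m m') < d.+1)%N -> (mdg m < d)%N /\ (mdg m' < d)%N.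
Proof. by rewrite -!mdeg_eq0 mdegD; lia. Qed.

Let scomp_local u v i j m d : flat u -> flat v -> (mdg m < d.+1)%N ->
  (forall j k, (mdg k < d)%N -> u j k = v j k) ->
  scomp (Xp u) (f i j) m = scomp (Xp v) (f i j) m.
Proof.
move=> fu fv md uv.
apply: (eqon_pcomp_gain (P := fun k => (mdg k < d.+1)%N)
  (Q := fun k => (mdg k < d)%N)) => //.
- exact: down_closed_deg.
- exact: gain_deg.
- by move=> a k kd; rewrite !mcoeff_trunc /Xp uv.
- by move=> a; exact/mcoeff0_trunc/Xp0.
- by move=> a; exact/mcoeff0_trunc/Xp0.
by move=> k k2; rewrite mcoeff_trunc f_low // if_same.
Qed.

Let it k : 'I_n -> ser := iter k op (fun _ _ => 0).

Let it_flat k : flat (it k).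
Proof. by case: k => // k; exact: op_flat. Qed.

Let op_local u v d : flat u -> flat v ->
  (forall j k, (mdg k < d)%N -> u j k = v j k) ->
  forall j k, (mdg k < d.+1)%N -> op u j k = op v j k.
Proof.
move=> fu fv uv j k kd; rewrite /op; case: ifP => [_|//].
by rewrite (scomp_local _ _ fu fv kd uv).
Qed.

Let itS k : forall j m, (mdg m < k)%N -> it k j m = it k.+1 j m.
Proof.
elim: k => [//|k IH] j m mk; apply: op_local IH j m mk; exact: it_flat.
Qed.

Let it_stable k k' j m : (mdg m < k)%N -> (k <= k')%N -> it k j m = it k' j m.
Proof.
move=> mk; elim: k' => [|k' IH]; first by rewrite leqn0 => /eqP ->.
rewrite leq_eqVlt => /orP[/eqP <- //|]; rewrite ltnS => kk'.
by rewrite IH // itS // (leq_trans mk).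
Qed.

(** By triangularity the [k]-th iterate is final in degrees below [k], so the diagonal is a fixed
    point of [op], without any convergence of the iterates. *)
Let psi j : ser := fun m => it (mdg m).+1 j m.

Let psi_flat : flat psi.
Proof. by move=> j m m2; exact: it_flat. Qed.

Let psi_op j m : psi j m = op psi j m.
Proof.
apply: (@op_local (it (mdg m)) psi (mdg m)) => // a k km.
by symmetry; apply: it_stable.
Qed.

Lemma bmnm_sum_le (w : mon -> R) N (p : mpoly n R[i]) : (forall m, 0 <= w m) ->
  \sum_(m : bmultinom n N) w m * normc (mcoeff m p) <= wnorm w p.
Proof.
move=> w0; rewrite -(wnorm_trunc N w (fun m => mcoeff m p)).
apply: ler_wnorm => m; rewrite mcoeff_trunc; case: ifP => // _.
by rewrite Normc.normc0 mulr0 mulr_ge0 ?normc_ge0.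
Qed.

(** If the truncation of psi below [N] has norm at most [rho], that of x + psi is at most [2 * rho];
    as [f] has order two, the next truncation has norm at most l (2 rho / r0)^2 M0, which is again
    at most [rho] once [rho] is small. The divisors are absorbed in passing from [w] to [w']. *)
Lemma fixed_point K : 0 <= K -> gained S (fun j m => normc (div j m)) K ->
  exists psi : 'I_n -> ser,
  [/\ forall j m, ~~ (S m && (2 <= mdg m)%N) -> psi j m = 0,
      forall j m, S m -> (2 <= mdg m)%N ->
        psi j m = scomp (fun i m => sX R i m + psi i m) (f (sel j m) j) m / div j m &
      forall j, sconv (psi j)].
Proof.
move=> K0 gainK; exists psi; split.
- by move=> j m Sm; rewrite psi_op /op (negbTE Sm).
- by move=> j m Sm m2; rewrite psi_op /op Sm m2.
have [r0 [M0 [r0_gt0 M0_ge0 fmaj]]] : exists r M, [/\ 0 < r, 0 <= M &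
    forall t : 'I_l * 'I_n, smaj r M (f t.1 t.2)].
  apply: finite_uniform => [t r r' M M'|t]; first exact: smaj_mono.
  exact: f_conv.
(* The factor [l]: since [sel j m] varies with [m], the coefficients of psi are bounded by the sum
   over all equations. *)
pose B : R := l%:R * M0 + 1.
have B0 : 0 < B by rewrite ltr_pwDr // mulr_ge0.
(* The first bound keeps x + psi within the radius [r0] of [f]; the second is the smallness
   condition [rhoB]. *)
pose rho : R := Num.min (r0 / 2) (r0 ^+ 2 / (4 * B)).
have rho0 : 0 < rho by rewrite lt_min !divr_gt0 ?exprn_gt0 ?mulr_gt0.
have rho_r0 : 2 * rho <= r0.
  by rewrite mulrC -ler_pdivlMr // ge_min lexx.
have rhoB : l%:R * ((2 * rho / r0) ^+ 2 * M0) <= rho.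
  have : rho <= r0 ^+ 2 / (4 * B) by rewrite ge_min lexx orbT.
  rewrite ler_pdivlMr ?mulr_gt0 // => h.
  rewrite !exprMn exprVn mulrCA -!mulrA [_^-1 * _]mulrC !mulrA.
  rewrite ler_pdivrMr ?exprn_gt0 //.
  apply: (@le_trans _ _ (rho * (rho * (4 * B)))); last by rewrite ler_wpM2l // ltW.
  rewrite /B; have := mulr_ge0 (ler0n R l) M0_ge0; nra.
(* As [lam] is at most K |Q|, the weight [w] dominates the powers of rho exp (- K), a radius that
   does not involve [L]. *)
move=> j0; exists (rho * expR (- K)), rho; split; first by rewrite mulr_gt0 ?expR_gt0.
move=> L; have [lam [lam0 lamK lamD lam_gain]] := gainK L.
pose w m : R := rpow rho m * expR (- lam m).
have w0 m : 0 <= w m by rewrite mulr_ge0 ?expR_ge0 // rpow_ge0 // ltW.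
have wM : submul w.
  move=> m m'; rewrite /w mulrACA -expRD /rpow mdegD exprD.
  by rewrite ler_wpM2l ?mulr_ge0 ?exprn_ge0 ?(ltW rho0) // ler_expR -opprD lerN2.
have w1 : w (@mnm0 n) <= 1.
  by rewrite /w rpow0 mul1r -expR0 ler_expR oppr_le0.
(* [w'] is [w] divided by the divisor, in the range where [lam] absorbs it; by [lam_gain] one
   splitting of the monomial pays for the division. *)
pose w' j m : R := if [&& S m, (mdg m <= L)%N & (1 < mdg m)%N]
  then w m / normc (div j m) else 0.
have w'0 j m : 0 <= w' j m.
  by rewrite /w'; case: ifP => // _; rewrite divr_ge0 ?normc_ge0.
have w'M j m m' : m != @mnm0 n -> m' != @mnm0 n ->
    w' j (mnm_add m m') <= w m * w m'.
  move=> m0 m'0; rewrite /w'; case: ifP => [/and3P[Sm mL _]|_]; last by rewrite mulr_ge0.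
  have g := lam_gain j m m' m0 m'0 Sm mL.
  have d0 : 0 < normc (div j (mnm_add m m')).
    by move: (lt_le_trans (expR_gt0 _) g); rewrite pmulr_lgt0 ?expR_gt0.
  have -> : w m * w m' = rpow rho (mnm_add m m') * expR (- (lam m + lam m')).
    by rewrite /w mulrACA -expRD opprD /rpow mdegD exprD.
  rewrite ler_pdivrMr // /w -mulrA ler_wpM2l ?(rpow_ge0 _ (ltW rho0)) //.
  by rewrite !expRN mulrC ler_pdivlMr ?expR_gt0 // mulrC ler_pdivrMr ?expR_gt0.
have main N : (N <= L.+1)%N -> forall j, wnorm w (trunc N (psi j)) <= rho.
  elim: N => [|N IH] NL j.
    by rewrite wnorm_trunc big1 ?(ltW rho0) // => -[].
  pose g i := trunc N (Xp psi i).
  pose P i := pcomp g (trunc N.+1 (f i j)).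
  have g0 i : mcoeff (@mnm0 n) (g i) = 0 by exact/mcoeff0_trunc/Xp0.
  have gr i : wnorm w (g i) <= 2 * rho.
    have -> : g i = trunc N (sX R i) + trunc N (psi i).
      by apply/mpolyP => m; rewrite mcoeffD !mcoeff_trunc; case: ifP => //; rewrite addr0.
    apply: le_trans (wnormD _ _ w0) _.
    rewrite mulrDl !mul1r lerD ?(IH (ltnW NL)) //.
    apply: (@le_trans _ _ (wnorm w (mpolyX R[i] (mnm1 i)))).
      apply: ler_wnorm => m; rewrite mcoeff_trunc mcoeffX eq_sym; case: ifP => // _.
      by rewrite Normc.normc0 mulr0 mulr_ge0 ?normc_ge0.
    rewrite wnormX /w /rpow mdeg1 expr1 ler_piMr ?(ltW rho0) //.
    by rewrite -expR0 ler_expR oppr_le0.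
  have psiP m : (mdg m < N.+1)%N ->
      w m * normc (psi j m) <= \sum_i w' j m * normc (mcoeff m (P i)).
    move=> mN; rewrite psi_op /op; case: ifP => [/andP[Sm m2]|_]; last first.
      by rewrite Normc.normc0 mulr0 sumr_ge0 // => i _; rewrite mulr_ge0 ?normc_ge0.
    have -> : scomp (Xp psi) (f (sel j m) j) m = mcoeff m (P (sel j m)).
      rewrite -(scompE (N := N.+1) (N' := N.+1)) // => [|i]; last exact: Xp0.
      apply: (eqon_pcomp_gain (P := fun k => (mdg k < N.+1)%N)
        (Q := fun k => (mdg k < N)%N)) => //.
      - exact: down_closed_deg.
      - exact: gain_deg.
      - by move=> a; apply: eqon_sym; exact: eqon_trunc.
      - by move=> a; exact/mcoeff0_trunc/Xp0.
      by move=> k k2; rewrite mcoeff_trunc f_low // if_same.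
    rewrite (bigD1 (sel j m)) //= ler_wpDr //.
      by rewrite sumr_ge0 // => i _; rewrite mulr_ge0 ?normc_ge0.
    have mL : (mdg m <= L)%N by move: mN NL; rewrite !ltnS; exact: leq_trans.
    rewrite /w' Sm m2 mL /= Normc.normcM Normc.normcV.
    by rewrite mulrA mulrAC.
  rewrite wnorm_trunc.
  apply: (@le_trans _ _ (\sum_i wnorm (w' j) (P i))).
    apply: (@le_trans _ _
      (\sum_i \sum_(m : bmultinom n N.+1) w' j m * normc (mcoeff m (P i)))).
      by rewrite exchange_big /=; apply: ler_sum => m _; apply/psiP/bmdeg.
    by apply: ler_sum => i _; exact: bmnm_sum_le.
  apply: le_trans rhoB; rewrite mulr_natl -[X in _ *+ X]card_ord -sumr_const.
  apply: ler_sum => i _.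
  have := smaj_low (d := 2) (r := r0) (r' := 2 * rho) _ rho_r0 (f_low i j) (fmaj (i, j)).
  rewrite mulr_gt0 // => /(_ isT N.+1); apply: le_trans.
  apply: wnorm_pcomp => // m mf.
  apply: (wnorm_mprod_gain (w := w)) => //; first by rewrite mulr_ge0 ?(ltW rho0).
    exact: w'M.
  rewrite ltnNge -ltnS; apply: contraTN mf => m2.
  by rewrite -mcoeff_eq0 mcoeff_trunc f_low ?if_same.
apply: le_trans (main L (leqnSn L) j0); apply: ler_wnorm => m.
rewrite mcoeff_trunc; case: ltnP => mL; last by rewrite Normc.normc0 !mulr0.
rewrite ler_wpM2r ?normc_ge0 // /w /rpow exprMn ler_wpM2l ?exprn_ge0 ?(ltW rho0) //.
by rewrite -expRM_natl ler_expR mulrN lerN2 mulrC.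
Qed.

End FixedPoint.

(** * Sums of convergent power series *)

Section GeometricLimits.
Variable R : realType.
Implicit Types (a b C q : R) (u : nat -> R[i]).

Lemma le_geometric a b C q : 0 <= q -> q < 1 ->
  (forall N, a <= b + C * q ^+ N) -> a <= b.
Proof.
move=> q0 q1 ab; rewrite -[b]addr0 -[X in _ + X](mulr0 C).
apply: (@cvgr_to_ge _ \oo _ _ (fun N => b + C * q ^+ N)); last exact: nearW.
apply: cvgD; first exact: cvg_cst.
apply: cvgM; first exact: cvg_cst.
by apply: cvg_expr; rewrite ger0_norm.
Qed.

(** Every lower end u N - e N is below every upper end, so the supremum of the lower ends lies in
    all the intervals, and the error bound comes with it. *)
Lemma sup_enclosure (u e : nat -> R) :
  (forall N N', (N <= N')%N -> `|u N' - u N| <= e N) ->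
  exists s, forall N, `|s - u N| <= e N.
Proof.
move=> ue; have cross N N' : u N - e N <= u N' + e N'.
  have e0 k : 0 <= e k by apply: le_trans (ue k k (leqnn k)).
  have [NN'|/ltnW N'N] := leqP N N'.
    by have := ue _ _ NN'; rewrite ler_norml => /andP[]; have := e0 N'; lra.
  by have := ue _ _ N'N; rewrite ler_norml => /andP[]; have := e0 N; lra.
pose A := range (fun N => u N - e N).
have A0 : A !=set0 by exists (u 0%N - e 0%N), 0%N.
have Aub N : ubound A (u N + e N) by move=> _ [N' _ <-]; exact: cross.
exists (sup A) => N; rewrite ler_norml; apply/andP; split.
  suff : u N - e N <= sup A by lra.
  by apply: ub_le_sup; [exists (u 0%N + e 0%N)|exists N].
by rewrite lerBlDr addrC; apply: ge_sup.
Qed.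

Lemma normc_ReIm (z : R[i]) : normc z <= `|complex.Re z| + `|complex.Im z|.
Proof.
rewrite -(@ler_pXn2r _ 2) ?nnegrE ?normc_ge0 ?addr_ge0 //.
case: z => a b /=; rewrite sqr_sqrtr ?addr_ge0 ?sqr_ge0 //.
rewrite sqrrD !real_normK ?num_real // addrAC lerDl.
by rewrite mulrn_wge0 // mulr_ge0.
Qed.

Lemma normc_Re (z : R[i]) : `|complex.Re z| <= normc z.
Proof.
case: z => a b /=; rewrite -sqrtr_sqr ler_wsqrtr // lerDl sqr_ge0 //.
Qed.

Lemma normc_Im (z : R[i]) : `|complex.Im z| <= normc z.
Proof.
case: z => a b /=; rewrite -sqrtr_sqr ler_wsqrtr // lerDr sqr_ge0 //.
Qed.

Lemma normc_distC (z w : R[i]) : normc (z - w) = normc (w - z).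
Proof. by rewrite -opprB (@normcN R). Qed.

Lemma normc_triangle (v z w : R[i]) : normc (z - w) <= normc (z - v) + normc (v - w).
Proof. by apply: le_trans (normcD _ _); rewrite addrA subrK. Qed.

Lemma geometric_limit u C q : 0 <= q -> q < 1 ->
  (forall N N', (N <= N')%N -> normc (u N' - u N) <= C * q ^+ N) ->
  exists s, forall N, normc (s - u N) <= C * q ^+ N.
Proof.
move=> q0 q1 uC.
have [a ua] : exists a, forall N, `|a - complex.Re (u N)| <= C * q ^+ N.
  apply: sup_enclosure => N N' NN'; apply: le_trans (uC _ _ NN').
  by apply: le_trans (normc_Re _); rewrite raddfB.
have [b ub] : exists b, forall N, `|b - complex.Im (u N)| <= C * q ^+ N.
  apply: sup_enclosure => N N' NN'; apply: le_trans (uC _ _ NN').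
  by apply: le_trans (normc_Im _); rewrite raddfB.
exists (a +i* b) => N.
have h N' : normc ((a +i* b) - u N') <= 2 * C * q ^+ N'.
  apply: le_trans (normc_ReIm _) _; rewrite !raddfB /=.
  by have := ua N'; have := ub N'; lra.
apply: (@le_geometric _ _ (2 * C) q) => // N'.
have [NN'|N'N] := leqP N N'.
  apply: le_trans (normc_triangle (u N') _ _) _.
  by rewrite addrC lerD ?uC.
apply: le_trans (h N) _.
have C0 : 0 <= C.
  by have := uC 0%N 0%N (leqnn _); rewrite expr0 mulr1; apply: le_trans; exact: normc_ge0.
rewrite -mulrA mulrDl !mul1r mulrDl lerD2l mulrDl mul1r.
apply: (@le_trans _ _ (C * q ^+ N')); last by rewrite lerDl mulr_ge0 ?exprn_ge0.
by rewrite ler_wpM2l // ler_wiXn2l ?(ltW q1) // ltnW.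
Qed.

End GeometricLimits.

(** * Evaluation on polydiscs and sums of series *)

Section Evaluation.
Variables (R : realType) (n : nat).
Local Notation mon := (multinom n).
Local Notation ser := (mon -> R[i]).
Local Notation vec := 'rV[R[i]]_n.
Local Notation mp := (mpoly n R[i]).
Implicit Types (c : ser) (m : mon) (r rho M : R) (x y : vec) (p : mp)
  (f : vec -> R[i]).

Definition peval p x : R[i] := meval (fun j => x 0 j) p.

Lemma pevalD p q x : peval (p + q) x = peval p x + peval q x.
Proof. exact: raddfD. Qed.

Lemma pevalB p q x : peval (p - q) x = peval p x - peval q x.
Proof. exact: raddfB. Qed.

Lemma pevalM p q x : peval (p * q) x = peval p x * peval q x.
Proof. exact: rmorphM. Qed.

Lemma pevalZ a p x : peval (a *: p) x = a * peval p x.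
Proof. exact: mevalZ. Qed.

Lemma peval_sum (I : Type) (s : seq I) (P : pred I) (F : I -> mp) x :
  peval (\sum_(i <- s | P i) F i) x = \sum_(i <- s | P i) peval (F i) x.
Proof. exact: raddf_sum. Qed.

Lemma peval_pcomp (g : 'I_n -> mp) p x :
  peval (pcomp g p) x = peval p (\row_j peval (g j) x).
Proof. by rewrite /peval meval_pcomp; apply: meval_eq => j; rewrite mxE. Qed.

Lemma pevalX m x : peval (mpolyX _ m) x = \prod_j x 0 j ^+ m j.
Proof. exact: mevalX. Qed.

Definition vnorm x : R := \big[Num.max/0]_(j < n) normc (x 0 j).

Lemma vnorm_ge0 x : 0 <= vnorm x.
Proof. by rewrite /vnorm; elim/big_rec: _ => // j v _ v0; rewrite le_max v0 orbT. Qed.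

Lemma vnormP x r : 0 <= r -> reflect (forall j, normc (x 0 j) <= r) (vnorm x <= r).
Proof.
move=> r0; rewrite /vnorm.
apply: (iffP (bigmax_leP _ _ _ _)) => [[_ h] j|h]; first exact: h.
by split.
Qed.

Lemma le_vnorm x j : normc (x 0 j) <= vnorm x.
Proof. by move/(vnormP _ (vnorm_ge0 x)): (lexx (vnorm x)). Qed.

Lemma normc_peval rho p x : vnorm x <= rho -> normc (peval p x) <= wnorm (rpow rho) p.
Proof.
move=> xr; rewrite /peval mevalE; apply: le_trans (normc_sum _ _ _) _.
apply: ler_sum => m _; rewrite Normc.normcM mulrC ler_wpM2r ?normc_ge0 //.
rewrite normc_prod /rpow mdegE -prodrXr; apply: ler_prod => j _.
rewrite normcXn exprn_ge0 ?normc_ge0 //= lerXn2r ?nnegrE ?normc_ge0 //.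
  by apply: le_trans xr; exact: vnorm_ge0.
by apply: le_trans xr; exact: le_vnorm.
Qed.

Lemma peval_low N r p x : 0 < r -> vnorm x <= r ->
  (forall m, (mdg m < N)%N -> mcoeff m p = 0) ->
  normc (peval p x) <= (vnorm x / r) ^+ N * wnorm (rpow r) p.
Proof.
move=> r0 xr plow; apply: le_trans (normc_peval _ (lexx _)) _.
rewrite !(wnormE _ (leqnn _)) mulr_sumr; apply: ler_sum => m _.
have [mN|Nm] := ltnP (mdg m) N; first by rewrite plow // Normc.normc0 !mulr0.
rewrite mulrA ler_wpM2r ?normc_ge0 // /rpow.
have -> : vnorm x ^+ mdg m = (vnorm x / r) ^+ mdg m * r ^+ mdg m.
  by rewrite -exprMn divfK // gt_eqF.
apply: ler_wpM2r; first by rewrite exprn_ge0 // ltW.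
apply: ler_wiXn2l => //; first by rewrite divr_ge0 ?vnorm_ge0 // ltW.
by rewrite ler_pdivrMr // mul1r.
Qed.

Lemma peval_lipschitz p B : 0 <= B -> exists2 C, 0 <= C & forall x y,
  vnorm x <= B -> vnorm y <= B ->
  normc (peval p x - peval p y) <= C * vnorm (x - y).
Proof.
move=> B0; elim/mpolyind: p => [|a m p _ _ [C C0 IH]].
  by exists 0 => // x y _ _; rewrite /peval !meval0 subrr Normc.normc0 mul0r.
suff [D D0 mD] : exists2 D, 0 <= D & forall x y,
    vnorm x <= B -> vnorm y <= B ->
    normc (peval (mpolyX _ m) x - peval (mpolyX _ m) y) <= D * vnorm (x - y).
  exists (normc a * D + C) => [|x y xB yB].
    by rewrite addr_ge0 ?mulr_ge0 ?normc_ge0.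
  rewrite !pevalD !pevalZ opprD addrACA -mulrBr mulrDl.
  apply: le_trans (normcD _ _) _; rewrite lerD ?IH // Normc.normcM -mulrA.
  by rewrite ler_wpM2l ?normc_ge0 ?mD.
elim/mon_ind: m {p IH} => [|i m [D D0 IH]].
  exists 0 => // x y _ _; rewrite mul0r mpolyX0 /peval !rmorph1.
  by rewrite subrr Normc.normc0.
exists (B * D + wnorm (rpow B) (mpolyX R[i] m)) => [|x y xB yB].
  by rewrite addr_ge0 ?mulr_ge0 ?wnorm_ge0 // => k; rewrite rpow_ge0.
rewrite mpolyXD !pevalM /peval !mevalXU -!/(peval _ _).
have -> : x 0 i * peval (mpolyX R[i] m) x - y 0 i * peval (mpolyX R[i] m) y =
  x 0 i * (peval (mpolyX R[i] m) x - peval (mpolyX R[i] m) y)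
  + (x - y) 0 i * peval (mpolyX R[i] m) y by rewrite !mxE; ring.
apply: le_trans (normcD _ _) _; rewrite mulrDl !Normc.normcM lerD //.
  rewrite -mulrA ler_pM ?normc_ge0 ?IH //.
  by apply: le_trans xB; exact: le_vnorm.
by rewrite mulrC ler_pM ?normc_ge0 ?le_vnorm ?normc_peval.
Qed.

(* A quantitative form of [f] being the sum of [c] near [0]: limits of germs
   are only ever taken through these geometric remainders. *)
Definition repr r M c f := smaj r M c /\
  forall x, vnorm x < r -> forall N,
    normc (f x - peval (trunc N c) x) <= (vnorm x / r) ^+ N * M.

Definition grepr c f := exists r M, 0 < r /\ repr r M c f.

Lemma ratio_ge0 r x : 0 < r -> 0 <= vnorm x / r.
Proof. by move=> r0; rewrite divr_ge0 ?vnorm_ge0 ?ltW. Qed.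

Lemma ratio_lt1 r x : 0 < r -> vnorm x < r -> vnorm x / r < 1.
Proof. by move=> r0 xr; rewrite ltr_pdivrMr // mul1r. Qed.

Lemma repr_mono r r' M M' c f : 0 < r' -> r' <= r -> M <= M' ->
  repr r M c f -> repr r' M' c f.
Proof.
move=> r'0 r'r MM' [cM fc]; split=> [|x xr' N]; first exact: smaj_mono cM.
have r0 : 0 < r by exact: lt_le_trans r'r.
have M0 := smaj_ge0 cM.
apply: le_trans (fc x (lt_le_trans xr' r'r) N) _.
apply: ler_pM => //; first by rewrite exprn_ge0 ?ratio_ge0.
rewrite lerXn2r ?nnegrE ?ratio_ge0 // ler_wpM2l ?vnorm_ge0 //.
by rewrite lef_pV2.
Qed.

Lemma grepr_ext c f f' r : 0 < r -> (forall x, vnorm x < r -> f x = f' x) ->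
  grepr c f -> grepr c f'.
Proof.
move=> r0 ff' [r1 [M [r10 fc]]].
have m0 : 0 < Num.min r r1 by rewrite lt_min r0.
have mr : Num.min r r1 <= r by rewrite ge_min lexx.
exists (Num.min r r1), M; split => //.
have [cM fcx] : repr (Num.min r r1) M c f.
  by apply: repr_mono fc; rewrite ?ge_min ?lexx ?orbT.
by split => // x xr N; rewrite -ff' ?fcx // (lt_le_trans xr).
Qed.

Lemma repr_eq r M M' c f f' x : 0 < r -> vnorm x < r ->
  repr r M c f -> repr r M' c f' -> f x = f' x.
Proof.
move=> r0 xr [_ fc] [_ fc']; apply/eqP; rewrite -subr_eq0 -normc_eq0.
rewrite eq_le normc_ge0 andbT.
apply: (@le_geometric _ _ _ (M + M') (vnorm x / r)) => [||N].
- exact: ratio_ge0.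
- exact: ratio_lt1.
rewrite add0r; apply: le_trans (normc_triangle (peval (trunc N c) x) _ _) _.
by rewrite mulrC mulrDr lerD ?fc // normc_distC fc'.
Qed.

Lemma grepr_eq c f f' : grepr c f -> grepr c f' ->
  exists2 r, 0 < r & forall x, vnorm x < r -> f x = f' x.
Proof.
move=> [r [M [r0 fc]]] [r' [M' [r'0 fc']]].
have m0 : 0 < Num.min r r' by rewrite lt_min r0.
exists (Num.min r r') => // x xr.
by apply: (repr_eq m0 xr); [apply: repr_mono fc|apply: repr_mono fc'];
  rewrite ?ge_min ?lexx ?orbT.
Qed.

Lemma low_trunc N N' c m : (N <= N')%N -> (mdg m < N)%N ->
  mcoeff m (trunc N' c - trunc N c) = 0.
Proof. by move=> NN' mN; rewrite mcoeffB !mcoeff_trunc mN (leq_trans mN) ?subrr. Qed.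

Lemma wnorm_truncB N N' r c : 0 <= r ->
  wnorm (rpow r) (trunc N' c - trunc N c) <= wnorm (rpow r) (trunc (maxn N N') c).
Proof.
move=> r0; apply: ler_wnorm => m; rewrite ler_wpM2l ?rpow_ge0 //.
rewrite mcoeffB !mcoeff_trunc leq_max; case: ltnP => _; case: ltnP => _ /=;
  by rewrite ?subrr ?subr0 ?sub0r ?(@normcN R) ?Normc.normc0 ?normc_ge0.
Qed.

Lemma sconv_repr r M c : 0 < r -> smaj r M c -> exists f, repr r M c f.
Proof.
move=> r0 cM; have fex x : exists s, vnorm x < r ->
    forall N, normc (s - peval (trunc N c) x) <= (vnorm x / r) ^+ N * M.
  have [xr|_] := ltP (vnorm x) r; last by exists 0.
  have [|||s sP] := @geometric_limit R (fun N => peval (trunc N c) x) M (vnorm x / r).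
  - exact: ratio_ge0.
  - exact: ratio_lt1.
  - move=> N N' NN'; rewrite -pevalB mulrC.
    apply: le_trans (peval_low r0 (ltW xr) (fun m => low_trunc c NN')) _.
    rewrite ler_wpM2l ?exprn_ge0 ?ratio_ge0 //.
    by apply: le_trans (wnorm_truncB _ _ _ (ltW r0)) _.
  by exists s => _ N; rewrite mulrC.
by have [f fP] := choice fex; exists f.
Qed.

Lemma sconv_grepr c : sconv c -> exists f, grepr c f.
Proof.
by move=> [r [M [r0 /(sconv_repr r0)[f fc]]]]; exists f, r, M.
Qed.

Lemma grepr_sconv c f : grepr c f -> sconv c.
Proof. by move=> [r [M [r0 [cM _]]]]; exists r, M. Qed.

(** Bounded polynomials with the right coefficients below degree [N] may replace the truncations:
    the difference has order [N], hence is controlled by [peval_low]. *)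
Lemma repr_approx r M M' c f (P : nat -> mp) :
  0 < r -> smaj r M c ->
  (forall N, wnorm (rpow r) (P N) <= M') ->
  (forall N m, (mdg m < N)%N -> mcoeff m (P N) = c m) ->
  (forall x, vnorm x < r -> forall N,
     normc (f x - peval (P N) x) <= (vnorm x / r) ^+ N * M') ->
  repr r (M' + (M' + M)) c f.
Proof.
move=> r0 cM PM Pc fP.
have M'0 : 0 <= M'.
  by apply: le_trans (PM 0%N); rewrite wnorm_ge0 // => m; rewrite rpow_ge0 ?ltW.
split=> [|x xr N]; first by apply: smaj_mono cM => //; rewrite addrA lerDr addr_ge0.
apply: le_trans (normc_triangle (peval (P N) x) _ _) _.
rewrite mulrDr lerD ?fP // -pevalB.
apply: le_trans (peval_low (N := N) r0 (ltW xr) _) _ => [m mN|].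
  by rewrite mcoeffB Pc // mcoeff_trunc mN subrr.
rewrite ler_wpM2l ?exprn_ge0 ?ratio_ge0 //.
apply: le_trans (wnormD _ _ (fun m => rpow_ge0 m (ltW r0))) _.
rewrite lerD ?PM // -scaleN1r wnormZ (@normcN R) Normc.normc1 mul1r.
exact: cM.
Qed.

Lemma grepr_scomp c f (d : 'I_n -> ser) (g : 'I_n -> vec -> R[i]) :
  (forall j, d j (@mnm0 n) = 0) -> grepr c f -> (forall j, grepr (d j) (g j)) ->
  grepr (scomp d c) (fun x => f (\row_j g j x)).
Proof.
move=> d0 [rf [Mf [rf0 [cM fc]]]] gd.
have [r1 r10 dr1] :=
  smaj_small (divr_gt0 rf0 (ltr0Sn R 1)) d0 (fun j => grepr_sconv (gd j)).
have [r2 [M2 [r20 M20 gr2]]] : exists r M,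
    [/\ 0 < r, 0 <= M & forall j, repr r M (d j) (g j)].
  by apply: finite_uniform gd => t r r' M M'; exact: repr_mono.
pose r := Num.min r1 r2.
have r0 : 0 < r by rewrite lt_min r10.
have dr j : smaj r (rf / 2) (d j).
  by apply: smaj_mono (dr1 j) => //; rewrite ge_min lexx.
have gr j : repr r M2 (d j) (g j).
  by apply: repr_mono (gr2 j) => //; rewrite ge_min lexx orbT.
have rf2 : 0 <= rf / 2 by rewrite divr_ge0 // ltW.
have Mf0 := smaj_ge0 cM.
have cM2 : smaj (rf / 2) Mf c.
  apply: smaj_mono cM => //; rewrite ?divr_gt0 //.
  by rewrite ler_pdivrMr // ler_peMr ?(ltW rf0) ?ler1n.
pose G x := \row_j g j x.
(* Schwarz lemma for the inner map: the remainder of [c] at [G x] becomes geometric in |x| / r. *)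
have Gx x : vnorm x < r -> vnorm (G x) <= vnorm x / r * (rf / 2).
  move=> xr; apply/vnormP => [|j]; first by rewrite mulr_ge0 ?ratio_ge0.
  rewrite mxE; apply: (@le_geometric _ _ _ M2 (vnorm x / r)) => [||N].
  - exact: ratio_ge0.
  - exact: ratio_lt1.
  rewrite -[g j x](subrK (peval (trunc N (d j)) x)).
  apply: le_trans (normcD _ _) _; rewrite addrC lerD //; last first.
    by rewrite mulrC; apply: (gr j).2.
  rewrite -[X in X * _ ]expr1; apply: le_trans (peval_low (N := 1) r0 (ltW xr) _) _.
    by move=> m; rewrite ltnS leqn0 mdeg_eq0 => /eqP ->; exact: mcoeff0_trunc.
  by rewrite ler_wpM2l ?exprn_ge0 ?ratio_ge0 //; exact: dr.
have scM : smaj r Mf (scomp d c) by apply: smaj_scomp dr cM2 => //; exact: ltW.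
pose Pl N := pcomp (fun j => trunc N (d j)) (trunc N c).
exists r, ((3 * Mf) + ((3 * Mf) + Mf)); split => //.
apply: (repr_approx (P := Pl)) => //.
- move=> N; apply: le_trans (wnorm_pcomp_trunc _ _ (ltW r0) rf2 dr cM2) _.
  by lra.
- by move=> N m mN; exact: scompE.
move=> x xr N; have q0 := ratio_ge0 x r0; have q1 := ratio_lt1 r0 xr.
have qN := exprn_ge0 N q0.
apply: le_trans (normc_triangle (peval (trunc N c) (G x)) _ _) _.
have -> : (vnorm x / r) ^+ N * (3 * Mf) =
  (vnorm x / r) ^+ N * Mf + (vnorm x / r) ^+ N * (2 * Mf) by ring.
have Gx2 : vnorm (G x) <= rf / 2.
  by apply: le_trans (Gx x xr) _; rewrite ler_piMl // ltW.
have h1 : normc (f (G x) - peval (trunc N c) (G x)) <= (vnorm x / r) ^+ N * Mf.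
  apply: le_trans (fc (G x) _ N) _.
    by apply: le_lt_trans Gx2 _; rewrite ltr_pdivrMr // ltr_pMr // ltr1n.
  rewrite ler_wpM2r // lerXn2r ?nnegrE ?ratio_ge0 // ler_pdivrMr //.
  apply: le_trans (Gx x xr) _; rewrite ler_wpM2l //.
  by rewrite ler_pdivrMr // ler_peMr ?(ltW rf0) ?ler1n.
apply: lerD => //; rewrite /Pl peval_pcomp.
have [C C0 lip] := peval_lipschitz (trunc N c) rf2.
pose Gt k := \row_j peval (trunc k (d j)) x.
have Gt2 k : vnorm (Gt k) <= rf / 2.
  apply/vnormP => // j; rewrite mxE; apply: le_trans (dr j k).
  exact/normc_peval/ltW.
have GGt k : vnorm (G x - Gt k) <= (vnorm x / r) ^+ k * M2.
  apply/vnormP => [|j]; first by rewrite mulr_ge0 ?exprn_ge0.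
  by rewrite !mxE; apply: (gr j).2.
(* The Lipschitz constant [C] depends on [N], so the inner map is truncated at an independent degree
   [k] going to infinity. For [k >= N] the compositions with inner degrees [k] and [N] agree below
   degree [N]. *)
apply: (@le_geometric _ _ _ (C * M2) (vnorm x / r)) => // k.
have [Nk|kN] := leqP N k; last first.
  apply: le_trans (lip _ _ Gx2 (Gt2 N)) _.
  apply: (@le_trans _ _ (C * ((vnorm x / r) ^+ k * M2))).
    rewrite ler_wpM2l //; apply: le_trans (GGt N) _; rewrite ler_wpM2r //.
    by rewrite ler_wiXn2l ?(ltW q1) // ltnW.
  rewrite (_ : C * (_ * M2) = C * M2 * (vnorm x / r) ^+ k); last by ring.
  by rewrite lerDr !mulr_ge0.
apply: le_trans (normc_triangle (peval (trunc N c) (Gt k)) _ _) _.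
rewrite addrC lerD //; last first.
  apply: le_trans (lip _ _ Gx2 (Gt2 k)) _.
  by rewrite -mulrA ler_wpM2l // mulrC.
rewrite -!peval_pcomp -pevalB.
apply: le_trans (peval_low (N := N) r0 (ltW xr) _) _.
  move=> m mN; rewrite mcoeffB !scompE ?subrr // (leq_trans mN) //.
rewrite ler_wpM2l // mulrDl mul1r.
apply: le_trans (wnormD _ _ (fun m => rpow_ge0 m (ltW r0))) _.
rewrite -scaleN1r wnormZ (@normcN R) Normc.normc1 mul1r.
by apply: lerD; apply: wnorm_pcomp_trunc dr cM2 => //; exact: ltW.
Qed.

End Evaluation.

(** * Uniqueness of the coefficients *)

Section Uniqueness.
Variable R : realType.

Lemma base_expansion_inj B k (a b : 'I_k -> nat) :
  (forall j, (a j < B)%N) -> (forall j, (b j < B)%N) ->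
  (\sum_j a j * B ^ j = \sum_j b j * B ^ j)%N -> a =1 b.
Proof.
elim: k a b => [|k IH] a b aB bB; first by move=> _ [].
have step (e : 'I_k.+1 -> nat) :
    (\sum_j e j * B ^ j = (\sum_j e (lift ord0 j) * B ^ j) * B + e ord0)%N.
  rewrite big_ord_recl expn0 muln1 addnC; congr addn.
  by rewrite big_distrl; apply: eq_bigr => j _; rewrite /= /bump add1n expnSr mulnA.
rewrite !step => eab.
have a0 : a ord0 = b ord0.
  by have := congr1 (modn^~ B) eab; rewrite !modnMDl !modn_small.
have B0 : (0 < B)%N by apply: leq_ltn_trans (aB ord0).
have /IH : (\sum_j a (lift ord0 j) * B ^ j = \sum_j b (lift ord0 j) * B ^ j)%N.
  by have := congr1 (divn^~ B) eab; rewrite !divnMDl // !divn_small // !addn0.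
move=> /(_ (fun j => aB _) (fun j => bB _)) h j.
by case: (unliftP ord0 j) => [j' ->|->].
Qed.

Variable n : nat.
Local Notation mon := (multinom n).
Local Notation ser := (mon -> R[i]).
Local Notation vec := 'rV[R[i]]_n.
Local Notation mp := (mpoly n R[i]).
Implicit Types (c : ser) (m : mon) (r M : R) (x : vec) (p : mp) (f : vec -> R[i]).

Lemma vnormZ_le (t : R) x : 0 <= t -> vnorm (t%:C *: x) <= t * vnorm x.
Proof.
move=> t0; apply/vnormP => [|j]; first by rewrite mulr_ge0 ?vnorm_ge0.
rewrite mxE Normc.normcM /= expr0n addr0 sqrtr_sqr ger0_norm //.
by rewrite ler_wpM2l ?le_vnorm.
Qed.

(* Kronecker substitution [x_j := t ^ (B ^ j)] separates the monomials of [p]. *)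
Lemma peval_eq0 p r : 0 < r -> (forall x, vnorm x < r -> peval p x = 0) -> p = 0.
Proof.
move=> r0 p0; apply/eqP/negPn/negP => pn0.
pose B := mmeasure mdg p.
have B0 : (0 < B)%N.
  by rewrite lt0n mmeasure_poly_eq0.
pose K m := (\sum_(j < n) m j * B ^ j)%N.
have suppB m j : m \in msupp p -> (m j < B)%N.
  move=> mp_; have mB : (mdg m < B)%N := mmeasure_mnm_lt mdg mp_.
  apply: leq_ltn_trans mB.
  by rewrite mdegE (bigD1 j) //= leq_addr.
pose q : {poly R[i]} := \sum_(m <- msupp p) mcoeff m p *: 'X^(K m).
pose s : R := Num.min 1 r / 2.
have m0 : 0 < Num.min 1 r :> R by rewrite lt_min ltr01.
have s0 : 0 < s by rewrite divr_gt0.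
have s1 : s <= 1 by rewrite ler_pdivrMr // ge_min; apply/orP; left; lra.
have sr : s < r.
  apply: (@lt_le_trans _ _ (Num.min 1 r)); last by rewrite ge_min lexx orbT.
  by rewrite ltr_pdivrMr // ltr_pMr // ltr1n.
have qroot (t : R) : 0 <= t -> t <= s -> root q t%:C.
  move=> t0 ts; apply/rootP.
  rewrite -[RHS](p0 (\row_j (t%:C) ^+ (B ^ j))).
    rewrite /peval mevalE horner_sum; apply: eq_bigr => m _.
    rewrite hornerZ hornerXn; congr (_ * _).
    rewrite /K -prodrXr; apply: eq_bigr => j _.
    by rewrite mxE -exprM mulnC.
  apply: le_lt_trans sr; apply/vnormP => [|j]; first exact: ltW.
  rewrite mxE normcXn /= expr0n addr0 sqrtr_sqr ger0_norm //.
  have t1 := le_trans ts s1.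
  apply: le_trans ts; rewrite -[leRHS]expr1 ler_wiXn2l //.
  by rewrite expn_gt0 B0.
(* As many distinct roots as [size q], one more than a nonzero [q] can have. *)
pose roots := [seq (s / i.+1%:R)%:C | i <- iota 0 (size q)].
have q0 : q = 0.
  apply/eqP/negPn/negP => qn0.
  have := @max_poly_roots _ q roots qn0.
  rewrite size_map size_iota ltnn => h; suff : false by []; apply: h.
    apply/allP => _ /mapP[i _ ->]; apply: qroot; first by rewrite divr_ge0 // ltW.
    by rewrite ler_pdivrMr ?ltr0n // ler_peMr ?(ltW s0) // ler1n.
  rewrite map_inj_uniq ?iota_uniq // => i j /complexI.
  move/(mulfI (lt0r_neq0 s0))/invr_inj/eqP.
  by rewrite eqr_nat eqSS => /eqP.
have : p != 0 by [].
rewrite -msupp_eq0; case E : (msupp p) => [|m s'] // _.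
have mp_ : m \in msupp p by rewrite E mem_head.
have := congr1 (fun q : {poly R[i]} => q`_(K m)) q0; rewrite coef0 coef_sum.
rewrite (bigD1_seq m) ?msupp_uniq //= big_seq_cond big1 => [|m' /andP[m'p m'm]].
  rewrite coefZ coefXn eqxx mulr1 addr0 => /eqP.
  by apply/negP; rewrite -mcoeff_msupp.
rewrite coefZ coefXn; case: eqP => [eK|_]; rewrite ?mulr0 //.
have /mnmP em : m =1 m'.
  by apply: (base_expansion_inj (B := B)) eK => j; exact: suppB.
by rewrite em eqxx in m'm.
Qed.

(** Induction on the degree k: the difference [h] of the truncations is homogeneous of degree k, but
    is bounded by a multiple of |x|^(k+1). Rescaling x by t = 2^-N and letting N grow forces [h] to
    vanish. *)
Lemma grepr_uniq c c' f : grepr c f -> grepr c' f -> c =1 c'.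
Proof.
move=> [r1 [M1 [r10 fc1]]] [r2 [M2 [r20 fc2]]].
pose r := Num.min r1 r2; have r0 : 0 < r by rewrite lt_min r10.
have {fc1} [_ fc] : repr r M1 c f by apply: repr_mono fc1; rewrite ?ge_min ?lexx.
have {fc2} [_ fc'] : repr r M2 c' f.
  by apply: repr_mono fc2; rewrite ?ge_min ?lexx ?orbT.
suff deg k m : (mdg m < k)%N -> c m = c' m by move=> m; exact: (deg (mdg m).+1).
elim: k m => // k IH m mk.
pose h := trunc k.+1 c - trunc k.+1 c'.
have hlow a : mdg a != k -> mcoeff a h = 0.
  rewrite mcoeffB !mcoeff_trunc ltnS; case: ltngtP => // [ak|]; last by rewrite subrr.
  by rewrite IH // subrr.
have hM x : vnorm x < r -> normc (peval h x) <= (vnorm x / r) ^+ k.+1 * (M1 + M2).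
  move=> xr; rewrite pevalB; apply: le_trans (normc_triangle (f x) _ _) _.
  by rewrite mulrDr lerD ?fc' // normc_distC fc.
have hhom (t : R) x : peval h (t%:C *: x) = t%:C ^+ k * peval h x.
  rewrite /peval !mevalE mulr_sumr; apply: eq_bigr => a _.
  have [<-|ak] := eqVneq (mdg a) k; last by rewrite hlow // !mul0r mulr0.
  rewrite mulrCA; congr (_ * _); rewrite mdegE -prodrXr -big_split /=.
  by apply: eq_bigr => j _; rewrite mxE exprMn.
have h0 : h = 0.
  apply: (peval_eq0 r0) => x xr; apply/eqP; rewrite -normc_eq0.
  rewrite eq_le normc_ge0 andbT.
  have half0 : 0 <= 1 / 2 :> R by lra.
  apply: (@le_geometric _ _ _ ((vnorm x / r) ^+ k.+1 * (M1 + M2)) (1 / 2)) => //.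
    lra.
  move=> N; rewrite add0r; pose t : R := (1 / 2) ^+ N.
  have t0 : 0 < t by rewrite exprn_gt0 //; lra.
  have t1 : t <= 1 by rewrite exprn_ile1 //; lra.
  have tx : vnorm (t%:C *: x) <= t * vnorm x by apply: vnormZ_le; exact: ltW.
  have txr : vnorm (t%:C *: x) < r.
    by apply: le_lt_trans xr; apply: le_trans tx _; rewrite ler_piMl ?vnorm_ge0.
  have := hM _ txr; rewrite hhom Normc.normcM normcXn /= expr0n addr0 sqrtr_sqr.
  rewrite (gtr0_norm t0) => hb.
  rewrite -(ler_pM2l (exprn_gt0 k t0)); apply: le_trans hb _.
  have M0 : 0 <= M1 + M2.
    have v0 : vnorm (0 : vec) < r.
      by apply: le_lt_trans r0; apply/vnormP => // j; rewrite mxE Normc.normc0.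
    have := fc 0 v0 0%N; have := fc' 0 v0 0%N; rewrite !expr0 !mul1r => a b.
    by apply: addr_ge0; [apply: le_trans b|apply: le_trans a]; exact: normc_ge0.
  rewrite (_ : _ * (_ * _ * _) = (t * (vnorm x / r)) ^+ k.+1 * (M1 + M2)).
    rewrite ler_wpM2r // lerXn2r ?nnegrE ?(ratio_ge0 _ r0)
      ?(mulr_ge0 (ltW t0) (ratio_ge0 x r0)) //.
    by rewrite mulrA ler_wpM2r // invr_ge0 ltW.
  have e (a b d : R) : a ^+ k * (b ^+ k.+1 * d * a) = (a * b) ^+ k.+1 * d.
    by rewrite exprMn [a ^+ k.+1]exprS; move: (b ^+ k.+1) => b'; ring.
  exact: e.
have := congr1 (mcoeff m) h0; rewrite mcoeffB mcoeff0 !mcoeff_trunc mk.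
by move/eqP; rewrite subr_eq0 => /eqP.
Qed.

End Uniqueness.

(** * Linear operations on germs and multiplication by a monomial *)

Section GermAlgebra.
Variables (R : realType) (n : nat).
Local Notation mon := (multinom n).
Local Notation ser := (mon -> R[i]).
Local Notation vec := 'rV[R[i]]_n.
Local Notation mp := (mpoly n R[i]).
Implicit Types (c : ser) (m : mon) (r M : R) (x : vec) (p : mp) (f : vec -> R[i]).

Lemma repr_peval r p : 0 < r -> repr r (wnorm (rpow r) p) (fun m => mcoeff m p) (peval p).
Proof.
move=> r0; split=> [N|x xr N].
  apply: ler_wnorm => m; rewrite mcoeff_trunc ler_wpM2l ?(rpow_ge0 _ (ltW r0)) //.
  by case: ifP => //; rewrite Normc.normc0 normc_ge0.
rewrite -pevalB; apply: le_trans (peval_low (N := N) r0 (ltW xr) _) _ => [m mN|].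
  by rewrite mcoeffB mcoeff_trunc mN subrr.
rewrite ler_wpM2l ?exprn_ge0 ?ratio_ge0 //; apply: ler_wnorm => m.
rewrite ler_wpM2l ?(rpow_ge0 _ (ltW r0)) // mcoeffB mcoeff_trunc.
by case: ifP => _; rewrite ?subrr ?subr0 ?Normc.normc0 ?normc_ge0.
Qed.

Lemma grepr_peval p : grepr (fun m => mcoeff m p) (peval p).
Proof. by exists 1, (wnorm (rpow 1) p); split; last exact: repr_peval. Qed.

Lemma truncD N c c' : trunc N (fun m => c m + c' m) = trunc N c + trunc N c'.
Proof.
by apply/mpolyP => m; rewrite mcoeffD !mcoeff_trunc; case: ifP; rewrite ?addr0.
Qed.

Lemma truncZ N a c : trunc N (fun m => a * c m) = a *: trunc N c.
Proof.
by apply/mpolyP => m; rewrite mcoeffZ !mcoeff_trunc; case: ifP; rewrite ?mulr0.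
Qed.

Lemma grepr_add c c' f f' : grepr c f -> grepr c' f' ->
  grepr (fun m => c m + c' m) (fun x => f x + f' x).
Proof.
move=> [r1 [M1 [r10 fc1]]] [r2 [M2 [r20 fc2]]].
pose r := Num.min r1 r2; have r0 : 0 < r by rewrite lt_min r10.
have {fc1} [cM1 fc] : repr r M1 c f by apply: repr_mono fc1; rewrite ?ge_min ?lexx.
have {fc2} [cM2 fc'] : repr r M2 c' f'.
  by apply: repr_mono fc2; rewrite ?ge_min ?lexx ?orbT.
exists r, (M1 + M2); split => //; split=> [N|x xr N]; rewrite truncD.
  apply: le_trans (wnormD _ _ (fun m => rpow_ge0 m (ltW r0))) _.
  by apply: lerD; [exact: cM1|exact: cM2].
rewrite pevalD opprD addrACA mulrDr; apply: le_trans (normcD _ _) _.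
by rewrite lerD ?fc ?fc'.
Qed.

Lemma grepr_scale a c f : grepr c f -> grepr (fun m => a * c m) (fun x => a * f x).
Proof.
move=> [r [M [r0 [cM fc]]]]; exists r, (normc a * M); split => //.
split=> [N|x xr N]; rewrite truncZ.
  by rewrite wnormZ ler_wpM2l ?normc_ge0.
by rewrite pevalZ -mulrBr Normc.normcM mulrCA ler_wpM2l ?normc_ge0 ?fc.
Qed.

Lemma grepr_sum (I : Type) (s : seq I) (c : I -> ser) (f : I -> vec -> R[i]) :
  (forall i, grepr (c i) (f i)) ->
  grepr (fun m => \sum_(i <- s) c i m) (fun x => \sum_(i <- s) f i x).
Proof.
move=> cf; elim: s => [|i s IH].
  have := grepr_peval (0 : mp); congr grepr; apply/funext => m.
    by rewrite big_nil mcoeff0.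
  by rewrite big_nil /peval meval0.
have := grepr_add (cf i) IH; congr grepr; apply/funext => m; by rewrite big_cons.
Qed.

Definition shift_ser (a : mon) c : ser :=
  fun m => if mpoly.lem a m then c (mnm_sub m a) else 0.

Lemma mcoeffXM a p m :
  mcoeff m (mpolyX _ a * p) = shift_ser a (fun m => mcoeff m p) m.
Proof.
rewrite /shift_ser; case: ifP => am.
  by rewrite -{1}(submK am) addmC -commr_mpolyX mcoeffMX.
apply/eqP; rewrite mcoeff_eq0; apply/negP; rewrite -commr_mpolyX.
rewrite (perm_mem (msuppMX _ _)) => /mapP[m' _ e].
by move: am; rewrite e lem_addr.
Qed.

Lemma grepr_shift a c f : grepr c f ->
  grepr (shift_ser a c) (fun x => peval (mpolyX _ a) x * f x).
Proof.
move=> [r [M [r0 [cM fc]]]]; have M0 := smaj_ge0 cM.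
have w0 (m : mon) : 0 <= rpow r m by rewrite rpow_ge0 // ltW.
pose P N := mpolyX _ a * trunc N c.
have PM N : wnorm (rpow r) (P N) <= rpow r a * M.
  apply: (@le_trans _ _ (wnorm (rpow r) (mpolyX R[i] a) * wnorm (rpow r) (trunc N c))).
    by apply: wnormM => // m m' _ _; exact: rpowM.
  by rewrite wnormX ler_wpM2l.
have Pc N m : (mdg m < N)%N -> mcoeff m (P N) = shift_ser a c m.
  move=> mN; rewrite mcoeffXM /shift_ser; case: ifP => // am.
  by rewrite mcoeff_trunc (leq_ltn_trans _ mN) // mdegB.
exists r, (rpow r a * M + (rpow r a * M + rpow r a * M)); split => //.
apply: (repr_approx r0 (P := P)) => // [N|x xr N].
  apply: le_trans (PM N); apply: ler_wnorm => m; rewrite ler_wpM2l // mcoeff_trunc.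
  by case: ifP => [mN|_]; [rewrite Pc|rewrite Normc.normc0 normc_ge0].
rewrite pevalM -mulrBr Normc.normcM mulrCA ler_pM ?normc_ge0 ?fc //.
by apply: le_trans (normc_peval _ (ltW xr)) _; rewrite wnormX.
Qed.

End GermAlgebra.

(** * Germs of holomorphic maps *)

Section Topology.
Variables (R : realType) (n : nat).
Local Notation mon := (multinom n).
Local Notation ser := (mon -> R[i]).
Local Notation vec := 'rV[R[i]]_n.
Local Notation mp := (mpoly n R[i]).
Implicit Types (c : ser) (m : mon) (r M : R) (x : vec) (p : mp) (f : vec -> R[i]).

Lemma complex_gt0 (e : R[i]) : 0 < e -> exists2 d : R, 0 < d & e = d%:C.
Proof.
case: e => a b; rewrite ltcE /= => /andP[/eqP -> a0].
by exists a.
Qed.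

Lemma near0P (P : vec -> Prop) :
  (\forall x \near (0 : vec), P x) <-> exists2 r, 0 < r & forall x, vnorm x < r -> P x.
Proof.
split=> [/nbhs_ballP[e /= /complex_gt0[r r0 ->] eP]|[r r0 rP]].
  exists r => // x xr; apply: eP; split; first by rewrite ltcR.
  move=> i j; rewrite ord1 mxE /ball /= sub0r normrN complex_normE ltcR.
  by apply: le_lt_trans xr; exact: le_vnorm.
apply/nbhs_ballP; exists (r / 2)%:C => /=; first by rewrite ltcR divr_gt0.
move=> x [_ xr]; apply: rP; apply: (@le_lt_trans _ _ (r / 2)).
  apply/vnormP => [|j]; first by rewrite divr_ge0 // ltW.
  have := xr 0 j; rewrite mxE /ball /= sub0r normrN complex_normE ltcR; exact: ltW.
by rewrite ltr_pdivrMr // ltr_pMr // ltr1n.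
Qed.

(** The norm of a row is a maximum formed among nonnegative elements of [R[i]], whose order is
    partial; it is identified through its real upper bounds. *)
Lemma normr_row x : `|x| = (vnorm x)%:C.
Proof.
have key (r : R) : 0 <= r -> (`|x| <= r%:C) = (vnorm x <= r).
  move=> r0; have r0' : 0 <= r%:C by rewrite ler0c.
  rewrite [in LHS]/Num.Def.normr /= mx_normE -[r%:C]/((NngNum r0')%:num) num_le.
  apply/bigmax_leP/(vnormP _ r0) => [[_ h] j|h].
    by have := h (0, j) isT; rewrite -num_le /= complex_normE lecR.
  split; first by rewrite -num_le.
  by move=> [i j] _; rewrite -num_le /= ord1 complex_normE lecR.
apply/eqP; rewrite eq_le key ?vnorm_ge0 // lexx /=.
have : 0 <= `|x| by [].
case E : `|x| => [a b]; rewrite lecE /= => /andP[/eqP b0 a0].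
have ex : `|x| = a%:C by rewrite E b0.
by rewrite b0 -/(a%:C) lecR -key // ex.
Qed.

Definition to_mon (Q : multiindex n) : mon := Multinom [tuple Q j | j < n].
Definition of_mon m : multiindex n := [ffun j => m j].

Lemma to_monE Q j : to_mon Q j = Q j.
Proof. by rewrite mnmE. Qed.

Lemma to_monK : cancel to_mon of_mon.
Proof. by move=> Q; apply/ffunP => j; rewrite ffunE to_monE. Qed.

Lemma of_monK : cancel of_mon to_mon.
Proof. by move=> m; apply/mnmP => j; rewrite to_monE ffunE. Qed.

Lemma mdeg_to_mon Q : mdg (to_mon Q) = mdeg Q.
Proof. by rewrite mdegE; apply: eq_bigr => j _; rewrite to_monE. Qed.

Lemma mpowE x Q : mpow x Q = peval (mpolyX _ (to_mon Q)) x.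
Proof. by rewrite pevalX; apply: eq_bigr => j _; rewrite to_monE. Qed.

(** The box partial sums that define holomorphic germs. The box of side [N] lies between the degrees
    below [N] and the degrees at most n N, which allows the comparison with [trunc]. *)
Definition boxp N c : mp := \sum_(Q : {ffun 'I_n -> 'I_N})
  c (to_mon (box_multiindex Q)) *: mpolyX _ (to_mon (box_multiindex Q)).

Lemma mcoeff_boxp N c m :
  mcoeff m (boxp N c) = if [forall j, (m j < N)%N] then c m else 0.
Proof.
rewrite raddf_sum /=; case: ifPn => [/forallP mN|/forallPn[j mj]]; last first.
  apply: big1 => Q _; rewrite mcoeffZ mcoeffX; case: eqP => [e|]; rewrite ?mulr0 //.
  by move: mj; rewrite -e to_monE ffunE ltn_ord.
pose Q0 : {ffun 'I_n -> 'I_N} := [ffun j => Ordinal (mN j)].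
have eQ0 : to_mon (box_multiindex Q0) = m.
  by apply/mnmP => j; rewrite to_monE !ffunE.
rewrite (bigD1 Q0) //= big1 => [|Q QQ0].
  by rewrite mcoeffZ mcoeffX eQ0 eqxx mulr1 addr0.
rewrite mcoeffZ mcoeffX; case: eqP => [e|]; rewrite ?mulr0 //.
move/negP: QQ0; case; apply/eqP/ffunP => j; apply: val_inj.
by rewrite ffunE /= -e to_monE ffunE.
Qed.

Lemma deg_box N m : (mdg m < N)%N -> [forall j, (m j < N)%N].
Proof.
move=> mN; apply/forallP => j; apply: leq_ltn_trans mN.
by rewrite mdegE (bigD1 j) //= leq_addr.
Qed.

Lemma box_deg N m : [forall j, (m j < N)%N] -> (mdg m < (n * N).+1)%N.
Proof.
move/forallP => mN; rewrite ltnS mdegE -[n in (n * _)%N]card_ord -sum_nat_const.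
by apply: leq_sum => j _; exact: ltnW.
Qed.

Lemma wnorm_boxp w N c : (forall m, 0 <= w m) ->
  wnorm w (boxp N c) <= wnorm w (trunc (n * N).+1 c).
Proof.
move=> w0; apply: ler_wnorm => m; rewrite mcoeff_boxp mcoeff_trunc.
case: ifP => [/box_deg ->//|_]; rewrite ler_wpM2l // Normc.normc0; exact: normc_ge0.
Qed.

Lemma wnorm_trunc_boxp w N c : (forall m, 0 <= w m) ->
  wnorm w (trunc N c) <= wnorm w (boxp N c).
Proof.
move=> w0; apply: ler_wnorm => m; rewrite mcoeff_boxp mcoeff_trunc.
case: ifP => [/deg_box ->//|_]; rewrite ler_wpM2l // Normc.normc0; exact: normc_ge0.
Qed.

Lemma peval_boxp N (c : fps R n) x :
  peval (boxp N (c \o of_mon)) x = \sum_(Q : {ffun 'I_n -> 'I_N})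
        c (box_multiindex Q) * mpow x (box_multiindex Q).
Proof.
rewrite peval_sum; apply: eq_bigr => Q _.
by rewrite pevalZ mpowE /= to_monK.
Qed.

Lemma sum_normr_box N (c : fps R n) x :
  \sum_(Q : {ffun 'I_n -> 'I_N}) `|c (box_multiindex Q) * mpow x (box_multiindex Q)|
  = peval (boxp N (fun m => (normc (c (of_mon m)))%:C)) (\row_j (normc (x 0 j))%:C).
Proof.
rewrite peval_sum; apply: eq_bigr => Q _.
rewrite pevalZ pevalX to_monK complex_normE Normc.normcM rmorphM /=; congr (_ * _).
rewrite normc_prod rmorph_prod; apply: eq_bigr => j _.
by rewrite normcXn rmorphXn mxE to_monE.
Qed.

Lemma normc_real (t : R) : 0 <= t -> normc t%:C = t.
Proof. by move=> t0; rewrite /= expr0n addr0 sqrtr_sqr ger0_norm. Qed.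

Lemma cvg_normc_le (u : nat -> R[i]) s a e N0 :
  u N @[N --> \oo] --> s -> (forall N, (N0 <= N)%N -> normc (u N - a) <= e) ->
  normc (s - a) <= e.
Proof.
move=> us ua; apply/ler_addgt0Pr => d d0.
have /cvgrPdist_le/(_ d%:C) := us; rewrite ltcR => /(_ d0)[N1 _ h].
have := h (maxn N0 N1) (leq_maxr _ _); rewrite /= complex_normE lecR => sd.
apply: le_trans (normc_triangle (u (maxn N0 N1)) _ _) _.
by rewrite addrC lerD // ua // leq_maxl.
Qed.

(** Abel's lemma: absolute convergence at the single point (r, ..., r) gives a majorant, and with it
    geometric remainders on the whole polydisc. *)
Lemma holomorphic_grepr f : holomorphic_germ f -> exists c, grepr c f.
Proof.
case=> c /near0P[r0 r00 cf]; pose r := r0 / 2.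
have r_gt0 : 0 < r by rewrite divr_gt0.
have rr0 : r < r0 by rewrite ltr_pdivrMr // ltr_pMr // ltr1n.
have w0 m : 0 <= rpow r m by rewrite rpow_ge0 // ltW.
pose x0 : vec := const_mx r%:C.
have vx0 : vnorm x0 < r0.
  apply: le_lt_trans rr0; apply/vnormP => [|j]; first exact: ltW.
  by rewrite mxE normc_real // ltW.
have [[M cM] _] := cf _ vx0; exists (c \o of_mon).
have bM N : wnorm (rpow r) (boxp N (c \o of_mon)) <= complex.Re M.
  have := cM N.
  have -> : \sum_(Q : {ffun 'I_n -> 'I_N})
     `|c (box_multiindex Q) * mpow x0 (box_multiindex Q)| =
     (\sum_(Q : {ffun 'I_n -> 'I_N}) normc (c (box_multiindex Q))
        * rpow r (to_mon (box_multiindex Q)))%:C.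
    rewrite rmorph_sum; apply: eq_bigr => Q _; rewrite complex_normE Normc.normcM.
    congr ((_ * _)%:C); rewrite normc_prod /rpow mdegE -prodrXr.
    by apply: eq_bigr => j _; rewrite normcXn mxE normc_real ?(ltW r_gt0) // to_monE.
  rewrite lecE /= => /andP[_]; apply: le_trans.
  apply: le_trans (wnorm_sum _ _ _ w0) _; apply: ler_sum => Q _.
  by rewrite wnormZ wnormX /= to_monK.
exists r, (complex.Re M); split => //; split=> [N|x xr N].
  by apply: le_trans (bM N); exact: wnorm_trunc_boxp.
have [_ fx] := cf x (lt_trans xr rr0).
apply: (cvg_normc_le (N0 := N) fx) => N' NN'; rewrite -peval_boxp -pevalB.
apply: le_trans (peval_low (N := N) r_gt0 (ltW xr) _) _ => [m mN|].
  by rewrite mcoeffB mcoeff_boxp mcoeff_trunc mN deg_box ?subrr // (leq_trans mN).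
rewrite ler_wpM2l ?exprn_ge0 ?ratio_ge0 //; apply: le_trans (bM N').
apply: ler_wnorm => m; rewrite ler_wpM2l // mcoeffB mcoeff_trunc mcoeff_boxp.
case: ltnP => mN; last by rewrite subr0.
by rewrite deg_box ?(leq_trans mN) // subrr Normc.normc0 normc_ge0.
Qed.

Lemma grepr_holomorphic c f : grepr c f -> holomorphic_germ f.
Proof.
move=> [r [M [r0 [cM fc]]]]; exists (c \o to_mon); apply/near0P; exists r => // x xr.
have w0 (m : mon) : 0 <= rpow r m by rewrite rpow_ge0 // ltW.
have q0 := ratio_ge0 x r0; have q1 := ratio_lt1 r0 xr.
have cK : (c \o to_mon) \o of_mon = c by apply/funext => m /=; rewrite of_monK.
split.
  exists M%:C => N; rewrite sum_normr_box.
  pose c' m := (normc (c m))%:C.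
  have -> : (fun m => (normc ((c \o to_mon) (of_mon m)))%:C) = c'.
    by apply/funext => m; rewrite /= of_monK.
  rewrite -[leLHS]ger0_norm; last first.
    rewrite peval_sum sumr_ge0 // => Q _; rewrite pevalZ mulr_ge0 ?ler0c ?normc_ge0 //.
    by rewrite pevalX prodr_ge0 // => j _; rewrite mxE exprn_ge0 // ler0c normc_ge0.
  rewrite complex_normE lecR; apply: (@le_trans _ _ (wnorm (rpow r) (boxp N c'))).
    apply: normc_peval; apply/vnormP => [|j]; first exact: ltW.
    rewrite mxE normc_real ?normc_ge0 //.
    by apply: le_trans (ltW xr); exact: le_vnorm.
  apply: le_trans (wnorm_boxp _ _ w0) _; apply: le_trans (cM (n * N).+1).
  rewrite !wnorm_trunc; apply: ler_sum => m _.
  by rewrite /c' normc_real ?normc_ge0.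
have bd N : normc (f x - peval (boxp N c) x) <= 3 * M * (vnorm x / r) ^+ N.
  apply: le_trans (normc_triangle (peval (trunc N c) x) _ _) _.
  have -> : 3 * M * (vnorm x / r) ^+ N =
    (vnorm x / r) ^+ N * M + (vnorm x / r) ^+ N * (M + M) by ring.
  rewrite lerD ?fc // -pevalB.
  apply: le_trans (peval_low (N := N) r0 (ltW xr) _) _ => [m mN|].
    by rewrite mcoeffB mcoeff_boxp mcoeff_trunc mN deg_box ?subrr.
  rewrite ler_wpM2l ?exprn_ge0 //; apply: le_trans (wnormD _ _ w0) _.
  rewrite lerD ?cM // -scaleN1r wnormZ (@normcN R) Normc.normc1 mul1r.
  by apply: le_trans (wnorm_boxp _ _ w0) _.
apply/cvgrPdist_le => e /complex_gt0[d d0 ->].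
have lim0 : 3 * M * (vnorm x / r) ^+ N @[N --> \oo] --> (0 : R).
  rewrite -[X in _ --> X](mulr0 (3 * M)); apply: cvgM; first exact: cvg_cst.
  by apply: cvg_expr; rewrite ger0_norm.
have /cvgrPdist_le/(_ d d0) := lim0; apply: filterS => N.
rewrite sub0r normrN => Nd; rewrite -peval_boxp cK complex_normE lecR.
by apply: le_trans (bd N) _; apply: le_trans Nd; exact: ler_norm.
Qed.

Lemma is_diff0_small (f : vec -> vec) : is_diff 0 f (fun _ => 0) -> f 0 = 0 ->
  forall e : R, 0 < e -> exists2 r, 0 < r &
    forall x, vnorm x < r -> vnorm (f x) <= e * vnorm x.
Proof.
move=> [df dfE] f0 e e0.
have /eqaddoP/(_ e%:C) := diff_locally df; rewrite ltcR => /(_ e0).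
rewrite near_simpl => /near0P[r r0 h]; exists r => // x /h.
rewrite dfE /= -[X in `|X|]/(f (x + 0) - (f 0 + 0)) addr0 f0 addr0 subr0.
by rewrite !normr_row -rmorphM lecR.
Qed.

Lemma is_diff_id_quadratic (f : vec -> vec) (C r : R) : 0 < r -> f 0 = 0 -> 0 <= C ->
  (forall x, vnorm x < r -> vnorm (f x - x) <= C * vnorm x ^+ 2) -> is_diff 0 f id.
Proof.
move=> r0 f0 C0 fC.
have cid : continuous (idfun : vec -> vec) by move=> x; exact: cvg_id.
have o0 (e : R[i]) : 0 < e ->
    \forall x \near (0 : vec), `|f (x + 0) - (f 0 + x)| <= e * `|x|.
  move=> /complex_gt0[d d0 ->]; apply/near0P; exists (Num.min r (d / (C + 1))).
    by rewrite lt_min r0 divr_gt0 // ltr_pwDr.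
  move=> x; rewrite lt_min => /andP[xr xd].
  rewrite addr0 f0 add0r !normr_row -rmorphM lecR; apply: le_trans (fC x xr) _.
  rewrite expr2 mulrA ler_wpM2r ?vnorm_ge0 //.
  move: xd; rewrite ltr_pdivlMr ?ltr_pwDr // => /ltW; apply: le_trans.
  by rewrite mulrC ler_wpM2l ?vnorm_ge0 // lerDl.
have dE : 'd f 0 = (idfun : vec -> vec) :> (vec -> vec).
  apply: (@diff_unique _ vec vec f idfun 0) => //.
  by apply/eqaddoP => e e0; rewrite near_simpl; exact: o0.
have df : differentiable f (0 : vec).
  apply/diff_locallyP; split; first by rewrite dE.
  by rewrite dE; apply/eqaddoP => e e0; rewrite near_simpl; exact: o0.
by split; [exact: df|exact: dE].
Qed.

End Topology.

(** * Composition and inversion of germs *)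

Section SeriesGerms.
Variables (R : realType) (n : nat).
Local Notation mon := (multinom n).
Local Notation ser := (mon -> R[i]).
Local Notation vec := 'rV[R[i]]_n.
Local Notation mp := (mpoly n R[i]).
Implicit Types (c : ser) (g : 'I_n -> ser) (m : mon) (r M : R) (x : vec) (p : mp)
  (f : vec -> R[i]).

Lemma grepr_bigO d c f : (forall m, (mdg m < d)%N -> c m = 0) -> grepr c f ->
  exists r C, [/\ 0 < r, 0 <= C &
    forall x, vnorm x < r -> normc (f x) <= C * vnorm x ^+ d].
Proof.
move=> c0 [r [M [r0 [cM fc]]]]; exists r, (M / r ^+ d); split => //.
  by rewrite divr_ge0 ?exprn_ge0 ?(smaj_ge0 cM) // ltW.
move=> x xr; have := fc x xr d.
have -> : trunc d c = 0.
  by apply/mpolyP => m; rewrite mcoeff_trunc mcoeff0; case: ifP => // /c0.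
rewrite /peval meval0 subr0 expr_div_n => h; apply: le_trans h _.
by rewrite [leRHS]mulrAC [M * _]mulrC [leRHS]mulrAC.
Qed.

Lemma vnorm_row_le (G : 'I_n -> vec -> R[i]) (C : R) d x : 0 <= C ->
  (forall j, normc (G j x) <= C * vnorm x ^+ d) ->
  vnorm (\row_j G j x) <= C * vnorm x ^+ d.
Proof.
move=> C0 h; apply/vnormP => [|j]; first by rewrite mulr_ge0 ?exprn_ge0 ?vnorm_ge0.
by rewrite mxE.
Qed.

Lemma grepr_map_bigO d g (G : 'I_n -> vec -> R[i]) :
  (forall j m, (mdg m < d)%N -> g j m = 0) -> (forall j, grepr (g j) (G j)) ->
  exists r C, [/\ 0 < r, 0 <= C &
    forall x, vnorm x < r -> vnorm (\row_j G j x) <= C * vnorm x ^+ d].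
Proof.
move=> g0 gG.
have [r [C [r0 C0 h]]] : exists r C, [/\ 0 < r, 0 <= C &
    forall j x, vnorm x < r -> normc (G j x) <= C * vnorm x ^+ d].
  apply: finite_uniform => [j r r' M M' r'0 r'r MM' h x xr|j].
    apply: le_trans (h x (lt_le_trans xr r'r)) _.
    by rewrite ler_wpM2r ?exprn_ge0 ?vnorm_ge0.
  by have [r [C [r0 _ h]]] := grepr_bigO (g0 j) (gG j); exists r, C.
exists r, C; split => // x xr; apply: vnorm_row_le => // j; exact: h.
Qed.

Lemma grepr_map_small g (G : 'I_n -> vec -> R[i]) :
  (forall j, g j (@mnm0 n) = 0) -> (forall j, grepr (g j) (G j)) ->
  forall e, 0 < e -> exists2 r, 0 < r & forall x, vnorm x < r -> vnorm (\row_j G j x) < e.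
Proof.
move=> g0 gG e e0.
have [|r [C [r0 C0 h]]] := grepr_map_bigO (d := 1) _ gG.
  by move=> j m; rewrite ltnS leqn0 mdeg_eq0 => /eqP ->.
exists (Num.min r (e / (C + 1))); first by rewrite lt_min r0 divr_gt0 // ltr_pwDr.
move=> x; rewrite lt_min => /andP[/h h1]; rewrite ltr_pdivlMr ?ltr_pwDr // => h2.
apply: le_lt_trans h1 _; apply: le_lt_trans h2; rewrite expr1 mulrC.
by rewrite ler_wpM2l ?vnorm_ge0 // lerDl.
Qed.

Lemma vnorm0 : vnorm (0 : vec) = 0.
Proof.
apply/eqP; rewrite eq_le vnorm_ge0 andbT; apply/vnormP => // j.
by rewrite mxE Normc.normc0.
Qed.

Lemma peval0 p : peval p 0 = mcoeff (@mnm0 n) p.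
Proof.
apply/eqP; rewrite -subr_eq0 -normc_eq0 eq_le normc_ge0 andbT.
have := @peval_low R n 1 1 (p - (mcoeff (@mnm0 n) p)%:A) 0.
rewrite ltr01 vnorm0 ler01 mul0r expr1 mul0r => /(_ isT isT).
rewrite /peval rmorphB /= -mul_mpolyC mulr1 mevalC; apply => m.
rewrite ltnS leqn0 mdeg_eq0 => /eqP ->.
by rewrite mcoeffB mcoeffC eqxx mulr1 subrr.
Qed.

Lemma grepr_at0 c f : grepr c f -> f 0 = c (@mnm0 n).
Proof.
move=> [r [M [r0 [_ /(_ 0)]]]]; rewrite vnorm0 => /(_ r0 1%N).
rewrite mul0r expr1 mul0r peval0 mcoeff_trunc mdeg0 /= => h.
by apply/eqP; rewrite -subr_eq0 -normc_eq0 eq_le h normc_ge0.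
Qed.

Lemma peval_homog k p (t : R) x : (forall m, mdg m != k -> mcoeff m p = 0) ->
  peval p (t%:C *: x) = t%:C ^+ k * peval p x.
Proof.
move=> pk; rewrite /peval !mevalE mulr_sumr; apply: eq_bigr => a _.
have [<-|ak] := eqVneq (mdg a) k; last by rewrite pk // !mul0r mulr0.
rewrite mulrCA; congr (_ * _); rewrite mdegE -prodrXr -big_split /=.
by apply: eq_bigr => j _; rewrite mxE exprMn.
Qed.

(** The truncation below degree 2 is homogeneous of degree one, so rescaling [x] turns the o(|x|)
    bound on [f] into a bound on this linear part by every positive number. *)
Lemma grepr_linear_part c f : grepr c f -> c (@mnm0 n) = 0 ->
  (forall e : R, 0 < e -> exists2 r, 0 < r &
     forall x, vnorm x < r -> normc (f x) <= e * vnorm x) ->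
  forall m, (mdg m < 2)%N -> c m = 0.
Proof.
move=> [r [M [r0 [cM fc]]]] c0 small m m2.
suff h0 : trunc 2 c = 0 by have := congr1 (mcoeff m) h0; rewrite mcoeff_trunc m2 mcoeff0.
have M0 := smaj_ge0 cM.
apply: (peval_eq0 r0) => x xr; apply/eqP; rewrite -normc_eq0 eq_le normc_ge0 andbT.
apply/ler_addgt0Pr => e e0; rewrite add0r.
pose e' := e / (vnorm x + 1).
have x1 : 0 < vnorm x + 1 by rewrite ltr_pwDr // vnorm_ge0.
have e'0 : 0 < e' by rewrite divr_gt0.
have [s s0 sP] := small e' e'0.
apply: (@le_trans _ _ (e' * vnorm x)); last first.
  by rewrite /e' mulrAC ler_pdivrMr // ler_wpM2l ?(ltW e0) // lerDl.
pose q : R := 1 / 2; have q0 : 0 < q by rewrite /q; lra.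
have q1 : q < 1 by rewrite /q; lra.
(* [u] brings [x] into the radius [s] where the o(|x|) bound holds; the further factors [q ^+ N] let
   the quadratic remainder disappear. *)
pose u : R := Num.min 1 (s / (vnorm x + 1)).
have u0 : 0 < u by rewrite lt_min ltr01 divr_gt0.
have u1 : u <= 1 by rewrite ge_min lexx.
have us : u * vnorm x < s.
  apply: (@lt_le_trans _ _ (u * (vnorm x + 1))); first by rewrite ltr_pM2l // ltrDl.
  by rewrite -ler_pdivlMr // ge_min lexx orbT.
apply: (@le_geometric _ _ _ (u * ((vnorm x / r) ^+ 2 * M)) q) => // [|N]; first exact: ltW.
pose t := u * q ^+ N.
have t0 : 0 < t by rewrite mulr_gt0 ?exprn_gt0.
have tu : t <= u by rewrite ler_piMr ?(ltW u0) // exprn_ile1 ?(ltW q0) ?(ltW q1).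
have tx : vnorm (t%:C *: x) <= t * vnorm x by apply: vnormZ_le; exact: ltW.
have txs : vnorm (t%:C *: x) < s.
  apply: le_lt_trans us; apply: le_trans tx _; by rewrite ler_wpM2r ?vnorm_ge0.
have txr : vnorm (t%:C *: x) < r.
  apply: le_lt_trans xr; apply: le_trans tx _.
  by rewrite ler_piMl ?vnorm_ge0 // (le_trans tu).
have hom : peval (trunc 2 c) (t%:C *: x) = t%:C ^+ 1 * peval (trunc 2 c) x.
  apply: peval_homog => a; rewrite mcoeff_trunc; case: ltnP => // a2 a1.
  suff -> : a = @mnm0 n by [].
  by apply/eqP; rewrite -mdeg_eq0; move: a1 a2; case: (mdg a) => [|[|]].
have h : t * normc (peval (trunc 2 c) x) = normc (peval (trunc 2 c) (t%:C *: x)).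
  by rewrite hom expr1 Normc.normcM normc_real ?(ltW t0).
have h1 := sP _ txs; have h2 := fc _ txr 2%N.
rewrite -(ler_pM2l t0) h -[peval _ _](subrK (f (t%:C *: x))).
apply: le_trans (normcD _ _) _; rewrite normc_distC.
apply: le_trans (lerD h2 h1) _.
apply: (@le_trans _ _ ((t * (vnorm x / r)) ^+ 2 * M + e' * (t * vnorm x))).
  apply: lerD; last by rewrite ler_wpM2l // ltW.
  rewrite ler_wpM2r // lerXn2r ?nnegrE ?(ratio_ge0 _ r0) //.
    exact: mulr_ge0 (ltW t0) (ratio_ge0 x r0).
  by rewrite mulrA ler_wpM2r // invr_ge0 ltW.
rewrite /t; move: (vnorm x / r) (q ^+ N) (vnorm x) => A B D.
by rewrite le_eqVlt; apply/orP; left; apply/eqP; ring.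
Qed.

Lemma scompD g c c' m : scomp g (fun m => c m + c' m) m = scomp g c m + scomp g c' m.
Proof. by rewrite /scomp truncD pcompD mcoeffD. Qed.

Lemma scompZ g a c m : scomp g (fun m => a * c m) m = a * scomp g c m.
Proof. by rewrite /scomp truncZ pcompZ mcoeffZ. Qed.

Lemma scomp_sX g j m : (forall i, g i (@mnm0 n) = 0) -> scomp g (sX R j) m = g j m.
Proof.
move=> g0; transitivity (mcoeff m (pcomp (fun i => trunc (mdg m).+1 (g i))
    (mpolyX R[i] (mnm1 j)))).
  apply: (eqon_pcompl (N := (mdg m).+1)) => // [i|]; first exact: mcoeff0_trunc.
  exact: eqon_truncX.
by rewrite pcompX mcoeff_trunc ltnSn.
Qed.

Lemma scomp_low d g c m : (forall i, g i (@mnm0 n) = 0) ->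
  (forall m, (mdg m < d)%N -> c m = 0) -> (mdg m < d)%N -> scomp g c m = 0.
Proof.
move=> g0 c0 md.
have -> : 0 = mcoeff m (pcomp (fun i => trunc (mdg m).+1 (g i)) 0).
  by rewrite pcomp_mmap mmap0 mcoeff0.
apply: (eqon_pcompl (N := (mdg m).+1)) => // [i|a am]; first exact: mcoeff0_trunc.
by rewrite mcoeff_trunc am c0 ?mcoeff0 // (leq_trans am).
Qed.

Lemma mcoeff0_pcomp (g : 'I_n -> mp) p : (forall i, mcoeff (@mnm0 n) (g i) = 0) ->
  mcoeff (@mnm0 n) (pcomp g p) = mcoeff (@mnm0 n) p.
Proof.
move=> g0; transitivity (mcoeff (@mnm0 n) (pcomp g (mcoeff (@mnm0 n) p)%:A)).
  apply: (eqon_pcompl (N := 1)) => //; last by rewrite mdeg0.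
  move=> m; rewrite ltnS leqn0 mdeg_eq0 => /eqP ->.
  by rewrite mcoeffZ mcoeff1 eqxx mulr1.
by rewrite pcompZ pcomp_mmap rmorph1 mcoeffZ mcoeff1 eqxx mulr1.
Qed.

Lemma mprod_diag (d : 'I_n -> R[i]) m :
  mprod (fun k => d k *: mpolyX R[i] (mnm1 k)) m = (\prod_k d k ^+ m k) *: mpolyX _ m.
Proof.
elim/mon_ind: m => [|i m IH].
  by rewrite mprod0 mpolyX0 big1 ?scale1r // => k _; rewrite mnm0E.
rewrite mprod_addU IH mpolyXD -scalerAl -scalerAr scalerA; congr (_ *: _).
rewrite (bigD1 i) //= [RHS](bigD1 i) //= mnmDE mnm1E eqxx add1n exprS mulrA.
congr (_ * _); apply: eq_bigr => k ki.
by rewrite mnmDE mnm1E eq_sym (negbTE ki) add0n.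
Qed.

Lemma mcoeff_pcomp_diag (d : 'I_n -> R[i]) p m :
  mcoeff m (pcomp (fun k => d k *: mpolyX R[i] (mnm1 k)) p)
  = (\prod_k d k ^+ m k) * mcoeff m p.
Proof.
pose k := maxn (mmeasure mdg p) (mdg m).+1.
have mk : (mdg m < k)%N by rewrite leq_max ltnSn orbT.
rewrite (pcompE (k := k)) ?leq_maxl // raddf_sum /=.
rewrite (bigD1 (BMultinom mk)) //= big1 => [|a am].
  by rewrite mcoeffZ mprod_diag mcoeffZ mcoeffX eqxx mulr1 addr0 mulrC.
rewrite mcoeffZ mprod_diag mcoeffZ mcoeffX; case: eqP => [e|]; rewrite ?mulr0 //.
by move/negP: am; case; apply/eqP/val_inj.
Qed.

Lemma smaj_le r M c c' : 0 <= r -> (forall m, normc (c' m) <= normc (c m)) ->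
  smaj r M c -> smaj r M c'.
Proof.
move=> r0 cc' cM N; apply: le_trans (cM N); rewrite !wnorm_trunc.
by apply: ler_sum => m _; rewrite ler_wpM2l ?rpow_ge0.
Qed.

Lemma sconv_le c c' : (forall m, normc (c' m) <= normc (c m)) -> sconv c -> sconv c'.
Proof.
move=> cc' [r [M [r0 cM]]]; exists r, M; split => //.
exact: smaj_le (ltW r0) cc' cM.
Qed.

Lemma sXE j : sX R j = (fun m => mcoeff m (mpolyX R[i] (mnm1 j))).
Proof. by apply/funext => m; rewrite /sX mcoeffX eq_sym. Qed.

Lemma grepr_sX j : grepr (sX R j) (fun x => x 0 j).
Proof.
have := grepr_peval (mpolyX R[i] (mnm1 j : mon)); rewrite -sXE; congr grepr.
by apply/funext => x; rewrite /peval mevalXU.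
Qed.

Lemma sX0 j : sX R j (@mnm0 n) = 0.
Proof. by rewrite /sX eq_sym mnm1_eq0. Qed.

Definition Xplus (psi : 'I_n -> ser) j : ser := fun m => sX R j m + psi j m.

Definition flat (psi : 'I_n -> ser) := forall j m, (mdg m < 2)%N -> psi j m = 0.

Lemma Xplus0 psi j : flat psi -> Xplus psi j (@mnm0 n) = 0.
Proof. by move=> fpsi; rewrite /Xplus sX0 fpsi ?mdeg0 ?addr0. Qed.

(* The reversion is the fixed point of [phi = - psi o (X + phi)]: the same
   majorant argument, with all divisors equal to [-1]. *)
Lemma series_reversion psi : flat psi -> (forall j, sconv (psi j)) ->
  exists phi : 'I_n -> ser, [/\ flat phi, forall j, sconv (phi j) &
    forall j, scomp (Xplus phi) (Xplus psi j) =1 sX R j].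
Proof.
move=> fpsi cpsi.
have gain1 : gained predT (fun (j : 'I_n) m => normc (- 1 : R[i])) 0.
  move=> L; exists (fun _ => 0); split=> [Q|Q|P Q|j P Q _ _ _ _];
    rewrite ?mul0r ?addr0 //.
  by rewrite (@normcN R) Normc.normc1 mul1r.
have [phi [phi0 phiE cphi]] := fixed_point (f := fun _ : 'I_1 => psi)
  (fun _ _ => ord0) (fun _ => fpsi) (fun _ => cpsi) (lexx 0) gain1.
have fphi : flat phi by move=> j m m2; apply: phi0; rewrite /= -ltnNge.
exists phi; split => // j m.
have X0 i : Xplus phi i (@mnm0 n) = 0 := Xplus0 i fphi.
rewrite [Xplus psi j]/Xplus scompD scomp_sX //.
rewrite {1}/Xplus -addrA; apply/eqP; rewrite -subr_eq0 addrAC subrr add0r.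
have [m2|m2] := ltnP (mdg m) 2.
  by rewrite fphi // add0r (scomp_low X0 (fpsi j) m2).
by rewrite phiE // divrN divr1 addNr.
Qed.

Lemma grepr_Xplus psi (G : 'I_n -> vec -> R[i]) :
  (forall j, grepr (psi j) (G j)) ->
  forall j, grepr (Xplus psi j) (fun x => x 0 j + G j x).
Proof. by move=> h j; apply: grepr_add; [exact: grepr_sX|]. Qed.

Lemma right_inverse_germ psi (P : vec -> vec) : flat psi ->
  (forall j, grepr (Xplus psi j) (fun x => P x 0 j)) ->
  exists phi (Q : vec -> vec), [/\ flat phi,
    forall j, grepr (Xplus phi j) (fun x => Q x 0 j) &
    exists2 r, 0 < r & forall x, vnorm x < r -> P (Q x) = x].
Proof.
move=> fpsi gP.
have cpsi j : sconv (psi j).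
  have := grepr_add (gP j) (grepr_scale (-1) (grepr_sX j)) => /grepr_sconv.
  by congr sconv; apply/funext => m; rewrite /Xplus mulN1r addrAC subrr add0r.
have [phi [fphi cphi phiE]] := series_reversion fpsi cpsi.
have /choice[q qP] : forall j, exists f, grepr (phi j) f.
  by move=> j; exact: sconv_grepr.
exists phi, (fun x => \row_j (x 0 j + q j x)); split; first exact: fphi.
  move=> j; have := grepr_Xplus qP j; congr grepr; apply/funext => x.
  by rewrite mxE.
suff [r [M [r0 _ h]]] : exists r M, [/\ 0 < r, 0 <= M &
    forall j x, vnorm x < r -> P (\row_j (x 0 j + q j x)) 0 j = x 0 j].
  by exists r => // x xr; apply/rowP => j; exact: h.
apply: finite_uniform => [j r r' _ _ _ r'r _ h x xr|j].
  exact: h (lt_le_trans xr r'r).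
have := grepr_scomp (fun i => Xplus0 i fphi) (gP j) (grepr_Xplus qP).
have -> : scomp (Xplus phi) (Xplus psi j) = sX R j by apply/funext; exact: phiE.
by move=> /grepr_eq/(_ (grepr_sX j))[r r0 h]; exists r, 0.
Qed.

Lemma Xplus_small psi (P : vec -> vec) : flat psi ->
  (forall j, grepr (Xplus psi j) (fun x => P x 0 j)) ->
  forall e, 0 < e -> exists2 r, 0 < r & forall x, vnorm x < r -> vnorm (P x) < e.
Proof.
move=> fpsi gP e e0; have [r r0 h] := grepr_map_small (fun j => Xplus0 j fpsi) gP e0.
exists r => // x /h; congr (vnorm _ < _); apply/rowP => j; by rewrite mxE.
Qed.

(** The right inverse [Q] has itself a right inverse [P'], and P = P Q P' = P' near 0, so [Q] is
    two-sided. *)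
Lemma inverse_germ psi (P : vec -> vec) : flat psi ->
  (forall j, grepr (Xplus psi j) (fun x => P x 0 j)) ->
  exists phi (Q : vec -> vec), [/\ flat phi,
    forall j, grepr (Xplus phi j) (fun x => Q x 0 j),
    exists2 r, 0 < r & forall x, vnorm x < r -> P (Q x) = x &
    exists2 r, 0 < r & forall x, vnorm x < r -> Q (P x) = x].
Proof.
move=> fpsi gP; have [phi [Q [fphi gQ [r r0 PQ]]]] := right_inverse_germ fpsi gP.
exists phi, Q; split => //; first by exists r.
have [psi' [P' [fpsi' gP' [r' r'0 QP']]]] := right_inverse_germ fphi gQ.
have [s s0 sP'] := Xplus_small fpsi' gP' r0.
exists (Num.min r' s) => [|x]; first by rewrite lt_min r'0.
rewrite lt_min => /andP[xr' xs].
have -> : P x = P' x by rewrite -{1}(QP' x xr') PQ // sP'.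
exact: QP'.
Qed.

Lemma Xplus_is_diff psi (P : vec -> vec) : flat psi ->
  (forall j, grepr (Xplus psi j) (fun x => P x 0 j)) -> P 0 = 0 /\ is_diff 0 P id.
Proof.
move=> fpsi gP.
have P0 : P 0 = 0.
  by apply/rowP => j; rewrite (grepr_at0 (gP j)) Xplus0 // mxE.
have gpsi j : grepr (psi j) (fun x => P x 0 j - x 0 j).
  have := grepr_add (gP j) (grepr_scale (-1) (grepr_sX j)); congr grepr.
    by apply/funext => m; rewrite /Xplus mulN1r addrAC subrr add0r.
  by apply/funext => x; rewrite mulN1r.
have [r [C [r0 C0 h]]] := grepr_map_bigO fpsi gpsi.
split => //; apply: (is_diff_id_quadratic r0 P0 C0) => x /h.
by congr (vnorm _ <= _); apply/rowP => j; rewrite !mxE.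
Qed.

End SeriesGerms.

(** * Monomial ideals and small divisors *)

Section SummableLogs.
Variable R : realType.

Lemma sum_half_powers N : \sum_(k < N) (2 ^+ k.+1)^-1 <= 1 :> R.
Proof.
suff -> : \sum_(k < N) (2 ^+ k.+1)^-1 = 1 - (2 ^+ N)^-1 :> R.
  by rewrite gerBl invr_ge0 exprn_ge0.
elim: N => [|N IH]; first by rewrite big_ord0 expr0 invr1 subrr.
rewrite big_ord_recr /= IH exprS invfM.
by move: ((2 ^+ N)^-1 : R) => a; field.
Qed.

(** The nonnegative numbers M - t dominate the negative parts of [t]. If the weighted sums of the
    latter were unbounded, the partial sums of the series would tend to -oo. *)
Lemma negative_part_summable (t : nat -> R) (M : R) : 0 <= M -> (forall k, t k <= M) ->
  (- (\sum_(1 <= k <oo) (t k / 2 ^+ k)%:E) < +oo)%E ->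
  exists U, forall N, \sum_(k < N) Num.max 0 (- t k.+1) / 2 ^+ k.+1 <= U.
Proof.
move=> M0 tM; apply: contraPP => /forallNP nU.
suff -> : (\sum_(1 <= k <oo) (t k / 2 ^+ k)%:E)%E = -oo%E by rewrite /= ltxx.
apply: cvg_lim => //; apply/cvgeNyPle => A.
have /existsNP[N /negP] := nU (M - A); rewrite -ltNge => UN.
exists N.+1 => // -[//|n] /= Nn; rewrite sumEFin lee_fin.
rewrite big_add1 /= big_mkord.
have p0 k : 0 <= (2 ^+ k)^-1 :> R by rewrite invr_ge0 exprn_ge0.
have le1 : \sum_(k < N) Num.max 0 (- t k.+1) / 2 ^+ k.+1 <=
    \sum_(k < n) (M - t k.+1) / 2 ^+ k.+1.
  apply: (@le_trans _ _ (\sum_(k < N) (M - t k.+1) / 2 ^+ k.+1)).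
    apply: ler_sum => k _; rewrite ler_wpM2r // ge_max subr_ge0 tM /=.
    by rewrite lerDr.
  rewrite -!(big_mkord xpredT (fun k => (M - t k.+1) / 2 ^+ k.+1)).
  rewrite [leRHS](big_cat_nat (n := N)) //= lerDl sumr_ge0 // => k _.
  by rewrite mulr_ge0 // subr_ge0.
have eq1 : \sum_(k < n) (M - t k.+1) / 2 ^+ k.+1 =
    M * (\sum_(k < n) (2 ^+ k.+1)^-1) - \sum_(k < n) t k.+1 / 2 ^+ k.+1.
  by rewrite mulr_sumr -sumrB; apply: eq_bigr => k _; rewrite mulrBl.
have := ler_wpM2l M0 (sum_half_powers n).
by move: UN le1; rewrite eq1 mulr1; lra.
Qed.

End SummableLogs.

(** * Membership in a monomial ideal read on coefficients *)

Section MonomialIdeal.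
Variables (R : realType) (n p : nat) (Rs : 'I_p -> multiindex n).
Local Notation mon := (multinom n).
Local Notation ser := (mon -> R[i]).
Local Notation vec := 'rV[R[i]]_n.
Local Notation mp := (mpoly n R[i]).
Implicit Types (c : ser) (m : mon).

Definition outside : pred mon := fun m => [forall k, ~~ mpoly.lem (to_mon (Rs k)) m].

Lemma outside_down : down_closed outside.
Proof.
move=> m m' /forallP h; split; apply/forallP => k; apply: contra (h k) => km.
  by rewrite (lepm_trans km) // lem_addr.
by rewrite (lepm_trans km) // lem_addl.
Qed.

(** By uniqueness of the coefficients, the coefficient 1 of x^Q comes from a multiple of some
    generator, which therefore divides x^Q. *)
Lemma monomial_ideal_mpow Q :
  monomial_ideal Rs (fun x : vec => mpow x Q) -> ~~ outside (to_mon Q).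
Proof.
case=> g [/(_ _)/holomorphic_grepr gh /near0P[r r0 hE]].
have /choice[c cP] : forall k, exists c, grepr c (g k) by move=> k; exact: gh.
have gs : grepr (fun m => \sum_(k <- index_enum 'I_p) shift_ser (to_mon (Rs k)) (c k) m)
    (fun x => \sum_(k <- index_enum 'I_p) peval (mpolyX _ (to_mon (Rs k))) x * g k x).
  by apply: grepr_sum => k; exact: grepr_shift.
have gQ := grepr_peval (mpolyX R[i] (to_mon Q)).
have /(grepr_uniq gQ)/(_ (to_mon Q)) : grepr
    (fun m => \sum_(k <- index_enum 'I_p) shift_ser (to_mon (Rs k)) (c k) m)
    (peval (mpolyX R[i] (to_mon Q))).
  apply: grepr_ext r0 _ gs => x /hE; rewrite -mpowE => ->.
  by apply: eq_bigr => k _; rewrite mpowE.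
rewrite mcoeffX eqxx /= => e1; apply/negP => /forallP out.
move/eqP: e1; rewrite big1 ?oner_eq0 // => k _.
by rewrite /shift_ser (negbTE (out k)).
Qed.

Lemma wnorm_mulX r (a : mon) (q : mp) :
  wnorm (rpow r) (q * mpolyX _ a) = rpow r a * wnorm (rpow r) q.
Proof.
rewrite /wnorm (perm_big _ (msuppMX q a)) big_map mulr_sumr.
apply: eq_bigr => m _; rewrite mcoeffMX mulrA; congr (_ * _).
by rewrite /rpow mdegD exprD.
Qed.

Lemma sconv_unshift (a : mon) c c' :
  (forall m, normc (c' m) <= normc (c (mnm_add a m))) -> sconv c -> sconv c'.
Proof.
move=> cc' [r [M [r0 cM]]]; exists r, (M / rpow r a); split => // N.
have ra : 0 < rpow r a by rewrite exprn_gt0.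
rewrite ler_pdivlMr // mulrC -wnorm_mulX.
apply: le_trans (cM (mdg a + N)%N); apply: ler_wnorm => m.
rewrite ler_wpM2l ?(rpow_ge0 _ (ltW r0)) // [_ * mpolyX _ _]commr_mpolyX mcoeffXM.
rewrite /shift_ser; case: ifP => [am|_]; last by rewrite Normc.normc0 normc_ge0.
rewrite mcoeff_trunc; case: ltnP => mN; last by rewrite Normc.normc0 normc_ge0.
have em : m = mnm_add a (mnm_sub m a) by rewrite addmC submK.
rewrite mcoeff_trunc {2}em mdegD ltn_add2l mN.
by rewrite [in leRHS]em.
Qed.

(** Each monomial is charged to one picked generator among those dividing it, so that nothing is
    counted twice; the quotients inherit convergence from [c]. *)
Lemma mem_monomial_ideal c (h : vec -> R[i]) : grepr c h ->
  (forall m, outside m -> c m = 0) -> monomial_ideal Rs h.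
Proof.
move=> ch c0; pose R_ k := to_mon (Rs k).
pose first m := [pick k | mpoly.lem (R_ k) m].
pose ck k m := if first (mnm_add (R_ k) m) == Some k then c (mnm_add (R_ k) m) else 0.
have sk k : sconv (ck k).
  apply: (sconv_unshift (a := R_ k)) (grepr_sconv ch) => m.
  by rewrite /ck; case: ifP => // _; rewrite Normc.normc0 normc_ge0.
have /choice[g gP] : forall k, exists f, grepr (ck k) f.
  by move=> k; exact: sconv_grepr.
have gs : grepr (fun m => \sum_(k <- index_enum 'I_p) shift_ser (R_ k) (ck k) m)
    (fun x => \sum_(k <- index_enum 'I_p) peval (mpolyX _ (R_ k)) x * g k x).
  by apply: grepr_sum => k; exact: grepr_shift.
have cE : (fun m => \sum_(k <- index_enum 'I_p) shift_ser (R_ k) (ck k) m) = c.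
  apply/funext => m.
  have skE k : shift_ser (R_ k) (ck k) m = if first m == Some k then c m else 0.
    rewrite /shift_ser /ck; case: ifP => [km|km].
      by rewrite addmC submK.
    rewrite /first; case: pickP => [k' k'm|//]; case: eqP => // -[e].
    by rewrite -e k'm in km.
  under eq_bigr do rewrite skE.
  case E : (first m) => [k0|].
    rewrite (bigD1 k0) //= eqxx big1 ?addr0 // => k kk0.
    by rewrite (inj_eq Some_inj) eq_sym (negbTE kk0).
  rewrite big1 //; symmetry; apply: c0; apply/forallP => k.
  by move: E; rewrite /first; case: pickP => // /(_ k) ->.
rewrite cE in gs; have [r r0 hE] := grepr_eq ch gs.
exists g; split=> [k|]; first exact: grepr_holomorphic (gP k).
apply/near0P; exists r => // x /hE ->; apply: eq_bigr => k _.
by rewrite mpowE.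
Qed.

End MonomialIdeal.

(** * Lower bounds and gaps for the small divisors *)

Section SmallDivisors.
Variables (R : realType) (n l p : nat) (mu : 'I_l -> 'rV[R[i]]_n).
Variables (Rs : 'I_p -> multiindex n).
Local Notation mon := (multinom n).
Local Notation I := (monomial_ideal (R := R) Rs).
Implicit Types (m : mon).
Hypothesis mu_neq0 : forall i j, mu i 0 j != 0.
Hypothesis D_diophantine : diophantine mu I.
Hypothesis D_centralizer : centralizer_generated mu Rs.

Lemma small_divisor_ge0 Q j : 0 <= small_divisor mu Q j.
Proof.
by rewrite /small_divisor; elim/big_rec: _ => // i v _ v0; rewrite le_max v0 orbT.
Qed.

Lemma le_small_divisor Q j i : normc (mpow (mu i) Q - mu i 0 j) <= small_divisor mu Q j.
Proof. exact: (le_bigmax _ (fun i => normc (mpow (mu i) Q - mu i 0 j))). Qed.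

Lemma small_divisor_neq0 m j : outside Rs m -> (2 <= mdg m)%N ->
  small_divisor mu (of_mon m) j != 0.
Proof.
move=> Sm m2; apply: contraL Sm => /eqP sd0; rewrite -[m]of_monK.
apply: (@monomial_ideal_mpow R); apply: (D_centralizer (j := j)).
  by rewrite -mdeg_to_mon of_monK.
move=> i; apply/eqP; rewrite -subr_eq0 -normc_eq0 eq_le normc_ge0 andbT -sd0.
exact: le_small_divisor.
Qed.

Lemma small_divisor_attained m j : 0 < small_divisor mu (of_mon m) j ->
  exists i, small_divisor mu (of_mon m) j = normc (mpow (mu i) (of_mon m) - mu i 0 j).
Proof.
move=> sd0; have /bigmax_geP[h|[i _ h]] := lexx (small_divisor mu (of_mon m) j).
  by have := lt_le_trans sd0 h; rewrite ltxx.
by exists i; apply/eqP; rewrite eq_le h le_small_divisor.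
Qed.

Lemma outside_omega k m j : outside Rs m -> (2 <= mdg m <= 2 ^ k)%N ->
  (omega mu I k <= (small_divisor mu (of_mon m) j)%:E)%E.
Proof.
move=> Sm /andP[m2 mk]; apply: ereal_inf_lbound; exists (of_mon m), j; split => //.
- by rewrite -mdeg_to_mon of_monK m2.
- by move/monomial_ideal_mpow; rewrite of_monK Sm.
exact: small_divisor_neq0.
Qed.

Lemma omega_gt0 k : (0 < omega mu I k)%E.
Proof.
have [r [_ [r0 _ h]]] : exists r M : R, [/\ 0 < r, 0 <= M &
    forall t : bmultinom n (2 ^ k).+1 * 'I_n,
      small_divisor mu (of_mon t.1) t.2 != 0 -> r <= small_divisor mu (of_mon t.1) t.2].
  apply: finite_uniform => [t r r' _ _ _ r'r _ h /h|t]; first exact: le_trans.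
  have [->|sd0] := eqVneq (small_divisor mu (of_mon t.1) t.2) 0; first by exists 1, 0.
  exists (small_divisor mu (of_mon t.1) t.2), 0; split => //.
  by rewrite lt_def sd0 small_divisor_ge0.
apply: (@lt_le_trans _ _ r%:E); first by rewrite lte_fin.
apply/ereal_infP => _ [Q [j [/andP[_ Qk] _ sd0 ->]]]; rewrite lee_fin.
have Qk' : (mdg (to_mon Q) < (2 ^ k).+1)%N by rewrite mdeg_to_mon.
by have := h (BMultinom Qk', j); rewrite /= to_monK; apply.
Qed.

Lemma omega_nonincreasing k k' : (k <= k')%N -> (omega mu I k' <= omega mu I k)%E.
Proof.
move=> kk'; apply/ereal_infP => _ [Q [j [/andP[Q2 Qk] IQ sd0 ->]]].
apply: ereal_inf_lbound; exists Q, j; split => //.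
by rewrite Q2 (leq_trans Qk) // leq_exp2l.
Qed.

Let t k := ln (fine (omega mu I k)).

(** [omega] is nonincreasing, so its logarithm is bounded above from any finite value on, and only
    finitely many terms precede. If [omega] is never finite, every term is ln 0 = 0. *)
Lemma log_omega_bounded : exists2 M, 0 <= M & forall k, t k <= M.
Proof.
have [[k0 k0P]|noinf] := pselect (exists k, omega mu I k \is a fin_num).
  exists (\sum_(k < k0.+1) `|t k|); first exact: sumr_ge0.
  have le_sum k : (k <= k0)%N -> t k <= \sum_(k < k0.+1) `|t k|.
    move=> kk0; apply: le_trans (ler_norm _) _.
    by rewrite (bigD1 (Ordinal (kk0 : (k < k0.+1)%N))) //= lerDl sumr_ge0.
  move=> k; have [/le_sum //|/ltnW k0k] := leqP k k0.
  apply: le_trans (le_sum k0 (leqnn _)).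
  have := omega_nonincreasing k0k; have := omega_gt0 k; move: k0P; rewrite /t.
  case: (omega mu I k0) => // b _; case: (omega mu I k) => // a.
  by rewrite lte_fin lee_fin => a0 ab; rewrite /= ler_ln ?posrE // (lt_le_trans a0).
exists 0 => // k; rewrite /t; have := omega_gt0 k.
case E : (omega mu I k) => [a||] //=; last by rewrite ln0.
by case: noinf; exists k; rewrite E.
Qed.

Lemma diophantine_bounds : exists u : nat -> R, exists U,
  [/\ forall k, 0 <= u k,
      forall N, \sum_(k < N) u k.+1 / 2 ^+ k.+1 <= U &
      forall k j m, outside Rs m -> (2 <= mdg m <= 2 ^ k)%N ->
        expR (- u k) <= small_divisor mu (of_mon m) j].
Proof.
have [M M0 tM] := log_omega_bounded.
have [U hU] := negative_part_summable M0 tM D_diophantine.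
(* The positive part of - ln omega. In the last clause [omega] is finite, being at most the divisor
   of an actual monomial. *)
exists (fun k => Num.max 0 (- t k)), U; split => //.
  by move=> k; rewrite le_max lexx.
move=> k j m Sm mk; have := outside_omega j Sm mk; have := omega_gt0 k.
rewrite /t; case: (omega mu I k) => // a; rewrite lte_fin lee_fin /= => a0.
apply: le_trans; rewrite -{2}(lnK (x := a)) ?posrE // ler_expR.
by rewrite lerNl le_max lexx orbT.
Qed.

Lemma mpow_normc (x : 'rV[R[i]]_n) m : mpow x (of_mon m) = \prod_j x 0 j ^+ m j.
Proof. by apply: eq_bigr => j _; rewrite ffunE. Qed.

Lemma mpowD (x : 'rV[R[i]]_n) m m' :
  mpow x (of_mon (mnm_add m m')) = mpow x (of_mon m) * mpow x (of_mon m').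
Proof.
by rewrite !mpow_normc -big_split; apply: eq_bigr => j _; rewrite mnmDE exprD.
Qed.

Lemma mpow1 (x : 'rV[R[i]]_n) s : mpow x (of_mon (mnm1 s)) = x 0 s.
Proof. by rewrite mpowE of_monK /peval mevalXU. Qed.

(* The divisor of [x^P] is transported to [x^(P + e_s)], where [e_s <= Q] keeps
   the monomial outside the ideal. *)
Lemma divisor_gap (d D theta e : R) (j : 'I_n) (P Q : mon) :
  0 < d -> 0 < D -> (forall i s, d <= normc (mu i 0 s) /\ normc (mu i 0 s) <= D) ->
  theta <= 1 / 2 * d -> theta <= d / (4 * D) -> 0 < theta -> 0 < e -> e <= 1 ->
  outside Rs (mnm_add Q P) -> P != @mnm0 n -> (2 <= mdg Q)%N ->
  small_divisor mu (of_mon Q) j < theta * e ->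
  small_divisor mu (of_mon (mnm_add Q P)) j < theta * e ->
  exists s m, [/\ outside Rs m, mdg m = (mdg P).+1 & small_divisor mu (of_mon m) s < e].
Proof.
move=> d0 D0 muP th1 th2 th0 e0 e1 SQP P0 Q2 sQ sQP.
have [s [Q' eQ]] : exists s Q', Q = mnm_add (mnm1 s) Q'.
  by apply: mnm_neq0; rewrite -mdeg_eq0 -lt0n (ltn_trans _ Q2).
pose m := mnm_add P (mnm1 s).
have Sm : outside Rs m.
  by move: SQP; rewrite eQ addmC addmA => /outside_down[].
have dm : mdg m = (mdg P).+1 by rewrite mdegD mdeg1 addn1.
exists s, m; split => //.
have m2 : (2 <= mdg m)%N by rewrite dm ltnS lt0n mdeg_eq0.
have sd0 : 0 < small_divisor mu (of_mon m) s.
  by rewrite lt_def small_divisor_ge0 andbT small_divisor_neq0.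
have [i ->] := small_divisor_attained sd0.
rewrite mpowD mpow1 -[X in _ - X]mul1r -mulrBl Normc.normcM.
(* Both hypotheses hold for every index, in particular for this [i]. As mu^Q is within d / 2 of
   mu_j, its modulus is at least d / 2; since mu^Q z = mu^(Q+P) - mu^Q is below 2 theta e, |z| is
   below 4 theta e / d, and the choice of [theta] keeps |z| D below [e]. *)
set z := mpow (mu i) (of_mon P) - 1; set y := mpow (mu i) (of_mon Q).
have [ds Ds] := muP i s; have [dj _] := muP i j.
have hQ := le_lt_trans (le_small_divisor (of_mon Q) j i) sQ.
have hQP := le_lt_trans (le_small_divisor (of_mon (mnm_add Q P)) j i) sQP.
have hyz : normc y * normc z < 2 * (theta * e).
  rewrite -Normc.normcM.
  have -> : y * z = (mpow (mu i) (of_mon (mnm_add Q P)) - mu i 0 j)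
    - (mpow (mu i) (of_mon Q) - mu i 0 j) by rewrite mpowD /z /y; ring.
  apply: le_lt_trans (normcB _ _) _; rewrite mulrDl mul1r; exact: ltrD.
have hy : d / 2 <= normc y.
  have := normc_triangle y (mu i 0 j) 0; rewrite !subr0 normc_distC => h.
  have : theta * e <= theta by rewrite ler_piMr // ltW.
  by move: hQ; rewrite -/y; lra.
have hz : normc z * d < 4 * (theta * e).
  have : d / 2 * normc z <= normc y * normc z by rewrite ler_wpM2r ?normc_ge0.
  have := normc_ge0 z.
  by lra.
rewrite ler_pdivlMr ?mulr_gt0 // in th2.
have hzD : normc z * normc (mu i 0 s) <= normc z * D by rewrite ler_wpM2l ?normc_ge0.
apply: le_lt_trans hzD _; rewrite -(ltr_pM2r d0).
apply: (@lt_le_trans _ _ (4 * (theta * e) * D)).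
  by rewrite mulrAC ltr_pM2r.
have : theta * (4 * D) * e <= d * e by rewrite ler_wpM2r // ltW.
by lra.
Qed.

Lemma gained_small_divisors : exists2 K, 0 <= K &
  gained (outside Rs) (fun j m => small_divisor mu (of_mon m) j) K.
Proof.
have [u [U [u0 uU usd]]] := diophantine_bounds.
have [d [M [d0 M0 muP]]] : exists r M, [/\ 0 < r, 0 <= M & forall t : 'I_l * 'I_n,
    r <= normc (mu t.1 0 t.2) /\ normc (mu t.1 0 t.2) <= M].
  apply: finite_uniform => [ij r r' M M' _ r'r MM' [h1 h2]|ij].
    by split; [exact: le_trans r'r h1|exact: le_trans h2 MM'].
  exists (normc (mu ij.1 0 ij.2)), (normc (mu ij.1 0 ij.2)).
  by rewrite normc_gt0 mu_neq0.
pose D := M + 1; have D0 : 0 < D by rewrite ltr_pwDr.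
pose theta := Num.min 1 (Num.min (1 / 2 * d) (d / (4 * D))).
have th0 : 0 < theta by rewrite !lt_min ltr01 !divr_gt0 ?mulr_gt0 //; lra.
have th1 : theta <= 1 by rewrite ge_min lexx.
apply: (gained_divisors th0 th1 u0 _ _ uU) => [k j m Sm mk|k j P Q SQP P0 Q2 sQ sQP].
  exact: usd.
have e0 := expR_gt0 (- u k.+1).
have e1 : expR (- u k.+1) <= 1 by rewrite -expR0 ler_expR oppr_le0.
have muP' i s : d <= normc (mu i 0 s) /\ normc (mu i 0 s) <= D.
  have [h1 h2] := muP (i, s); split => //.
  by apply: le_trans h2 _; rewrite lerDl.
have [||s [m [Sm dm sm]]] := divisor_gap d0 D0 muP' _ _ th0 e0 e1 SQP P0 Q2 sQ sQP.
- by rewrite !ge_min lexx orbT.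
- by rewrite !ge_min lexx !orbT.
(* |P| < 2^(k+1) leaves room for the extra variable: P + e_s still has degree at most 2^(k+1). *)
rewrite leqNgt; apply/negP => Pk.
have : expR (- u k.+1) <= small_divisor mu (of_mon m) s.
  by apply: usd Sm _; rewrite dm Pk ltnS lt0n mdeg_eq0 P0.
by rewrite leNgt sm.
Qed.

End SmallDivisors.

(** * The conjugacy *)

Section FormalConjugacy.
Variables (R : realType) (n l : nat) (mu : 'I_l -> 'rV[R[i]]_n).
Local Notation mon := (multinom n).
Local Notation ser := (mon -> R[i]).
Implicit Types (m : mon) (i : 'I_l) (j : 'I_n).
Variables (cF : 'I_l -> 'I_n -> ser) (S : pred mon) (psi : 'I_n -> ser).
Variable (sel : 'I_n -> mon -> 'I_l).
Hypothesis S_down : down_closed S.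
Hypothesis cF_linear : forall i j m, (mdg m < 2)%N -> cF i j m = mu i 0 j * sX R j m.
Hypothesis cF_comm : forall i i' j, scomp (cF i) (cF i' j) =1 scomp (cF i') (cF i j).
Hypothesis psi_flat : flat psi.

Definition nonlinear_part i j : ser := fun m => if (mdg m < 2)%N then 0 else cF i j m.

Definition eigen i m : R[i] := \prod_k mu i 0 k ^+ m k.

Hypothesis eigen_sel : forall j m, S m -> (2 <= mdg m)%N ->
  eigen (sel j m) m - mu (sel j m) 0 j != 0.
Hypothesis psiE : forall j m, S m -> (2 <= mdg m)%N ->
  psi j m = scomp (Xplus psi) (nonlinear_part (sel j m) j) m
    / (eigen (sel j m) m - mu (sel j m) 0 j).

Let Psi := Xplus psi.

Let Psi0 j : Psi j (@mnm0 n) = 0. Proof. exact: Xplus0. Qed.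

Let cF_split i j : cF i j = fun m => mu i 0 j * sX R j m + nonlinear_part i j m.
Proof.
apply/funext => m; rewrite /nonlinear_part; case: ltnP => m2.
  by rewrite addr0 cF_linear.
rewrite /sX; case: eqP => [em|_]; last by rewrite mulr0 add0r.
by move: m2; rewrite em mdeg1.
Qed.

Let cF0 i j : cF i j (@mnm0 n) = 0.
Proof. by rewrite cF_linear ?mdeg0 // sX0 mulr0. Qed.

(** The coefficient of F_i o Psi - Psi o D_i. *)
Let err i j m := scomp Psi (cF i j) m - eigen i m * Psi j m.

Let scomp_cF i j m :
  scomp Psi (cF i j) m = mu i 0 j * Psi j m + scomp Psi (nonlinear_part i j) m.
Proof. by rewrite {1}cF_split scompD scompZ scomp_sX. Qed.

Let err_low i j m : (mdg m < 2)%N -> err i j m = 0.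
Proof.
move=> m2; rewrite /err scomp_cF (scomp_low (d := 2)) // => [|a a2]; last first.
  by rewrite /nonlinear_part a2.
rewrite addr0 /Psi /Xplus psi_flat // addr0 /sX; case: eqP => [->|_].
  rewrite mulr1 mulr1 /eigen (bigD1 j) //= mnm1E eqxx expr1 big1 ?mulr1 ?subrr //.
  by move=> k kj; rewrite mnm1E eq_sym (negbTE kj).
by rewrite !mulr0 subrr.
Qed.

Let err_sel j m : S m -> (2 <= mdg m)%N -> err (sel j m) j m = 0.
Proof.
move=> Sm m2; rewrite /err scomp_cF.
have -> : scomp Psi (nonlinear_part (sel j m) j) m
    = psi j m * (eigen (sel j m) m - mu (sel j m) 0 j).
  by rewrite psiE // divfK // eigen_sel.
rewrite /Psi /Xplus /sX; case: eqP => [em|_]; first by move: m2; rewrite em mdeg1.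
by rewrite add0r; ring.
Qed.

Let D i k : mpoly n R[i] := mu i 0 k *: mpolyX _ (mnm1 k).

(* Both orders of [F_i o F_i' o Psi] are expanded at [m], knowing the conjugacy
   equation in lower degree. *)
Let err_cross i i' j m : S m ->
  (forall i j a, S a -> (mdg a < mdg m)%N -> err i j a = 0) ->
  (eigen i m - mu i 0 j) * err i' j m = (eigen i' m - mu i' 0 j) * err i j m.
Proof.
move=> Sm IH; pose N := (mdg m).+1; have mN : (mdg m < N)%N by [].
pose Pp k := trunc N (Psi k); pose Fp i k := trunc N (cF i k).
have Pp0 k : mcoeff (@mnm0 n) (Pp k) = 0 by exact: mcoeff0_trunc.
have Fp0 i0 k : mcoeff (@mnm0 n) (Fp i0 k) = 0 by exact: mcoeff0_trunc.
pose Y i k := pcomp Pp (Fp i k); pose Z i k := pcomp (D i) (Pp k).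
have YE i0 k a : (mdg a < N)%N -> mcoeff a (Y i0 k) = scomp Psi (cF i0 k) a.
  by move=> aN; rewrite /Y /Pp /Fp scompE.
have ZE i0 k a : (mdg a < N)%N -> mcoeff a (Z i0 k) = eigen i0 a * Psi k a.
  by move=> aN; rewrite /Z mcoeff_pcomp_diag mcoeff_trunc aN.
have Y0 i0 k : mcoeff (@mnm0 n) (Y i0 k) = 0 by rewrite /Y mcoeff0_pcomp.
have D0 i0 k : mcoeff (@mnm0 n) (D i0 k) = 0.
  by rewrite mcoeffZ mcoeffX mnm1_eq0 mulr0.
have Z0 i0 k : mcoeff (@mnm0 n) (Z i0 k) = 0 by rewrite /Z mcoeff0_pcomp.
(* F_b o F_a o Psi. Inside the nonlinear part of F_b only lower degrees matter, where F_a o Psi may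
   be replaced by Psi o D_a; composing with D_a multiplies the coefficient at [m] by [eigen a m].
   Exchanging [a] and [b] gives the claim. *)
have key a b : mcoeff m (pcomp Pp (pcomp (Fp a) (Fp b j))) =
    mu b 0 j * err a j m + eigen a m * (err b j m + eigen b m * Psi j m).
  have fpE : Fp b j = mu b 0 j *: trunc N (sX R j) + trunc N (nonlinear_part b j).
    by rewrite /Fp cF_split truncD truncZ.
  have split_ (g : 'I_n -> mpoly n R[i]) : (forall k, mcoeff (@mnm0 n) (g k) = 0) ->
      mcoeff m (pcomp g (Fp b j)) = mu b 0 j * mcoeff m (g j)
        + mcoeff m (pcomp g (trunc N (nonlinear_part b j))).
    move=> g0; rewrite fpE pcompD pcompZ mcoeffD mcoeffZ; congr (_ * _ + _).
    rewrite -(pcompX g j); apply: (eqon_pcompl (N := N)) => //.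
    exact: eqon_truncX.
  have nlE : mcoeff m (pcomp (Y a) (trunc N (nonlinear_part b j))) =
      mcoeff m (pcomp (Z a) (trunc N (nonlinear_part b j))).
    apply: (eqon_pcomp_gain (P := fun c => S c && (mdg c <= mdg m)%N)
      (Q := fun c => S c && (mdg c < mdg m)%N)) => //.
    - move=> c c'; rewrite mdegD => /andP[/S_down[-> ->] cm].
      by split; apply: leq_ltn_trans cm; rewrite ?leq_addr ?leq_addl.
    - move=> c c'; rewrite -!mdeg_eq0 mdegD => c0 c'0 /andP[/S_down[-> ->]] /=.
      by lia.
    - move=> k c /andP[Sc cm]; have cN := ltn_trans cm mN.
      by rewrite YE // ZE //; apply/eqP; rewrite -subr_eq0; apply/eqP/IH.
    - by move=> c c2; rewrite mcoeff_trunc /nonlinear_part c2 if_same.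
    by rewrite Sm leqnn.
  rewrite pcompA (split_ (Y a)) // nlE.
  have := split_ (Z a) (Z0 a); rewrite /Z -pcompA mcoeff_pcomp_diag -/(Y b j).
  rewrite -/(Z a j) -/(eigen a m) YE // ZE // => h.
  have -> : mcoeff m (pcomp (fun k => pcomp (D a) (Pp k)) (trunc N (nonlinear_part b j)))
    = eigen a m * scomp Psi (cF b j) m - mu b 0 j * (eigen a m * Psi j m).
    by rewrite h addrAC subrr add0r.
  by rewrite YE // /err; ring.
have comm : mcoeff m (pcomp Pp (pcomp (Fp i) (Fp i' j))) =
    mcoeff m (pcomp Pp (pcomp (Fp i') (Fp i j))).
  apply: (eqon_pcompl (N := N)) => // a aN.
  by rewrite /Fp !scompE // cF_comm.
by move: comm; rewrite !key => e; apply/eqP; rewrite -subr_eq0; apply/eqP;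
  move: e => /eqP; rewrite -subr_eq0 => /eqP e; rewrite -[RHS]e; ring.
Qed.

(** [err_cross] is applied against the selected index, whose error vanishes by construction of psi
    and whose divisor is nonzero. *)
Lemma formal_conjugacy i j m : S m -> scomp Psi (cF i j) m = eigen i m * Psi j m.
Proof.
move=> Sm; apply/eqP; rewrite -subr_eq0; apply/eqP; rewrite -/(err i j m).
have [k] := ubnP (mdg m); elim: k i j m Sm => // k IH i j m Sm mk.
have [m2|m2] := ltnP (mdg m) 2; first exact: err_low.
have := @err_cross (sel j m) i j m Sm.
rewrite (err_sel j Sm m2) mulr0 => h; apply/eqP; move: h.
move=> /(_ (fun i j a Sa am => IH i j a Sa (leq_trans am mk)))/eqP.
by rewrite mulf_eq0 (negbTE (eigen_sel j Sm m2)).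
Qed.

(** On the divisor-closed set [S], F_i o Psi may be replaced by Psi o D_i inside phi, and phi o Psi
    = id leaves D_i. *)
Lemma conjugated_series i (phi : 'I_n -> ser) j m : S m ->
  scomp Psi (phi j) =1 sX R j ->
  scomp (fun k => scomp Psi (cF i k)) (phi j) m = mu i 0 j * sX R j m.
Proof.
move=> Sm inv; pose N := (mdg m).+1; have mN : (mdg m < N)%N by [].
pose G k := scomp Psi (cF i k).
have G0 k : G k (@mnm0 n) = 0.
  rewrite /G (scomp_low (d := 1)) ?mdeg0 // => a.
  by rewrite ltnS leqn0 mdeg_eq0 => /eqP ->.
have G0' k : mcoeff (@mnm0 n) (trunc N (G k)) = 0 by exact: mcoeff0_trunc.
rewrite -(scompE (N := N) (N' := N) _ G0) //.
have -> : mcoeff m (pcomp (fun k => trunc N (G k)) (trunc N (phi j))) =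
    mcoeff m (pcomp (fun k => pcomp (D i) (trunc N (Psi k))) (trunc N (phi j))).
  apply: (eqon_pcomp (P := fun c => S c && (mdg c < N)%N)).
  - move=> c c'; rewrite mdegD => /andP[/S_down[-> ->] cm].
    by split; apply: leq_ltn_trans cm; rewrite ?leq_addr ?leq_addl.
  - move=> k c /andP[Sc cN].
    by rewrite mcoeff_trunc cN mcoeff_pcomp_diag mcoeff_trunc cN /G formal_conjugacy.
  by rewrite Sm.
rewrite -pcompA mcoeff_pcomp_diag scompE // inv /sX; case: eqP => [->|_].
  rewrite (bigD1 j) //= mnm1E eqxx expr1 big1 ?mulr1 //.
  by move=> k kj; rewrite mnm1E eq_sym (negbTE kj).
by rewrite !mulr0.
Qed.

End FormalConjugacy.

(** * From series back to germs *)

Section Assembly.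
Variables (R : realType) (n : nat).
Local Notation mon := (multinom n).
Local Notation ser := (mon -> R[i]).
Local Notation vec := 'rV[R[i]]_n.

Lemma mul_diag (d x : vec) j : (x *m diag_mx d) 0 j = d 0 j * x 0 j.
Proof. by rewrite mul_mx_diag mxE mulrC. Qed.

Lemma diag_unit_neq0 (d : vec) j : diag_mx d \in unitmx -> d 0 j != 0.
Proof.
by rewrite unitmxE det_diag unitfE => /prodf_neq0/(_ j isT).
Qed.

Lemma germ_series (F f : vec -> vec) (d : vec) : diffeo_germ F ->
  (\forall x \near (0 : vec), F x = x *m diag_mx d + f x) ->
  f 0 = 0 -> is_diff 0 f (fun _ => 0) ->
  exists c : 'I_n -> ser, (forall j, grepr (c j) (fun x => F x 0 j)) /\
    forall j m, (mdg m < 2)%N -> c j m = d 0 j * sX R j m.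
Proof.
case=> G [[F0 _] holF _ _ _] /near0P[r r0 FE] f0 df0.
have /choice[c cF] : forall j, exists c, grepr c (fun x => F x 0 j).
  by move=> j; exact: holomorphic_grepr (holF j).
exists c; split => // j m m2.
have gf : grepr (fun m => c j m + (- d 0 j) * sX R j m) (fun x => f x 0 j).
  apply: (@grepr_ext _ _ _ (fun x => F x 0 j + (- d 0 j) * x 0 j) _ r r0).
    by move=> x /FE ->; rewrite mxE mul_diag; ring.
  exact: grepr_add (cF j) (grepr_scale _ (grepr_sX R j)).
have c0 : c j (@mnm0 n) + (- d 0 j) * sX R j (@mnm0 n) = 0.
  by rewrite -(grepr_at0 gf) f0 mxE.
have := grepr_linear_part gf c0 _ m2; rewrite mulNr => h.
apply/eqP; rewrite -subr_eq0; apply/eqP/h => e e0.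
have [s s0 sP] := is_diff0_small df0 f0 e0; exists s => // x xs.
by apply: le_trans (le_vnorm _ j) (sP x xs).
Qed.

Lemma inverse_diffeo_of_series (psi phi : 'I_n -> ser) (P Q : vec -> vec) :
  flat psi -> flat phi ->
  (forall j, grepr (Xplus psi j) (fun x => P x 0 j)) ->
  (forall j, grepr (Xplus phi j) (fun x => Q x 0 j)) ->
  (exists2 r, 0 < r & forall x, vnorm x < r -> P (Q x) = x) ->
  (exists2 r, 0 < r & forall x, vnorm x < r -> Q (P x) = x) ->
  inverse_diffeo_germs Q P.
Proof.
move=> fpsi fphi gP gQ PQ QP; split.
- by split; [exact: (Xplus_is_diff fphi gQ).1|exact: (Xplus_is_diff fpsi gP).1].
- by move=> j; exact: grepr_holomorphic (gQ j).
- by move=> j; exact: grepr_holomorphic (gP j).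
- exact/near0P.
exact/near0P.
Qed.

(** The empty family is treated apart because selecting an equation requires an index. *)
Lemma id_linearizes (l : nat) (mu : 'I_l -> vec) F (I : set (vec -> R[i])) :
  ('I_l -> False) -> holomorphically_linearizable mu F I.
Proof.
move=> no; pose z (j : 'I_n) : ser := fun _ => 0.
have fz : flat z by [].
have gid j : grepr (Xplus z j) (fun x : vec => id x 0 j).
  by have := grepr_sX R j; congr grepr; apply/funext => m; rewrite /Xplus addr0.
exists id, id; split; last by move=> i; case: (no i).
- by apply: (inverse_diffeo_of_series fz fz gid gid); exists 1.
exact: (Xplus_is_diff fz gid).2.
Qed.

End Assembly.

Theorem corollary2p1 (R : realType) (n l p : nat)
    (mu : 'I_l -> 'rV[R[i]]_n)
    (F f : 'I_l -> 'rV[R[i]]_n -> 'rV[R[i]]_n)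
    (Rs : 'I_p -> multiindex n)
    (F_diffeo : forall i : 'I_l, diffeo_germ (F i))
    (F_abelian : forall i i' : 'I_l,
       \forall x \near (0 : 'rV[R[i]]_n), F i (F i' x) = F i' (F i x))
    (F_expansion : forall i : 'I_l,
       \forall x \near (0 : 'rV[R[i]]_n), F i x = x *m diag_mx (mu i) + f i x)
    (f_0 : forall i : 'I_l, f i 0 = 0)
    (df_0 : forall i : 'I_l, is_diff 0 (f i) (fun _ => 0))
    (D_invertible : forall i : 'I_l, diag_mx (mu i) \in unitmx)
    (Rs_generate : generate_invariants mu Rs)
    (D_diophantine : diophantine mu (monomial_ideal Rs))
    (D_centralizer : centralizer_generated mu Rs) :
  holomorphically_linearizable mu F (monomial_ideal Rs).
Proof.
have [[i0 _]|noi] := pselect (exists i : 'I_l, True); last first.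
  by apply: id_linearizes => i; apply: noi; exists i.
have mu_neq0 i j : mu i 0 j != 0 by exact: diag_unit_neq0.
have /choice[cF cFP] : forall i, exists c : 'I_n -> multinom n -> R[i],
    (forall j, grepr (c j) (fun x => F i x 0 j)) /\
    forall j m, (mdg m < 2)%N -> c j m = mu i 0 j * sX R j m.
  by move=> i; exact: germ_series (F_diffeo i) (F_expansion i) (f_0 i) (df_0 i).
have gF i j : grepr (cF i j) (fun x => F i x 0 j) := (cFP i).1 j.
have cF_linear i := (cFP i).2.
have cF0 i j : cF i j (@mnm0 n) = 0.
  by rewrite cF_linear ?mdeg0 // sX0 mulr0.
(* Commutation of the germs passes to their series by uniqueness of the coefficients. *)
have cF_comm i i' j : scomp (cF i) (cF i' j) =1 scomp (cF i') (cF i j).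
  have g1 := grepr_scomp (cF0 i) (gF i' j) (gF i).
  have g2 := grepr_scomp (cF0 i') (gF i j) (gF i').
  have [r r0 comm] := (near0P _).1 (F_abelian i' i).
  apply: grepr_uniq (g1) _; apply: grepr_ext r0 _ g2 => x /comm.
  have row_F k : \row_j F k x 0 j = F k x by apply/rowP => a; rewrite mxE.
  by rewrite !row_F => ->.
have [K K0 gainK] := gained_small_divisors mu_neq0 D_diophantine D_centralizer.
pose S := outside Rs.
(* An index attaining the maximum in the small divisor; [i0] is a default where no equation is
   solved. *)
have /choice[sel selP] : forall jm : 'I_n * multinom n, exists i,
    S jm.2 -> (2 <= mdg jm.2)%N -> small_divisor mu (of_mon jm.2) jm.1 =
      normc (eigen mu i jm.2 - mu i 0 jm.1).
  move=> [j m] /=; have [[Sm m2]|no] := pselect (S m /\ (2 <= mdg m)%N); last first.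
    by exists i0 => Sm m2; case: no.
  have sd0 : 0 < small_divisor mu (of_mon m) j.
    by rewrite lt_def small_divisor_ge0 andbT (small_divisor_neq0 D_centralizer).
  have [i ->] := small_divisor_attained sd0; exists i => _ _.
  by rewrite /eigen mpow_normc.
pose sl j m := sel (j, m).
pose div j m := eigen mu (sl j m) m - mu (sl j m) 0 j.
have normc_div j m : S m -> (2 <= mdg m)%N ->
    normc (div j m) = small_divisor mu (of_mon m) j.
  by move=> Sm m2; rewrite (selP (j, m)).
have gain : gained S (fun j m => normc (div j m)) K.
  move=> L; have [lam [lam0 lamK lamD lamG]] := gainK L.
  exists lam; split => // j P Q P0 Q0 SPQ PQL; rewrite normc_div ?lamG //.
  by move: P0 Q0; rewrite -!mdeg_eq0 mdegD; lia.
pose nl := nonlinear_part cF.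
have nl_low i j m : (mdg m < 2)%N -> nl i j m = 0.
  by move=> m2; rewrite /nl /nonlinear_part m2.
have nl_conv i j : sconv (nl i j).
  apply: sconv_le (grepr_sconv (gF i j)) => m; rewrite /nl /nonlinear_part.
  by case: ifP => // _; rewrite Normc.normc0 normc_ge0.
have [psi [psi0 psiE cpsi]] := fixed_point sl nl_low nl_conv K0 gain.
have fpsi : flat psi by move=> j m m2; apply: psi0; rewrite (leqNgt 2) m2 andbF.
have /choice[q qP] : forall j, exists g, grepr (psi j) g.
  by move=> j; exact: sconv_grepr.
pose Psi (x : 'rV[R[i]]_n) : 'rV[R[i]]_n := \row_j (x 0 j + q j x).
have gPsi j : grepr (Xplus psi j) (fun x => Psi x 0 j).
  by have := grepr_Xplus qP j; congr grepr; apply/funext => x; rewrite mxE.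
have [phi [Phi [fphi gPhi PsiPhi PhiPsi]]] := inverse_germ fpsi gPsi.
exists Phi, Psi; split.
- exact: (inverse_diffeo_of_series fpsi fphi gPsi gPhi PsiPhi PhiPsi).
- exact: (Xplus_is_diff fphi gPhi).2.
have Psi0 k : Xplus psi k (@mnm0 n) = 0 := Xplus0 k fpsi.
have row_eta (G : 'rV[R[i]]_n -> 'rV[R[i]]_n) x : \row_j G x 0 j = G x.
  by apply/rowP => a; rewrite mxE.
have inv j : scomp (Xplus psi) (Xplus phi j) =1 sX R j.
  have [r r0 h] := PhiPsi.
  apply: grepr_uniq (grepr_scomp Psi0 (gPhi j) gPsi) _.
  by apply: grepr_ext r0 _ (grepr_sX R j) => x /h; rewrite row_eta => ->.
move=> i j.
have eigen_sl k m : S m -> (2 <= mdg m)%N -> eigen mu (sl k m) m - mu (sl k m) 0 k != 0.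
  move=> Sm m2; rewrite -normc_eq0 -/(div k m) normc_div //.
  exact: (small_divisor_neq0 D_centralizer).
pose G k := scomp (Xplus psi) (cF i k).
have gG k : grepr (G k) (fun x => F i (Psi x) 0 k).
  have := grepr_scomp Psi0 (gF i k) gPsi; congr grepr; apply/funext => x.
  by rewrite row_eta.
have G0 k : G k (@mnm0 n) = 0.
  rewrite /G (scomp_low (d := 1)) ?mdeg0 // => a.
  by rewrite ltnS leqn0 mdeg_eq0 => /eqP ->.
have gH : grepr (fun m => scomp G (Xplus phi j) m + (- mu i 0 j) * sX R j m)
    (fun x => (Phi (F i (Psi x)) - x *m diag_mx (mu i)) 0 j).
  have := grepr_add (grepr_scomp G0 (gPhi j) gG)
    (grepr_scale (- mu i 0 j) (grepr_sX R j)).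
  congr grepr; apply/funext => x.
  have -> : \row_k F i (Psi x) 0 k = F i (Psi x).
    by apply/rowP => a; rewrite mxE.
  have subE (A B : 'rV[R[i]]_n) : (A - B) 0 j = A 0 j - B 0 j by rewrite !mxE.
  by rewrite subE mul_diag mulNr.
apply: (mem_monomial_ideal gH) => m Sm.
have S_down : down_closed S := @outside_down _ _ _.
have conj := conjugated_series S_down cF_linear cF_comm fpsi eigen_sl psiE.
by rewrite [scomp G _ m](conj i (Xplus phi) j m Sm (inv j)) mulNr subrr.
Qed.
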